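(* Let $\mathrm L_i=(\mathrm D-\alpha_i\mathrm I)^{N_i}$ for $i\in\{1,2\}$, with $N_i\ge1$ an integer and $\alpha_i\in\mathbb R$, and let $((\mathbf p_1,\mathbf p_2),(\boldsymbol\phi_1,\boldsymbol\phi_2))$ be an $[\mathrm L_1\otimes\mathrm L_2]$-admissible system. Let $\langle\cdot,\boldsymbol\nu\rangle:\mathcal M_{\mathrm L_1\otimes\mathrm L_2}(\mathbb R^2)\to\mathbb R^M$ be linear, weak$^\star$-continuous, surjective, and injective on $\mathcal N_{\mathrm L_1}\otimes\mathcal N_{\mathrm L_2}$. Let $E:\mathbb R^M\times\mathbb R^M\to\mathbb R^+\cup\{\infty\}$ be proper, coercive, lower semicontinuous, and strictly convex in its second argument; let $\mathbf y\in\mathbb R^M$ and $\lambda>0$. Then the solution set $$\mathcal V=\underset{f\in\mathcal M_{\mathrm L_1\otimes\mathrm L_2}(\mathbb R^2)}{\mathrm{argmin}}\ \Big(E(\mathbf y,\langle f,\boldsymbol\nu\rangle)+\lambda|f|_{\mathcal M_{\mathrm L_1\otimes\mathrm L_2}}\Big)$$ is nonempty, weak$^\star$-compact, and is the weak$^\star$-closed convex hull of its extreme points, which all are of the form $$\begin{aligned}f^\star(t_1,t_2)=&\sum_{k=1}^Ka_kg_{\boldsymbol\phi_1}(t_1,x_{1,k})g_{\boldsymbol\phi_2}(t_2,x_{2,k})+\sum_{n=1}^{N_1}\sum_{m=1}^{K_{1,n}}b_{n,m}p_{1,n}(t_1)g_{\boldsymbol\phi_2}(t_2,y_{n,m})\\&+\sum_{n'=1}^{N_2}\sum_{m'=1}^{K_{2,n'}}c_{n',m'}g_{\boldsymbol\phi_1}(t_1,z_{n',m'})p_{2,n'}(t_2)+\sum_{n=1}^{N_1}\sum_{n'=1}^{N_2}d_{n,n'}p_{1,n}(t_1)p_{2,n'}(t_2)\end{aligned}$$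 with real weights $a_k,b_{n,m},c_{n',m'},d_{n,n'}$, knots $(x_{1,k},x_{2,k})\in\mathbb R^2$, $y_{n,m}\in\mathbb R$, $z_{n',m'}\in\mathbb R$, and $$K+\sum_{n=1}^{N_1}K_{1,n}+\sum_{n'=1}^{N_2}K_{2,n'}\le M-N_1N_2.$$
   Context: **Operators.** $\mathrm D$ is the derivative on $\mathcal D'(\mathbb R)$. For $\mathrm L=(\mathrm D-\alpha\mathrm I)^N$: $\mathcal N_{\mathrm L}\subset\mathcal D'(\mathbb R)$ is its null space (dimension $N$), $g_{\mathrm L}(t)=\frac{t_+^{N-1}e^{\alpha t}}{(N-1)!}$ its causal Green's function ($t_+^0=\mathbf 1_{t\ge0}$), $\mathrm L^\star=(-\mathrm D-\alpha\mathrm I)^N$ its adjoint, and $g^\vee(t)=g(-t)$. $\mathcal C_0(\mathbb R^d)$ is the space of continuous functions vanishing at infinity and $\mathcal M(\mathbb R^d)$, its dual, the space of bounded Radon measures with the total-variation norm. **Admissible systems.** A universal $\mathrm L$-admissible system is a pair $(\mathbf p,\tilde{\boldsymbol\phi})$ with $\mathbf p=(p_n)_{n=1}^N$ a basis of $\mathcal N_{\mathrm L}$ and $\tilde\phi_n\in\mathcal D(\mathbb R)$ (smooth, compactly supported) with $\langle p_n,\tilde\phi_m\rangle=\delta_{n-m}$. With such $\tilde{\boldsymbol\phi}$, put $\mathcal C_{\mathrm L}(\mathbb R)=\{\mathrm L^\star v+\sum_na_n\tilde\phi_n:\ v\in\mathcal C_0(\mathbb R),\ a_n\in\mathbb R\}$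 (independent of the choice of universal system). An $\mathrm L$-admissible system $(\mathbf p,\boldsymbol\phi)$ consists of a basis $\mathbf p$ of $\mathcal N_{\mathrm L}$ and compactly supported $\phi_n\in\mathcal C_{\mathrm L}(\mathbb R)$, $\mathrm{supp}(\phi_n)\subset[\phi^-,\phi^+]$, with $\langle p_n,\phi_m\rangle=\delta_{n-m}$. Its kernel is $$g_{\boldsymbol\phi}(t,x)=g_{\mathrm L}(t-x)-\sum_{n=1}^N(g_{\mathrm L}^\vee\ast\phi_n)(x)\,p_n(t),$$ which for fixed $t$ is compactly supported in $x$. A system $((\mathbf p_1,\mathbf p_2),(\boldsymbol\phi_1,\boldsymbol\phi_2))$ is $[\mathrm L_1\otimes\mathrm L_2]$-admissible if $(\mathbf p_i,\boldsymbol\phi_i)$ is $\mathrm L_i$-admissible for $i=1,2$, where $\mathbf p_i=(p_{i,n})_{n=1}^{N_i}$, $\boldsymbol\phi_i=(\phi_{i,n})_{n=1}^{N_i}$. **Native space.** $\mathcal M_{\mathrm L_1\otimes\mathrm L_2}(\mathbb R^2)$ is the space of all $$f(t_1,t_2)=\int_{\mathbb R^2}g_{\boldsymbol\phi_1}(t_1,x_1)g_{\boldsymbol\phi_2}(t_2,x_2)\,\mathrm dm(x_1,x_2)+\sum_{n=1}^{N_1}p_{1,n}(t_1)\int_{\mathbb R}g_{\boldsymbol\phi_2}(t_2,x)\,\mathrm dm_{1,n}(x)+\sum_{n=1}^{N_2}\int_{\mathbb R}g_{\boldsymbol\phi_1}(t_1,x)\,\mathrm dm_{2,n}(x)\,p_{2,n}(t_2)+\sum_{n,n'}d_{n,n'}p_{1,n}(t_1)p_{2,n'}(t_2)$$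 with $m\in\mathcal M(\mathbb R^2)$, $m_{1,n},m_{2,n}\in\mathcal M(\mathbb R)$, $d_{n,n'}\in\mathbb R$; this representation is unique. The space is thereby identified with $\mathcal M(\mathbb R^2)\times\mathcal M(\mathbb R)^{N_1}\times\mathcal M(\mathbb R)^{N_2}\times\mathbb R^{N_1\times N_2}$, the dual of $\mathcal C_0(\mathbb R^2)\times\mathcal C_0(\mathbb R)^{N_1}\times\mathcal C_0(\mathbb R)^{N_2}\times\mathbb R^{N_1\times N_2}$; the weak$^\star$ topology is the one given by this duality (the set and this topology do not depend on the admissible system). **Seminorm.** For $f\in\mathcal M_{\mathrm L_1\otimes\mathrm L_2}(\mathbb R^2)$, let $m\in\mathcal M(\mathbb R^2)$, $m_{1,n}\in\mathcal M(\mathbb R)$ ($1\le n\le N_1$), $m_{2,n}\in\mathcal M(\mathbb R)$ ($1\le n\le N_2$), and $d_{n,n'}\in\mathbb R$ be the unique measures and coefficients such that $f(t_1,t_2)=\int_{\mathbb R^2}g_{\boldsymbol\phi_1}(t_1,x_1)g_{\boldsymbol\phi_2}(t_2,x_2)\,\mathrm dm(x_1,x_2)+\sum_{n=1}^{N_1}p_{1,n}(t_1)\int_{\mathbb R}g_{\boldsymbol\phi_2}(t_2,x)\,\mathrm dm_{1,n}(x)+\sum_{n=1}^{N_2}\int_{\mathbb R}g_{\boldsymbol\phi_1}(t_1,x)\,\mathrm dm_{2,n}(x)\,p_{2,n}(t_2)+\sum_{n,n'}d_{n,n'}p_{1,n}(t_1)p_{2,n'}(t_2)$. Then $$|f|_{\mathcal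 M_{\mathrm L_1\otimes\mathrm L_2}}=\|m\|_{\mathcal M(\mathbb R^2)}+\sum_{n=1}^{N_1}\|m_{1,n}\|_{\mathcal M(\mathbb R)}+\sum_{n=1}^{N_2}\|m_{2,n}\|_{\mathcal M(\mathbb R)};$$ it depends on the chosen admissible system and has null space $\mathcal N_{\mathrm L_1}\otimes\mathcal N_{\mathrm L_2}=\mathrm{span}\{p_{1,n}\otimes p_{2,n'}\}$. *)

(* Defs.v *)
From HB Require Import structures.
From mathcomp Require Import all_boot all_order all_algebra.
From mathcomp Require Import all_classical all_reals all_analysis.

Set Implicit Arguments.
Unset Strict Implicit.
Unset Printing Implicit Defensive.

Import Order.TTheory GRing.Theory Num.Theory.
Import numFieldNormedType.Exports.

Local Open Scope ring_scope.
Local Open Scope classical_set_scope.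

Definition smooth (R : realType) (u : R -> R) : Prop :=
  forall n x, derivable (u^`(n)) x 1.

Definition test_fun (R : realType) (psi : R -> R) : Prop :=
  smooth psi /\ compact (closure [set x | psi x != 0]).

(* A real distribution is carried by a functional on all of R -> R; only its
   values on test functions matter, and two functionals denote the same
   distribution when they agree on test functions. *)
Definition functional (R : realType) : Type := (R -> R) -> R.

(* The continuity clause is the usual seminorm estimate on D([-B, B]):
   |T psi| <= C * max_(j <= k) sup_x |psi^(j) x|. *)
Definition is_distribution (R : realType) (T : functional R) : Prop :=
  (forall (a : R) (u v : R -> R), test_fun u -> test_fun v ->
     T (fun x => a * u x + v x) = a * T u + T v) /\
  (forall B : R, exists (C : R) (k : nat), forall (psi : R -> R) (s : R),
     test_fun psi -> (forall x, B < `|x| -> psi x = 0) ->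
     (forall j x, (j <= k)%N -> `|psi^`(j) x| <= s) ->
     `|T psi| <= C * s).

Definition regular (R : realType) (u : R -> R) : functional R :=
  fun psi => \int[lebesgue_measure]_x (u x * psi x).

Definition dderiv (R : realType) (T : functional R) : functional R :=
  fun psi => - T (psi^`()).

(* (D - alpha I)^N and its adjoint (- D - alpha I)^N. *)
Definition opL (R : realType) (alpha : R) (N : nat) (T : functional R) :
    functional R :=
  iter N (fun U psi => dderiv U psi - alpha * U psi) T.

Definition opLadj (R : realType) (alpha : R) (N : nat) (T : functional R) :
    functional R :=
  iter N (fun U psi => - dderiv U psi - alpha * U psi) T.

Definition null_space (R : realType) (alpha : R) (N : nat) :
    set (functional R) :=
  [set T | is_distribution T /\
           forall psi, test_fun psi -> opL alpha N T psi = 0].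

(* Elements of the null space are smooth functions; a basis is given by the
   smooth representatives, since the values p n t are used below. *)
Definition null_basis (R : realType) (alpha : R) (N : nat)
    (p : 'I_N -> R -> R) : Prop :=
  [/\ forall n, smooth (p n),
      forall n, null_space alpha N (regular (p n)),
      forall a : 'I_N -> R,
        (forall psi, test_fun psi -> \sum_n a n * regular (p n) psi = 0) ->
        forall n, a n = 0
    & forall T, null_space alpha N T ->
        exists a : 'I_N -> R, forall psi, test_fun psi ->
          T psi = \sum_n a n * regular (p n) psi].

Definition vanishing_continuous (R : realType) (X : topologicalType)
    (v : X -> R) : Prop :=
  continuous v /\
  forall e : R, 0 < e ->
    exists2 A : set X, compact A & forall x, ~ A x -> `|v x| < e.

Definition universal_system (R : realType) (alpha : R) (N : nat)
    (p phi : 'I_N -> R -> R) : Prop :=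
  [/\ null_basis alpha p,
      forall n, test_fun (phi n)
    & forall n m, regular (p n) (phi m) = (n == m)%:R].

Definition space_CL (R : realType) (alpha : R) (N : nat) :
    set (functional R) :=
  [set T | exists (p phi : 'I_N -> R -> R) (v : R -> R) (a : 'I_N -> R),
     [/\ universal_system alpha p phi,
         vanishing_continuous v
       & forall psi, test_fun psi ->
           T psi = opLadj alpha N (regular v) psi
                   + \sum_n a n * regular (phi n) psi]].

Definition supported_in (R : realType) (T : functional R) (A : set R) : Prop :=
  forall psi, test_fun psi -> closure [set x | psi x != 0] `&` A = set0 ->
    T psi = 0.

(* The pairing <T, u> of a distribution T supported in [lo, hi] with a smooth
   function u is T (chi * u), for any test function chi equal to 1 near
   [lo, hi]. *)
Definition cutoff (R : realType) (lo hi : R) : R -> R :=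
  xget (fun=> 0) [set chi | test_fun chi /\
                    forall x, lo - 1 <= x <= hi + 1 -> chi x = 1].

Definition cpairing (R : realType) (lo hi : R) (T : functional R)
    (u : R -> R) : R :=
  T (fun x => cutoff lo hi x * u x).

Record admissible_system (R : realType) (alpha : R) (N : nat) := {
  sys_p : 'I_N -> R -> R;
  sys_phi : 'I_N -> functional R;
  sys_lo : R;
  sys_hi : R;
  sys_basis : null_basis alpha sys_p;
  sys_CL : forall n, space_CL alpha N (sys_phi n);
  sys_supp : forall n, supported_in (sys_phi n) `[sys_lo, sys_hi];
  sys_dual : forall n m,
    cpairing sys_lo sys_hi (sys_phi m) (sys_p n) = (n == m)%:R
}.

Definition green (R : realType) (alpha : R) (N : nat) (t : R) : R :=
  if 0 <= t then t ^+ N.-1 * expR (alpha * t) / (N.-1)`!%:R else 0.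

(* The convolution g^v * T is the distribution psi |-> <T, g * psi>.  For T in
   space_CL with compact support it has a unique continuous representative,
   selected here. *)
Definition green_conv (R : realType) (alpha : R) (N : nat) (lo hi : R)
    (T : functional R) : R -> R :=
  xget (fun=> 0)
    [set w | continuous w /\
       forall psi, test_fun psi ->
         regular w psi =
         cpairing lo hi T
           (fun y => \int[lebesgue_measure]_x
                       (green alpha N (y - x) * psi x))].

Definition kernel_phi (R : realType) (alpha : R) (N : nat)
    (S : admissible_system alpha N) (t x : R) : R :=
  green alpha N (t - x)
  - \sum_(n < N)
      green_conv alpha N (sys_lo S) (sys_hi S) (sys_phi S n) x * sys_p S n t.

(* Bounded Radon measures on R and R^2 are the finite signed Borel measures.
   Charges only matter through their values on measurable sets. *)
Definition meas1 (R : realType) : Type :=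
  {charge set (measurableTypeR R) -> \bar R}.

Definition meas2 (R : realType) : Type :=
  {charge set (measurableTypeR R * measurableTypeR R)%type -> \bar R}.

Definition hahn_pos d (T : measurableType d) (R : realType)
    (m : {charge set T -> \bar R}) : set T :=
  sval (cid (Hahn_decomposition m)).

Definition hahn_neg d (T : measurableType d) (R : realType)
    (m : {charge set T -> \bar R}) : set T :=
  sval (cid (svalP (cid (Hahn_decomposition m)))).

Definition hahnP d (T : measurableType d) (R : realType)
    (m : {charge set T -> \bar R}) :
    hahn_decomposition m (hahn_pos m) (hahn_neg m) :=
  svalP (cid (svalP (cid (Hahn_decomposition m)))).

Definition tv_norm d (T : measurableType d) (R : realType)
    (m : {charge set T -> \bar R}) : R :=
  fine (charge_variation (hahnP m) setT).

Definition charge_int d (T : measurableType d) (R : realType)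
    (m : {charge set T -> \bar R}) (h : T -> R) : R :=
  \int[jordan_pos (hahnP m)]_x h x - \int[jordan_neg (hahnP m)]_x h x.

Record coords (R : realType) (N1 N2 : nat) := {
  co_m : meas2 R;
  co_m1 : 'I_N1 -> meas1 R;
  co_m2 : 'I_N2 -> meas1 R;
  co_d : 'M[R]_(N1, N2)
}.

Definition synth (R : realType) (alpha1 alpha2 : R) (N1 N2 : nat)
    (S1 : admissible_system alpha1 N1) (S2 : admissible_system alpha2 N2)
    (c : coords R N1 N2) : R -> R -> R :=
  fun t1 t2 =>
    charge_int (co_m c) (fun x => kernel_phi S1 t1 x.1 * kernel_phi S2 t2 x.2)
    + \sum_(n < N1) sys_p S1 n t1 * charge_int (co_m1 c n) (kernel_phi S2 t2)
    + \sum_(n < N2) charge_int (co_m2 c n) (kernel_phi S1 t1) * sys_p S2 n t2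
    + \sum_(n < N1) \sum_(n' < N2) co_d c n n' * sys_p S1 n t1 * sys_p S2 n' t2.

Definition native_set (R : realType) (alpha1 alpha2 : R) (N1 N2 : nat)
    (S1 : admissible_system alpha1 N1) (S2 : admissible_system alpha2 N2) :
    set (R -> R -> R) :=
  [set f | exists c, synth S1 S2 c = f].

(* The representation is unique up to the values of the charges on
   non-measurable sets, on which nothing below depends. *)
Definition coords_of (R : realType) (alpha1 alpha2 : R) (N1 N2 : nat)
    (S1 : admissible_system alpha1 N1) (S2 : admissible_system alpha2 N2)
    (f : set_type (native_set S1 S2)) : coords R N1 N2 :=
  sval (cid (set_mem (valP f))).

Definition C0 (R : realType) (X : topologicalType) : Type :=
  {v : X -> R | vanishing_continuous v}.

Definition predual (R : realType) (N1 N2 : nat) : Type :=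
  (C0 R (R * R)%type * ('I_N1 -> C0 R R) * ('I_N2 -> C0 R R)
   * 'M[R]_(N1, N2))%type.

Definition duality (R : realType) (N1 N2 : nat)
    (c : coords R N1 N2) (h : predual R N1 N2) : R :=
  let: (v, v1, v2, e) := h in
  charge_int (co_m c) (sval v)
  + \sum_(n < N1) charge_int (co_m1 c n) (sval (v1 n))
  + \sum_(n < N2) charge_int (co_m2 c n) (sval (v2 n))
  + \sum_(n < N1) \sum_(n' < N2) co_d c n n' * e n n'.

(* The native space with its weak* topology: the initial topology of
   f |-> (h |-> <f, h>), h ranging over the predual, into the product of
   copies of R. *)
Definition native (R : realType) (alpha1 alpha2 : R) (N1 N2 : nat)
    (S1 : admissible_system alpha1 N1) (S2 : admissible_system alpha2 N2)
    : topologicalType :=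
  initial_topology
    (fun f : set_type (native_set S1 S2) =>
       duality (coords_of f) : prod_topology (fun _ : predual R N1 N2 => R)).

Definition native_fun (R : realType) (alpha1 alpha2 : R) (N1 N2 : nat)
    (S1 : admissible_system alpha1 N1) (S2 : admissible_system alpha2 N2)
    (f : native S1 S2) : R -> R -> R :=
  set_val (f : set_type (native_set S1 S2)).

Definition native_seminorm (R : realType) (alpha1 alpha2 : R) (N1 N2 : nat)
    (S1 : admissible_system alpha1 N1) (S2 : admissible_system alpha2 N2)
    (f : native S1 S2) : R :=
  let c := coords_of f in
  tv_norm (co_m c) + \sum_(n < N1) tv_norm (co_m1 c n)
  + \sum_(n < N2) tv_norm (co_m2 c n).

Definition null_tensor (R : realType) (alpha1 alpha2 : R) (N1 N2 : nat)
    (S1 : admissible_system alpha1 N1) (S2 : admissible_system alpha2 N2) :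
    set (native S1 S2) :=
  [set f | exists d : 'M[R]_(N1, N2), forall t1 t2,
     native_fun f t1 t2 =
     \sum_(n < N1) \sum_(n' < N2) d n n' * sys_p S1 n t1 * sys_p S2 n' t2].

(* The linear structure of the native space is the pointwise one. *)
Definition native_linear (R : realType) (alpha1 alpha2 : R) (N1 N2 M : nat)
    (S1 : admissible_system alpha1 N1) (S2 : admissible_system alpha2 N2)
    (nu : native S1 S2 -> 'rV[R]_M) : Prop :=
  forall (a : R) (f g h : native S1 S2),
    (forall t1 t2,
       native_fun h t1 t2 = a * native_fun f t1 t2 + native_fun g t1 t2) ->
    nu h = a *: nu f + nu g.

Definition convex_hull (R : realType) (alpha1 alpha2 : R) (N1 N2 : nat)
    (S1 : admissible_system alpha1 N1) (S2 : admissible_system alpha2 N2)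
    (A : set (native S1 S2)) : set (native S1 S2) :=
  [set f | exists (k : nat) (w : 'I_k -> R) (g : 'I_k -> native S1 S2),
     [/\ forall i, 0 <= w i, \sum_i w i = 1, forall i, A (g i)
       & forall t1 t2,
           native_fun f t1 t2 = \sum_i w i * native_fun (g i) t1 t2]].

Definition extreme_points (R : realType) (alpha1 alpha2 : R) (N1 N2 : nat)
    (S1 : admissible_system alpha1 N1) (S2 : admissible_system alpha2 N2)
    (A : set (native S1 S2)) : set (native S1 S2) :=
  [set f | A f /\
     forall (g h : native S1 S2) (s : R), A g -> A h -> 0 < s < 1 ->
       (forall t1 t2, native_fun f t1 t2 =
          s * native_fun g t1 t2 + (1 - s) * native_fun h t1 t2) ->
       g = f /\ h = f].

Definition argmin (R : realType) (X : Type) (J : X -> \bar R) : set X :=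
  [set f | forall g, (J f <= J g)%E].

Definition proper_fun (R : realType) (X : Type) (F : X -> \bar R) : Prop :=
  (forall z, F z != -oo%E) /\ exists z, (F z < +oo)%E.

Definition coercive_fun (R : realType) (M : nat)
    (F : 'rV[R]_M -> \bar R) : Prop :=
  forall A : R, exists B : R, forall z, B < `|z| -> (A%:E <= F z)%E.

(* Strictness is only meaningful on the effective domain; when F z or F z' is
   +oo the convexity inequality is trivial. *)
Definition strictly_convex_fun (R : realType) (M : nat)
    (F : 'rV[R]_M -> \bar R) : Prop :=
  forall (z z' : 'rV[R]_M) (s : R),
    z != z' -> (F z < +oo)%E -> (F z' < +oo)%E -> 0 < s < 1 ->
    (F (s *: z + (1 - s) *: z')%R < s%:E * F z + (1 - s)%:E * F z')%E.

(* Main.v *)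
Require Import Defs.
From HB Require Import structures.
From mathcomp Require Import all_boot all_order all_algebra.
From mathcomp Require Import all_classical all_reals all_analysis.
From mathcomp Require Import measurable_realfun ring lra.

Set Implicit Arguments.
Unset Strict Implicit.
Unset Printing Implicit Defensive.

Import Order.TTheory GRing.Theory Num.Theory.
Import numFieldNormedType.Exports.
Local Open Scope ring_scope.
Local Open Scope classical_set_scope.

(* Pairing f in t1 and t2 with (- D - alpha_i)^(N_i) psi_i turns every kernel
   into the test function psi_i and annihilates the null spaces; hence the
   measures, and then the matrix d, are determined by f, and the native space is
   the dual of the predual of coordinates.  By the Riesz representation theorem
   its seminorm balls with bounded d form closed subsets of a product of compact
   intervals, so they are weak* compact; nu is injective on the null tensors, so
   the sublevel sets of the objective are compact too and a minimizer exists.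
   Strict convexity makes nu f and |f| constant on the solution set V, which is
   therefore convex and compact, and the Krein-Milman theorem applies.

   Let f be an extreme point and pick disjoint sets on which the measures of f
   have positive variation.  If their number plus N1 N2 exceeded M, nu would
   vanish on a nonzero combination h of the restrictions of the measures to these
   sets and of the p_(1,n) p_(2,n'); f + h and f - h, for h small, would again be
   minimizers.  So the number of such sets is at most M - N1 N2: taking it
   maximal, every set is an atom of a measure on a Euclidean space, that is, a
   point mass. *)

(** An element of [native] is a mere function, its coordinates are picked by choice, and a charge is
    meaningful only on measurable sets. Linear combinations are therefore relations ([comb_charge],
    [comb_coords], [is_comb]), and convexity and compactness are studied in the product of real
    lines indexed by the predual, through the injection [Phi]. The Riesz theorem is proved for an
    abstract lattice of functions, so as to serve both the line and the plane. Its bound on the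
    total variation is exact; this makes the seminorm a supremum of weak* continuous functionals,
    hence lower semicontinuous. The seminorm does not see the matrix d. Removing from f the element
    with the same measures and d = 0, which stays in a compact set, leaves a null tensor with
    bounded image under nu; injectivity in finite dimension then bounds d. At an extreme point the
    products p_(1,n) p_(2,n') are directions that leave the seminorm unchanged. They enter the
    dimension count without producing a knot, whence the term N1 N2. *)

Section finite_measure_of.
Context d (T : measurableType d) (R : realType) (mu : {measure set T -> \bar R}).
Hypothesis mu_fin : fin_num_fun mu.

(** The idle [let] makes the finiteness proof a parameter of the constant, so that a finite measure
    structure can be attached to it. *)
Definition finite_measure_of : set T -> \bar R := let _ := mu_fin in mu.

HB.instance Definition _ := Measure.on finite_measure_of.

HB.instance Definition _ := @Measure_isFinite.Build _ _ _ finite_measure_of mu_fin.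

End finite_measure_of.

(** * Integration against charges *)

Section charge_theory.
Context d (T : measurableType d) (R : realType).
Implicit Types (m : {charge set T -> \bar R}) (mu : {finite_measure set T -> \bar R}).
Implicit Types (h : T -> R) (A : set T).

Definition bounded_by (s : R) h := forall x, `|h x| <= s.

Lemma bounded_integrable (mu : {measure set T -> \bar R}) h (s : R) :
  (mu setT < +oo)%E -> measurable_fun setT h -> bounded_by s h ->
  mu.-integrable setT (EFin \o h).
Proof.
move=> muoo mh hs; apply: measurable_bounded_integrable => //.
exists s; split; first by rewrite num_real.
by move=> M sM x _ /=; rewrite (le_trans (hs x))// ltW.
Qed.

Lemma finite_lty mu : (mu setT < +oo)%E.
Proof. by rewrite ltey_eq fin_num_measure. Qed.

Lemma finite_integrable mu h (s : R) :
  measurable_fun setT h -> bounded_by s h -> mu.-integrable setT (EFin \o h).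
Proof. by apply: bounded_integrable; exact: finite_lty. Qed.

Lemma Rintegral_measure_add mu1 mu2 h (s : R) :
  measurable_fun setT h -> bounded_by s h ->
  \int[measure_add mu1 mu2]_x h x = \int[mu1]_x h x + \int[mu2]_x h x.
Proof.
move=> mh hs; rewrite /Rintegral integral_measure_add//; last 2 first.
- exact: finite_integrable hs.
- exact: finite_integrable hs.
by rewrite fineD//; apply: integrable_fin_num => //; exact: finite_integrable hs.
Qed.

Lemma Rintegral_le_mass mu h (s : R) :
  measurable_fun setT h -> bounded_by s h ->
  `|\int[mu]_x h x| <= s * fine (mu setT).
Proof.
move=> mh hs; apply: le_trans (le_normr_Rintegral _ _) _ => //.
  exact: finite_integrable hs.
rewrite -Rintegral_cst//; apply: le_Rintegral => //.
- apply: (@finite_integrable _ _ s); first exact: measurableT_comp.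
  by move=> x; rewrite normr_id.
- by apply: (@finite_integrable _ _ `|s|) => // x.
Qed.

Definition jpos m : {finite_measure set T -> \bar R} := jordan_pos (hahnP m).
Definition jneg m : {finite_measure set T -> \bar R} := jordan_neg (hahnP m).

Lemma jordan_fineE m A : measurable A ->
  m A = ((fine (jpos m A) - fine (jneg m A))%:E)%E.
Proof.
move=> mA; rewrite (jordan_decomp (hahnP m) mA) /cadd/= cscaleN1 EFinB.
by rewrite !fineK// fin_num_measure.
Qed.

(** Any such pair of finite measures computes integrals and bounds the total variation, so the
    Jordan parts rarely have to be known explicitly. *)
Definition diff_of m mu1 mu2 :=
  forall A, measurable A -> fine (m A) = fine (mu1 A) - fine (mu2 A).

Lemma diff_of_jordan m : diff_of m (jpos m) (jneg m).
Proof. by move=> A mA; rewrite jordan_fineE. Qed.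

Lemma measure_add_fineE mu1 mu2 A : measurable A ->
  measure_add mu1 mu2 A = (fine (mu1 A) + fine (mu2 A))%:E.
Proof. by move=> mA; rewrite measure_addE EFinD !fineK// fin_num_measure. Qed.

(** Moving the subtracted measures across the equality leaves two sums of finite measures that agree
    on measurable sets. *)
Lemma integral_diff_eq mu1 mu2 mu3 mu4 h (s : R) :
  (forall A, measurable A ->
    fine (mu1 A) - fine (mu2 A) = fine (mu3 A) - fine (mu4 A)) ->
  measurable_fun setT h -> bounded_by s h ->
  \int[mu1]_x h x - \int[mu2]_x h x = \int[mu3]_x h x - \int[mu4]_x h x.
Proof.
move=> E mh hs.
suff: \int[mu1]_x h x + \int[mu4]_x h x = \int[mu3]_x h x + \int[mu2]_x h x.
  by move=> ?; lra.
rewrite -!(Rintegral_measure_add _ _ mh hs); congr fine.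
apply: eq_measure_integral => A mA _.
transitivity ((fine (mu1 A) + fine (mu4 A))%:E); first exact: measure_add_fineE.
transitivity ((fine (mu3 A) + fine (mu2 A))%:E); last exact/esym/measure_add_fineE.
by congr EFin; have := E A mA; lra.
Qed.

Lemma charge_int_diff m mu1 mu2 h (s : R) : diff_of m mu1 mu2 ->
  measurable_fun setT h -> bounded_by s h ->
  charge_int m h = \int[mu1]_x h x - \int[mu2]_x h x.
Proof.
move=> mE mh hs; apply: integral_diff_eq mh hs => A mA.
by rewrite -mE// -diff_of_jordan.
Qed.

Lemma tv_normE m : tv_norm m = fine (jpos m setT) + fine (jneg m setT).
Proof. by rewrite /tv_norm /charge_variation/= fineD// fin_num_measure. Qed.

Lemma tv_norm_ge0 m : 0 <= tv_norm m.
Proof. by rewrite tv_normE addr_ge0// fine_ge0. Qed.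

(** Minimality of the Jordan decomposition: the positive part of [A] is the charge of its
    intersection with the Hahn set, hence at most the [mu1]-measure of that intersection. *)
Lemma jpos_le m mu1 mu2 A : diff_of m mu1 mu2 -> measurable A ->
  fine (jpos m A) <= fine (mu1 A).
Proof.
move=> mE mA; have [[mP _] _ _ _] := hahnP m.
rewrite /jpos /= jordan_posE /= /crestr0 mem_set// /crestr mE; last exact: measurableI.
apply: (@le_trans _ _ (fine (mu1 (A `&` hahn_pos m)))).
  by rewrite lerBlDr lerDl fine_ge0.
apply: fine_le; rewrite ?fin_num_measure//; try exact: measurableI.
by apply: le_measure; rewrite ?inE//; exact: measurableI.
Qed.

Lemma jneg_le m mu1 mu2 A : diff_of m mu1 mu2 -> measurable A ->
  fine (jneg m A) <= fine (mu2 A).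
Proof.
move=> mE mA; have := jpos_le mE mA; have := mE A mA.
by rewrite (diff_of_jordan m mA); lra.
Qed.

Lemma tv_norm_le_diff m mu1 mu2 : diff_of m mu1 mu2 ->
  tv_norm m <= fine (mu1 setT) + fine (mu2 setT).
Proof. by move=> mE; rewrite tv_normE lerD// ?(jpos_le mE)// (jneg_le mE). Qed.

Lemma charge_int_le m h (s : R) : measurable_fun setT h -> bounded_by s h ->
  `|charge_int m h| <= s * tv_norm m.
Proof.
move=> mh hs; rewrite (charge_int_diff (@diff_of_jordan m) mh hs) tv_normE mulrDr.
by apply: le_trans (ler_normB _ _) _; rewrite lerD// Rintegral_le_mass.
Qed.

Definition eq_charge m1 m2 := forall A, measurable A -> fine (m1 A) = fine (m2 A).

Lemma eq_charge_diff m1 m2 mu1 mu2 : eq_charge m1 m2 ->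
  diff_of m2 mu1 mu2 -> diff_of m1 mu1 mu2.
Proof. by move=> E D A mA; rewrite E// D. Qed.

Lemma eq_charge_tv m1 m2 : eq_charge m1 m2 -> tv_norm m1 = tv_norm m2.
Proof.
move=> E; apply/eqP; rewrite eq_le; apply/andP; split.
  rewrite [leRHS]tv_normE; apply: tv_norm_le_diff.
  by apply: eq_charge_diff E _; exact: diff_of_jordan.
rewrite [leRHS]tv_normE; apply: tv_norm_le_diff.
by apply: (@eq_charge_diff _ m1); [move=> A mA; rewrite E|exact: diff_of_jordan].
Qed.

(** Adding the constant [|s|] makes the integrand nonnegative, where scaling of the measure is
    known. *)
Lemma Rintegral_mscale (mu : {measure set T -> \bar R}) (k : {nonneg R}) h (s : R) :
  (mu setT < +oo)%E -> measurable_fun setT h -> bounded_by s h ->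
  \int[mscale k mu]_x h x = k%:num * \int[mu]_x h x.
Proof.
move=> muoo mh hs.
have muoo' : (mscale k mu setT < +oo)%E.
  rewrite /mscale/= -ge0_fin_numE; last by rewrite mule_ge0.
  by rewrite fin_numM// ge0_fin_numE.
have gh x : 0 <= h x + `|s|.
  by have := ler_norm (- h x); rewrite normrN; have := hs x; have := ler_norm s; lra.
have mg : measurable_fun setT (fun x => h x + `|s|) by exact: measurable_funD.
have bg : bounded_by (s + `|s|) (fun x => h x + `|s|).
  by move=> x; rewrite (le_trans (ler_normD _ _))// normr_id lerD.
have bs : bounded_by `|s| (fun _ : T => `|s|) by move=> x; rewrite normr_id.
have E : \int[mscale k mu]_x (h x + `|s|) = k%:num * \int[mu]_x (h x + `|s|).
  rewrite /Rintegral ge0_integral_mscale//=; last 2 first.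
  - exact/measurable_EFinP.
  - by move=> x _; rewrite lee_fin.
  by rewrite fineM//; apply: integrable_fin_num => //; exact: bounded_integrable mg bg.
have := E; rewrite !RintegralD//; try exact: bounded_integrable mh hs;
  try exact: (bounded_integrable _ _ bs).
rewrite !Rintegral_cst// /mscale/= fineM//; last by rewrite ge0_fin_numE.
by rewrite mulrDr (mulrCA k%:num) => /addIr.
Qed.

Lemma finite_measure_comb mu1 mu2 (a : R) : 0 <= a ->
  {mu : {finite_measure set T -> \bar R} |
    (forall A, measurable A -> fine (mu A) = a * fine (mu1 A) + fine (mu2 A)) &
    forall h (s : R), measurable_fun setT h -> bounded_by s h ->
      \int[mu]_x h x = a * \int[mu1]_x h x + \int[mu2]_x h x}.
Proof.
move=> a0; pose k : {nonneg R} := NngNum a0.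
pose mu0 : {measure set T -> \bar R} := measure_add (mscale k mu1) mu2.
have mu0E A : measurable A -> mu0 A = (a * fine (mu1 A) + fine (mu2 A))%:E.
  move=> mA; rewrite [LHS]measure_addE /= /mscale/=.
  rewrite -(@fineK _ (mu1 A)) ?fin_num_measure// -(@fineK _ (mu2 A)) ?fin_num_measure//.
have fin : fin_num_fun mu0 by move=> A mA; rewrite mu0E.
exists (finite_measure_of fin) => [A mA|h s mh hs].
  exact: (congr1 fine (mu0E A mA)).
have fink : fin_num_fun (mscale k mu1).
  by move=> A mA; rewrite /= /mscale fin_numM// fin_num_measure.
have -> : \int[finite_measure_of fin]_x h x =
    \int[measure_add (finite_measure_of fink) mu2]_x h x.
  by [].
rewrite (Rintegral_measure_add _ _ mh hs); congr (_ + _).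
by apply: Rintegral_mscale mh hs; exact: finite_lty.
Qed.

(** A relation instead of an operation: the charges met later come from choices and are controlled
    on measurable sets only. *)
Definition comb_charge m (a : R) m1 m2 :=
  forall A, measurable A -> fine (m A) = a * fine (m1 A) + fine (m2 A).

Lemma comb_charge_diff m (a : R) m1 m2 : comb_charge m a m1 m2 ->
  exists mu1 mu2, [/\ diff_of m mu1 mu2,
    fine (mu1 setT) + fine (mu2 setT) = `|a| * tv_norm m1 + tv_norm m2 &
    forall h (s : R), measurable_fun setT h -> bounded_by s h ->
    \int[mu1]_x h x - \int[mu2]_x h x = a * charge_int m1 h + charge_int m2 h].
Proof.
move=> mE.
have [a0|a0] := leP 0 a.
  have [mu1 mu1E mu1I] := finite_measure_comb (jpos m1) (jpos m2) a0.
  have [mu2 mu2E mu2I] := finite_measure_comb (jneg m1) (jneg m2) a0.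
  exists mu1, mu2; split => [A mA||h s mh hs].
  - by rewrite mE// mu1E// mu2E// (diff_of_jordan m1 mA) (diff_of_jordan m2 mA); ring.
  - by rewrite mu1E// mu2E// !tv_normE ger0_norm//; ring.
  - rewrite (mu1I _ s)// (mu2I _ s)//.
    rewrite !(charge_int_diff (@diff_of_jordan _) mh hs); ring.
(* For negative [a] the Jordan parts of [m1] exchange their roles. *)
have a0' : 0 <= - a by rewrite oppr_ge0 ltW.
have [mu1 mu1E mu1I] := finite_measure_comb (jneg m1) (jpos m2) a0'.
have [mu2 mu2E mu2I] := finite_measure_comb (jpos m1) (jneg m2) a0'.
exists mu1, mu2; split => [A mA||h s mh hs].
- by rewrite mE// mu1E// mu2E// (diff_of_jordan m1 mA) (diff_of_jordan m2 mA); ring.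
- by rewrite mu1E// mu2E// !tv_normE ltr0_norm//; ring.
- rewrite (mu1I _ s)// (mu2I _ s)//.
  rewrite !(charge_int_diff (@diff_of_jordan _) mh hs); ring.
Qed.

Lemma comb_charge_int m (a : R) m1 m2 h (s : R) : comb_charge m a m1 m2 ->
  measurable_fun setT h -> bounded_by s h ->
  charge_int m h = a * charge_int m1 h + charge_int m2 h.
Proof.
move=> /comb_charge_diff[mu1 [mu2 [mE _ mI]]] mh hs.
by rewrite -(mI _ s)// (charge_int_diff mE mh hs).
Qed.

Lemma comb_charge_tv m (a : R) m1 m2 : comb_charge m a m1 m2 ->
  tv_norm m <= `|a| * tv_norm m1 + tv_norm m2.
Proof. by move=> /comb_charge_diff[mu1 [mu2 [mE <- _]]]; exact: tv_norm_le_diff. Qed.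

Lemma comb_charge_exists (a : R) m1 m2 : exists m, comb_charge m a m1 m2.
Proof.
exists (cadd (cscale a m1) m2) => A mA; rewrite /cadd/= /cscale/=.
by rewrite fineD ?fin_numM ?fin_num_measure// fineM ?fin_num_measure.
Qed.

End charge_theory.

Section charge_limits.
Context d (T : measurableType d) (R : realType).
Implicit Types (m : {charge set T -> \bar R}) (mu : {finite_measure set T -> \bar R}).

Lemma Rintegral_bounded_cvg mu (u : nat -> T -> R) (h : T -> R) (s : R) :
  (forall n, measurable_fun setT (u n)) -> (forall n, bounded_by s (u n)) ->
  measurable_fun setT h -> (forall x, u n x @[n --> \oo] --> h x) ->
  \int[mu]_x u n x @[n --> \oo] --> \int[mu]_x h x.
Proof.
move=> mu_ us mh uh.
have int_s : mu.-integrable setT (EFin \o (fun _ : T => s)).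
  by apply: (@finite_integrable _ _ _ _ _ `|s|) => // x.
have uhE x : (u n x)%:E @[n --> \oo] --> (h x)%:E.
  by apply: cvg_EFin; [exact: nearW|exact: uh].
have [ih _ C] := @dominated_convergence _ _ _ mu setT measurableT
  (fun n x => (u n x)%:E) (EFin \o h) (EFin \o (fun _ : T => s))
  (fun n => (measurable_EFinP _ _).2 (mu_ n)) ((measurable_EFinP _ _).2 mh)
  (aeW _ (fun x _ => uhE x)) int_s
  (aeW _ (fun x n _ => us n x)).
apply: fine_cvg; rewrite /Rintegral fineK; first exact: C.
exact: integrable_fin_num.
Qed.

Lemma charge_int_cvg m (u : nat -> T -> R) (h : T -> R) (s : R) :
  (forall n, measurable_fun setT (u n)) -> (forall n, bounded_by s (u n)) ->
  measurable_fun setT h -> (forall x, u n x @[n --> \oo] --> h x) ->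
  charge_int m (u n) @[n --> \oo] --> charge_int m h.
Proof.
move=> mu_ us mh uh; apply: cvgB; exact: Rintegral_bounded_cvg us mh uh.
Qed.

Lemma charge_int_indic m (A : set T) : measurable A ->
  charge_int m (\1_A) = fine (m A).
Proof.
move=> mA; rewrite /charge_int /Rintegral !integral_indic// setIT.
exact/esym/(diff_of_jordan m mA).
Qed.

End charge_limits.

(** * The Daniell and Riesz representation theorems *)

Section stone_lattice.
Context d (T : measurableType d) (R : realType).
Implicit Types (L : set (T -> R)) (f g h : T -> R) (u : nat -> T -> R).

(** The common features of continuous functions vanishing at infinity on the line and on the plane.
    [stone_min1] is Stone's condition, [stone_dini] replaces compactness, [stone_unit] expresses
    exhaustion by compact sets, and [stone_gen] ties the measurable sets to the lattice. *)
Record stone_lattice L : Prop := StoneLattice {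
  stone_lin : forall (a : R) f g, L f -> L g -> L (fun x => a * f x + g x);
  stone_min : forall f g, L f -> L g -> L (fun x => Num.min (f x) (g x));
  stone_min1 : forall f, L f -> L (fun x => Num.min (f x) 1);
  stone_measurable : forall f, L f -> measurable_fun setT f;
  stone_bounded : forall f, L f -> exists s : R, bounded_by s f;
  stone_dini : forall u, (forall n, L (u n)) ->
    (forall n x, 0 <= u n.+1 x <= u n x) ->
    (forall x (e : R), 0 < e -> exists n, u n x < e) ->
    forall e : R, 0 < e -> exists n, forall x, u n x < e;
  stone_unit : exists u, [/\ forall n, L (u n),
    forall n x, 0 <= u n x <= u n.+1 x, forall n x, u n x <= 1 &
    forall x, exists n, u n x = 1];
  stone_gen : forall A, measurable A ->
    <<s [set B | exists2 h, L h & B = [set x | 1 < h x]] >> A }.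

Context {L : set (T -> R)} (SL : stone_lattice L).

Lemma stone_0 : L (fun=> 0).
Proof.
have [u [Lu _ _ _]] := stone_unit SL.
rewrite (_ : (fun=> 0) = fun x => -1 * u 0%N x + u 0%N x); first exact: stone_lin.
by apply/funext => x; rewrite mulN1r addNr.
Qed.

Lemma stone_scale (a : R) f : L f -> L (fun x => a * f x).
Proof.
move=> Lf; rewrite (_ : (fun x => a * f x) = fun x => a * f x + 0).
  by apply: stone_lin => //; exact: stone_0.
by apply/funext => x; rewrite addr0.
Qed.

Lemma stone_add f g : L f -> L g -> L (fun x => f x + g x).
Proof.
move=> Lf Lg; rewrite (_ : (fun x => _) = fun x => 1 * f x + g x).
  exact: stone_lin.
by apply/funext => x; rewrite mul1r.
Qed.

Lemma stone_sub f g : L f -> L g -> L (fun x => f x - g x).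
Proof.
move=> Lf Lg; rewrite (_ : (fun x => _) = fun x => -1 * g x + f x).
  exact: stone_lin.
by apply/funext => x; rewrite mulN1r addrC.
Qed.

Lemma stone_minc (c : R) f : 0 <= c -> L f -> (forall x, 0 <= f x) ->
  L (fun x => Num.min (f x) c).
Proof.
rewrite le_eqVlt => /predU1P[<-|c0] Lf f0.
  rewrite (_ : (fun x => _) = fun=> 0); first exact: stone_0.
  by apply/funext => x; apply/min_idPr.
rewrite (_ : (fun x => _) = fun x => c * Num.min (c^-1 * f x) 1).
  by apply/stone_scale/(stone_min1 SL)/stone_scale.
by apply/funext => x; rewrite minr_pMr ?ltW// mulrA divff ?gt_eqF// mul1r mulr1.
Qed.

Lemma stone_pos f : L f -> L (fun x => Num.max (f x) 0).
Proof.
move=> Lf; rewrite (_ : (fun x => _) = fun x => f x - Num.min (f x) 0).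
  by apply: stone_sub => //; apply: (stone_min SL) => //; exact: stone_0.
apply/funext => x; case: (leP (f x) 0) => [fx|fx].
  by rewrite subrr.
by rewrite subr0.
Qed.

(** Elements of the lattice increasing to the indicator of [[set x | 1 < h x]]. The threshold is 1
    because truncation at 1 is the one granted by Stone's condition. *)
Definition level h (n : nat) x : R := Num.min (n%:R * Num.max (h x - 1) 0) 1.

Lemma stone_level h n : L h -> L (level h n).
Proof.
move=> Lh; apply/(stone_min1 SL)/stone_scale.
rewrite (_ : (fun x => _) =
  fun x => Num.max (h x) 0 - Num.min (Num.max (h x) 0) 1).
  by apply: stone_sub; [exact: stone_pos|apply/(stone_min1 SL)/stone_pos].
apply/funext => x; case: (leP (h x) 0) => h0.
  by rewrite minEle ler01 subrr max_r//; lra.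
by rewrite maxEle minEle; case: ifPn; case: ifPn; lra.
Qed.

Lemma level_ge0 h n x : 0 <= level h n x.
Proof. by rewrite le_min ler01 andbT mulr_ge0// le_max lexx orbT. Qed.

Lemma level_le1 h n x : level h n x <= 1.
Proof. by rewrite ge_min lexx orbT. Qed.

Lemma level_nd h n m x : (n <= m)%N -> level h n x <= level h m x.
Proof.
move=> nm; rewrite /level le_min [X in _ && X]ge_min lexx orbT andbT.
rewrite ge_min; apply/orP; left; rewrite ler_wpM2r//; last by rewrite ler_nat.
by rewrite le_max lexx orbT.
Qed.

Lemma level_eq0 h n x : ~ 1 < h x -> level h n x = 0.
Proof.
move=> /negP; rewrite -leNgt => h1; rewrite /level max_r ?subr_le0// mulr0.
by rewrite min_l.
Qed.

Lemma level_eq1 h x : 1 < h x -> exists n, forall k, (n <= k)%N -> level h k x = 1.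
Proof.
move=> h1; have h0 : 0 < h x - 1 by rewrite subr_gt0.
exists (Num.truncn (h x - 1)^-1).+1 => k nk; apply/min_r.
rewrite max_l; last exact: ltW.
rewrite -ler_pdivrMr// div1r ltW//.
have : (Num.truncn (h x - 1)^-1).+1%:R <= k%:R :> R by rewrite ler_nat.
by apply: lt_le_trans; rewrite truncnS_gt.
Qed.

Lemma level_cvg h x : level h n x @[n --> \oo] --> (\1_[set x | 1 < h x] x : R).
Proof.
rewrite indicE; case: (boolP (x \in _)) => [/[!inE]/= /level_eq1[n nE]|].
  by apply: cvg_near_cst; exists n => // k /= /nE.
move=> /negP; rewrite inE/= => hx; apply: cvg_near_cst.
by apply: nearW => n; rewrite level_eq0.
Qed.

Lemma stone_measurable_level h : L h -> measurable [set x | 1 < h x].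
Proof.
move=> Lh; rewrite (_ : mkset _ = [set: T] `&` h @^-1` `]1, +oo[).
  by apply: (stone_measurable SL Lh) => //; exact: measurable_itv.
by rewrite setTI; apply/seteqP; split => x /=; rewrite in_itv/= andbT.
Qed.

(** Dominated convergence along [level h n] shows that the charge vanishes on the sets [1 < h].
    These generate the measurable sets and are stable under intersection, through minima, so the two
    Jordan parts coincide. *)
Lemma stone_separates (m : {charge set T -> \bar R}) :
  (forall h, L h -> charge_int m h = 0) ->
  forall A, measurable A -> fine (m A) = 0.
Proof.
move=> m0; pose G := [set B | exists2 h, L h & B = [set x | 1 < h x]].
have GE B : G B -> jpos m B = jneg m B.
  move=> [h Lh BE]; have mB : measurable B by rewrite BE; exact: stone_measurable_level.
  have mBi : measurable_fun [set: T] (\1_[set x | 1 < h x] : T -> R).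
    by apply: measurable_indic; exact: stone_measurable_level.
  have C := @charge_int_cvg _ _ _ m (level h) (\1_[set x | 1 < h x]) 1
    (fun n => stone_measurable SL (stone_level n Lh)) _ mBi (@level_cvg h).
  have {}C : charge_int m (level h n) @[n --> \oo] --> charge_int m \1_[set x | 1 < h x].
    by apply: C => n x; rewrite ger0_norm ?level_ge0 ?level_le1.
  have : fine (m B) = 0.
    rewrite -charge_int_indic// BE; apply/esym; apply: (cvg_unique _ _ C) => //.
    by apply: cvg_near_cst; apply: nearW => n; rewrite m0//; exact: stone_level.
  rewrite (diff_of_jordan m mB) => /eqP; rewrite subr_eq0 => /eqP E.
  by rewrite -(@fineK _ (jpos m B)) ?fin_num_measure// -(@fineK _ (jneg m B)) ?fin_num_measure// E.
have [u [Lu u0 u1 uT]] := stone_unit SL.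
move=> A mA; rewrite (diff_of_jordan m mA).
suff -> : jpos m A = jneg m A by rewrite subrr.
(* The exhausting functions reach the value 1 without exceeding it; doubling them meets the strict
   inequality. *)
apply: (@g_sigma_algebra_measure_unique _ _ _ G _ (fun n => [set x | 1 < 2 * u n x])).
- by move=> B [h Lh ->]; exact: stone_measurable_level.
- by move=> n; exists (fun x => 2 * u n x) => //; exact: stone_scale.
- apply/seteqP; split => // x _; have [n un] := uT x.
  by exists n => //=; rewrite un mulr1; lra.
- move=> B C [h Lh ->] [g Lg ->]; exists (fun x => Num.min (h x) (g x)).
    exact: (stone_min SL).
  by apply/seteqP; split => x /=; rewrite lt_min => /andP.
- exact: GE.
- by move=> n; apply: (@le_lt_trans _ _ (jpos m setT)); [apply: le_measure; rewrite ?inE//; apply: stone_measurable_level; exact: stone_scale|exact: finite_lty].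
- exact: stone_gen.
Qed.

End stone_lattice.

Section daniell_representation.
Context d (T : measurableType d) (R : realType).
Context (L : set (T -> R)) (SL : stone_lattice L).
Implicit Types (f g h : T -> R).

Lemma stone_bounded_integrable (mu : {finite_measure set T -> \bar R}) f :
  L f -> mu.-integrable setT (EFin \o f).
Proof.
move=> Lf; have [s fs] := stone_bounded SL Lf.
exact: (finite_integrable mu (stone_measurable SL Lf) fs).
Qed.

(* Both [I] and integration are squeezed between the values of the outer measure
   on the superlevel sets of [h]. *)
Lemma daniell_layer (F : (T -> R) -> R) (mu : set T -> R) h (N : nat) :
  (forall f g, L f -> L g -> (forall x, 0 <= f x) -> (forall x, 0 <= g x) ->
     F (fun x => f x + g x) = F f + F g) ->
  (forall (a : R) f, 0 <= a -> L f -> (forall x, 0 <= f x) ->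
     F (fun x => a * f x) = a * F f) ->
  (forall e (A : set T), L e -> (forall x, 0 <= e x <= 1) -> (forall x, ~ A x -> e x = 0) ->
     measurable A -> F e <= mu A) ->
  (forall e (A : set T), L e -> (forall x, 0 <= e x) -> (forall x, A x -> 1 <= e x) ->
     measurable A -> mu A <= F e) ->
  (forall A, 0 <= mu A) -> L h -> (forall x, 0 <= h x <= 1) ->
  \sum_(j < N) mu [set x | j.+1%:R / N.+1%:R < h x] <= N.+1%:R * F h <=
  \sum_(j < N.+1) mu [set x | j%:R / N.+1%:R < h x].
Proof.
move=> Fadd Fscale Fle Fge mu0 Lh h01.
have h0 x : 0 <= h x by case/andP: (h01 x).
have N0 : 0 < N.+1%:R :> R by rewrite ltr0n.
pose q (j : nat) : R := j%:R / N.+1%:R.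
have q0 j : 0 <= q j by rewrite divr_ge0.
have qS j : q j.+1 = q j + N.+1%:R^-1 by rewrite /q -natr1 mulrDl mul1r.
have iN0 : 0 < N.+1%:R^-1 :> R by rewrite invr_gt0.
pose t (j : nat) x := Num.min (h x) (q j).
have Lt j : L (t j) by exact: stone_minc.
have t0 j x : 0 <= t j x by rewrite le_min h0 q0.
have tS j x : t j x <= t j.+1 x.
  by rewrite le_min !ge_min lexx/= qS lerDl (ltW iN0) orbT.
(* The slice of [h] between two consecutive heights. Multiplied by [N.+1] it lies between the
   indicators of the superlevel sets at its top and at its bottom. *)
pose e (j : nat) x := t j.+1 x - t j x.
have Le j : L (e j) by exact: stone_sub.
have e0 j x : 0 <= e j x by rewrite subr_ge0.
have mlev (c : R) : measurable [set x | c < h x].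
  rewrite (_ : mkset _ = [set: T] `&` h @^-1` `]c, +oo[).
    by apply: (stone_measurable SL Lh) => //; exact: measurable_itv.
  by rewrite setTI; apply/seteqP; split => x /=; rewrite in_itv/= andbT.
have Ft n : F (t n) = \sum_(j < n) F (e j).
  elim: n => [|n IH].
    rewrite big_ord0 (_ : t 0%N = fun x => 0 * h x).
      by rewrite Fscale// mul0r.
    apply/funext => x; rewrite mul0r /t /q mul0r; exact/min_idPr.
  rewrite big_ord_recr/= -IH -Fadd//; congr F.
  by apply/funext => x; rewrite /e addrC subrK.
have hE : h = t N.+1.
  apply/funext => x; rewrite /t /q divff ?gt_eqF//; apply/esym/min_l.
  by case/andP: (h01 x).
have Fhi j : N.+1%:R * F (e j) <= mu [set x | q j < h x].
  rewrite -Fscale//; apply: Fle => //.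
  - exact: (stone_scale SL).
  - move=> x; rewrite mulr_ge0//=.
    rewrite -(@ler_pM2l _ N.+1%:R^-1)// mulrA mulVf ?gt_eqF// mul1r mulr1.
    rewrite /e /t qS; move: (N.+1%:R^-1) iN0 => i i0.
    case: (leP (h x) (q j)) => ?; case: (leP (h x) (q j + _)) => ?; lra.
  - move=> x /negP; rewrite -leNgt => hq; rewrite /e /t !min_l ?subrr ?mulr0//.
    by rewrite (le_trans hq)// qS lerDl ltW.
have Flo j : mu [set x | q j.+1 < h x] <= N.+1%:R * F (e j).
  rewrite -Fscale//; apply: Fge => //.
  - exact: (stone_scale SL).
  - by move=> x; rewrite mulr_ge0.
  - move=> x /= hq; rewrite -(@ler_pM2l _ N.+1%:R^-1)// mulrA mulVf ?gt_eqF// mul1r mulr1.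
    rewrite /e /t; move: hq; rewrite qS; move: (N.+1%:R^-1) iN0 => i i0 hq.
    by rewrite !min_r; lra.
have -> : F h = \sum_(j < N.+1) F (e j) by rewrite [in LHS]hE Ft.
rewrite mulr_sumr; apply/andP; split; last by apply: ler_sum.
apply: (@le_trans _ _ (\sum_(j < N) N.+1%:R * F (e j))).
  by apply: ler_sum => i _; exact: Flo.
by rewrite [leRHS]big_ord_recr/= lerDl (le_trans _ (Flo N)).
Qed.

End daniell_representation.

(** * The outer measure of a positive functional *)

Section daniell.
Context d (T : measurableType d) (R : realType).
Context (L : set (T -> R)) (SL : stone_lattice L).
Implicit Types (f g h : T -> R) (u v : nat -> T -> R) (A B X : set T).
Variables (I : (T -> R) -> R) (C : R).

(** The functional is assumed additive on the nonnegative cone only, since the positive part of a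
    signed functional is defined there as a supremum. *)
Let Lp f := L f /\ forall x, 0 <= f x.

Hypothesis I_add : forall f g, Lp f -> Lp g -> I (fun x => f x + g x) = I f + I g.
Hypothesis I_scale : forall (a : R) f, 0 <= a -> Lp f -> I (fun x => a * f x) = a * I f.
Hypothesis I_ge0 : forall f, Lp f -> 0 <= I f.
Hypothesis I_bound : forall f (s : R), Lp f -> (forall x, f x <= s) -> I f <= C * s.

Lemma daniell_sub f g : Lp f -> Lp g -> (forall x, f x <= g x) ->
  I (fun x => g x - f x) = I g - I f /\ I f <= I g.
Proof.
move=> Lf Lg fg; have Lgf : Lp (fun x => g x - f x).
  split=> [|x]; last by rewrite subr_ge0.
  by apply: (stone_sub SL); [case: Lg|case: Lf].
have E := I_add Lf Lgf; rewrite (_ : (fun x => _) = g) in E; last first.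
  by apply/funext => x; rewrite addrC subrK.
by have := I_ge0 Lgf; rewrite E; split; lra.
Qed.

Lemma daniell_mono f g : Lp f -> Lp g -> (forall x, f x <= g x) -> I f <= I g.
Proof. by move=> Lf Lg fg; case: (daniell_sub Lf Lg fg). Qed.

Lemma Lp_min f g : Lp f -> Lp g -> Lp (fun x => Num.min (f x) (g x)).
Proof.
move=> [Lf f0] [Lg g0]; split; first exact: stone_min.
by move=> x; rewrite le_min f0 g0.
Qed.

Lemma Lp_sub f g : Lp f -> Lp g -> (forall x, f x <= g x) -> Lp (fun x => g x - f x).
Proof.
move=> Lf Lg fg; split=> [|x]; last by rewrite subr_ge0.
by apply: (stone_sub SL); [case: Lg|case: Lf].
Qed.

Lemma Lp_0 : Lp (fun=> 0).
Proof. by split=> //; exact: (stone_0 SL). Qed.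

Lemma daniell_0 : I (fun=> 0) = 0.
Proof.
by have := I_scale (lexx 0) Lp_0; rewrite !mul0r.
Qed.

Lemma Lp_level h n : L h -> Lp (level h n).
Proof. by move=> Lh; split; [exact: stone_level|exact: level_ge0]. Qed.

Let C_ge0 : 0 <= C.
Proof.
have := I_bound Lp_0 (fun=> ler01); rewrite daniell_0 mulr1.
exact.
Qed.

Lemma nd_seq_le u : (forall n x, u n x <= u n.+1 x) ->
  forall n m x, (n <= m)%N -> u n x <= u m x.
Proof.
move=> nd n m x; elim: m => [|m IH]; first by rewrite leqn0 => /eqP ->.
by rewrite leq_eqVlt => /predU1P[-> //|/IH /le_trans]; exact.
Qed.

(** The defects [e - min (u n) e] decrease pointwise to 0, hence uniformly by Dini, and the
    functional is controlled by the uniform norm. *)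
Lemma daniell_cover u e (r : R) : (forall n, Lp (u n)) ->
  (forall n x, u n x <= u n.+1 x) -> Lp e ->
  (forall x, exists n, e x <= u n x) -> (forall n, I (u n) <= r) -> I e <= r.
Proof.
move=> Lu nd Le eu ur.
have Lm n : Lp (fun x => Num.min (u n x) (e x)) by exact: Lp_min.
have me n x : Num.min (u n x) (e x) <= e x by rewrite ge_min lexx orbT.
apply/ler_addgt0Pr => t t0.
pose w n x := e x - Num.min (u n x) (e x).
have Lw n : Lp (w n) by exact: Lp_sub.
(* Dividing by [C + 1] keeps the quotient meaningful when [C] is 0, and [C] times it is still at
   most [t]. *)
have c1 : 0 < t / (C + 1) by rewrite divr_gt0// ltr_pwDr.
have wdec n x : 0 <= w n.+1 x <= w n x.
  by rewrite (Lw _).2/= lerB// le_min !ge_min nd lexx !orbT.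
have wcv x (a : R) : 0 < a -> exists n, w n x < a.
  by move=> a0; have [n un] := eu x; exists n; rewrite /w min_r// subrr.
have [n wn] := stone_dini SL (fun n => (Lw n).1) wdec wcv c1.
have : I (w n) <= C * (t / (C + 1)).
  by apply: I_bound (Lw n) _ => x; exact/ltW.
rewrite (daniell_sub (Lm n) Le (me n)).1.
have : I (fun x => Num.min (u n x) (e x)) <= r.
  apply: le_trans (ur n); apply: daniell_mono => // x.
  by rewrite ge_min lexx.
have : C * (t / (C + 1)) <= t.
  rewrite mulrA ler_pdivrMr ?ltr_pwDr// mulrC ler_wpM2l ?ltW//.
  by rewrite ltrDl.
lra.
Qed.

Definition covers u A (r : R) := [/\ forall n, Lp (u n),
  forall n x, u n x <= u n.+1 x, forall x, A x -> exists n, 1 <= u n x &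
  forall n, I (u n) <= r].

Definition outer A : R := inf [set r | exists u, covers u A r].

Lemma covers_unit : exists u, [/\ covers u setT C, forall n x, u n x <= 1 &
  forall x, exists n, u n x = 1].
Proof.
have [u [Lu u0 u1 uT]] := stone_unit SL; exists u; split=> //; split=> //.
- by move=> n; split=> // x; case/andP: (u0 n x).
- by move=> n x; case/andP: (u0 n x).
- by move=> x _; have [n un] := uT x; exists n; rewrite un.
- move=> n; rewrite -[leRHS]mulr1; apply: I_bound => //.
  by split=> // x; case/andP: (u0 n x).
Qed.

Lemma covers_ge0 u A r : covers u A r -> 0 <= r.
Proof. by move=> [Lu _ _ ur]; apply: le_trans (ur 0%N); exact: I_ge0. Qed.

Lemma outer_has_inf A : has_inf [set r | exists u, covers u A r].
Proof.
split; last by exists 0 => r [u /covers_ge0].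
by have [u [[Lu nd uT ur] _ _]] := covers_unit; exists C, u; split=> // x _; exact: uT.
Qed.

Lemma outer_le u A r : covers u A r -> outer A <= r.
Proof. by move=> c; apply: ge_inf; [exact: (outer_has_inf A).2|exists u]. Qed.

Lemma outer_ge0 A : 0 <= outer A.
Proof.
by apply: lb_le_inf; [exact: (outer_has_inf A).1|move=> r [u /covers_ge0]].
Qed.

Lemma outer_adherent A (e : R) : 0 < e -> exists u, covers u A (outer A + e).
Proof.
move=> e0; have [r [u [Lu nd uA ur]] re] := inf_adherent e0 (outer_has_inf A).
by exists u; split=> // n; apply: le_trans (ur n) _; exact: ltW.
Qed.

Lemma outer_mono A B : A `<=` B -> outer A <= outer B.
Proof.
move=> AB; apply/ler_addgt0Pr => e e0; have [u [Lu nd uB ur]] := outer_adherent B e0.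
by apply: (@outer_le u); split=> // x /AB/uB.
Qed.

Lemma outer_set0 : outer set0 = 0.
Proof.
apply/eqP; rewrite eq_le outer_ge0 andbT; apply: (@outer_le (fun _ _ => 0)).
by split=> // _; [exact: Lp_0|rewrite daniell_0].
Qed.

Lemma Lp_sum (k : nat) (v : nat -> T -> R) : (forall i, Lp (v i)) ->
  Lp (fun x => \sum_(i < k) v i x) /\
  I (fun x => \sum_(i < k) v i x) = \sum_(i < k) I (v i).
Proof.
move=> Lv; elim: k => [|k [[IH1 IH1'] IH2]].
  rewrite (_ : (fun x => _) = fun=> 0); last by apply/funext => x; rewrite big_ord0.
  by rewrite big_ord0 daniell_0; split=> //; exact: Lp_0.
rewrite (_ : (fun x => _) = fun x => \sum_(i < k) v i x + v k x); last first.
  by apply/funext => x; rewrite big_ord_recr.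
rewrite big_ord_recr/= -IH2; split; last by apply: I_add.
split; first by apply: (stone_add SL) => //; case: (Lv k).
by move=> x; rewrite addr_ge0//; case: (Lv k).
Qed.

Definition outer_meas A : \bar R := (outer A)%:E.

(** Each [F i] has a cover [v i] with error [e / 2 ^ i.+1]; the diagonal sums of the [v i n] for
    [i < n] cover the union. *)
Lemma outer_meas_sigma_subadditive : sigma_subadditive outer_meas.
Proof.
move=> F; apply/lee_addgt0Pr => e e0.
apply: le_trans (epsilon_trick _ _ (ltW e0)); last first.
  by move=> n; rewrite lee_fin outer_ge0.
have : forall n, exists u, covers u (F n) (outer (F n) + e / (2 ^ n.+1)%:R).
  by move=> n; apply: outer_adherent; rewrite divr_gt0// ltr0n expn_gt0.
move/choice => [v vF].
set S := (X in (_ <= X)%E).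
have [Sfin|] := boolP (S \is a fin_num); last first.
  rewrite ge0_fin_numE; last first.
    apply: nneseries_ge0 => n _ _; rewrite lee_fin addr_ge0 ?outer_ge0//.
    by rewrite divr_ge0// ltW.
  by rewrite -leNgt leye_eq => /eqP ->; rewrite leey.
rewrite -(fineK Sfin) lee_fin.
have Lv i n : Lp (v i n) by case: (vF i).
have nd i n m x : (n <= m)%N -> v i n x <= v i m x.
  by apply: nd_seq_le => {}n {}x; case: (vF i).
apply: (@outer_le (fun n x => \sum_(i < n) v i n x)); split.
- by move=> n; exact: (Lp_sum n (fun i => Lv i n)).1.
- move=> n x; rewrite big_ord_recr/= -[leLHS]addr0 lerD//; last by case: (Lv n n.+1).
  by apply: ler_sum => i _; exact: nd.
- move=> x [k _ Fkx]; have [_ _ cov _] := vF k; have [n n1] := cov _ Fkx.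
  exists (maxn n k.+1).
  have km : (k < maxn n k.+1)%N by rewrite leq_max ltnSn orbT.
  rewrite (bigD1 (Ordinal km))//= (le_trans n1)// (le_trans (nd _ _ (maxn n k.+1) _ _)) ?leq_maxl//.
  by rewrite lerDl sumr_ge0// => i _; case: (Lv i (maxn n k.+1)).
- move=> n; rewrite (Lp_sum n (fun i => Lv i n)).2 -lee_fin fineK//.
  apply: (@le_trans _ _ (\sum_(0 <= i < n) (outer (F i) + e / (2 ^ i.+1)%:R)%:E)).
    rewrite big_mkord sumEFin lee_fin; apply: ler_sum => i _.
    by case: (vF i).
  have pos i : (0 <= i)%N -> xpredT i ->
      (0 <= outer_meas (F i) + (e / (2 ^ i.+1)%:R)%:E)%E.
    by move=> _ _; rewrite lee_fin addr_ge0 ?outer_ge0// divr_ge0// ltW.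
  exact: (nneseries_lim_ge n pos).
Qed.

HB.instance Definition _ := isOuterMeasure.Build R T outer_meas
  (congr1 EFin outer_set0) outer_ge0 outer_mono outer_meas_sigma_subadditive.

(** Take a nearly optimal cover [u] of [X]. The functions [min (u n) (level h n)] cover the part of
    [X] in the set, so one index [k] already has almost its full outer measure. The remainders of
    [u] after subtracting the minimum with the fixed function [level h k] cover the rest of [X],
    because [level h k] vanishes there. *)
Lemma caratheodory_level h : L h ->
  caratheodory_measurable outer_meas [set x | 1 < h x].
Proof.
move=> Lh; apply: le_caratheodory_measurable => X.
set A := [set x | _]; rewrite -EFinD lee_fin.
apply/ler_addgt0Pr => t t0.
have t20 : 0 < t / 2 by rewrite divr_gt0.
have [u [Lu nd uX ur]] := outer_adherent X t20.
pose v n x := Num.min (u n x) (level h n x).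
have Lv n : Lp (v n) by apply: Lp_min => //; exact: Lp_level.
have ndv n x : v n x <= v n.+1 x.
  have a := nd n x; have b := @level_nd _ _ _ h n n.+1 x (leqnSn n); rewrite /v.
  by case: (leP (u n x)) => ?; case: (leP (u n.+1 x)) => ?; lra.
have [k vk] : exists k, outer (X `&` A) - t / 2 < I (v k).
  apply: contrapT => /forallNP H.
  suff : outer (X `&` A) <= outer (X `&` A) - t / 2 by lra.
  apply: (@outer_le v); split=> // [x [Xx /level_eq1[n nE]]|n].
    have [m um] := uX _ Xx; exists (maxn n m).
    rewrite le_min (le_trans um) ?(nd_seq_le nd) ?leq_maxr//=.
    by rewrite nE// leq_maxl.
  by rewrite leNgt; apply/negP.
pose w n x := u (n + k)%N x - Num.min (u (n + k)%N x) (level h k x).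
have Lm n : Lp (fun x => Num.min (u n x) (level h k x)).
  by apply: Lp_min => //; exact: Lp_level.
have mu n x : Num.min (u n x) (level h k x) <= u n x by rewrite ge_min lexx.
have : outer (X `&` ~` A) <= outer X + t / 2 - I (v k).
  apply: (@outer_le w); split.
  - by move=> n; apply: Lp_sub.
  - move=> n x; rewrite /w addSn.
    have a := nd (n + k)%N x.
    by case: (leP (u (n + k)%N x)) => ?; case: (leP (u (n + k).+1 x)) => ?; lra.
  - move=> x [Xx Ax]; have [m um] := uX _ Xx; exists m.
    rewrite /w (level_eq0 _ Ax) min_r ?subr0; last by case: (Lu (m + k)%N).
    by rewrite (le_trans um)// (nd_seq_le nd)// leq_addr.
  - move=> n; rewrite /w (daniell_sub (Lm _) (Lu _) (mu _)).1 lerB//.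
    apply: daniell_mono => // x; rewrite /v.
    have a := nd_seq_le nd x (leq_addl n k).
    by case: (leP (u k x)) => ?; case: (leP (u (n + k)%N x)) => ?; lra.
lra.
Qed.

Lemma caratheodory_measurableW A : measurable A ->
  caratheodory_measurable outer_meas A.
Proof.
move=> mA; have := stone_gen SL mA; apply; split=> [|B [h Lh ->]]; last exact: caratheodory_level.
split; first exact: caratheodory_measurable_set0.
  by move=> B mB; rewrite setTD; exact: caratheodory_measurable_setC.
by move=> F mF; exact: caratheodory_measurable_bigcup.
Qed.

(** A second name for [outer_meas], so that the outer measure and the measure structures sit on
    different constants. *)
Definition daniell_measure : set T -> \bar R := outer_meas.

Let daniell_measure0 : daniell_measure set0 = 0%E.
Proof. by rewrite /daniell_measure /outer_meas outer_set0. Qed.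

Let daniell_measure_ge0 A : (0 <= daniell_measure A)%E.
Proof. by rewrite lee_fin outer_ge0. Qed.

Let daniell_measure_semi_sigma_additive : semi_sigma_additive daniell_measure.
Proof.
move=> F mF tF mUF; apply: caratheodory_measure_sigma_additive => //.
- by move=> i; exact: caratheodory_measurableW.
- exact: caratheodory_measurableW.
Qed.

HB.instance Definition _ := isMeasure.Build _ _ _ daniell_measure
  daniell_measure0 daniell_measure_ge0 daniell_measure_semi_sigma_additive.

Let daniell_measure_fin : fin_num_fun daniell_measure.
Proof. by []. Qed.

HB.instance Definition _ := @Measure_isFinite.Build _ _ _ daniell_measure daniell_measure_fin.

Lemma daniell_le_outer e A : Lp e -> (forall x, e x <= 1) ->
  (forall x, ~ A x -> e x = 0) -> I e <= outer A.
Proof.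
move=> Le e1 eA; apply/ler_addgt0Pr => t t0.
have [u [Lu nd uA ur]] := outer_adherent A t0.
apply: (daniell_cover Lu nd Le _ ur) => x.
have [/uA[n un]|/eA ->] := pselect (A x); first by exists n; exact: le_trans (e1 x) un.
by exists 0%N; case: (Lu 0%N).
Qed.

Lemma outer_le_daniell e A : Lp e -> (forall x, A x -> 1 <= e x) -> outer A <= I e.
Proof.
by move=> Le eA; apply: (@outer_le (fun=> e)); split=> // x /eA; exists 0%N.
Qed.

(** [daniell_layer] holds for the functional and for the integral with the same set function. Its
    upper and lower sums differ by the single term of level 0, of mass at most [C], so the two
    values differ by at most [C / N.+1] for every [N]. *)
Lemma daniell_integral_le1 h : Lp h -> (forall x, h x <= 1) ->
  \int[daniell_measure]_x h x = I h.
Proof.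
move=> [Lh h0] h1; pose J (f : T -> R) := \int[daniell_measure]_x f x.
have h01 x : 0 <= h x <= 1 by rewrite h0 h1.
have int f : L f -> daniell_measure.-integrable setT (EFin \o f).
  exact: (stone_bounded_integrable SL).
have indI A : measurable A -> J \1_A = outer A.
  by move=> mA; rewrite /J /Rintegral integral_indic// setIT.
have iind A : measurable A -> daniell_measure.-integrable setT (EFin \o \1_A).
  move=> mA; apply: (@finite_integrable _ _ _ daniell_measure _ 1) => // x.
  by rewrite indicE; case: (x \in A); rewrite ?normr1 ?normr0.
have key (N : nat) : N.+1%:R * `|J h - I h| <= C.
  have IA f g : L f -> L g -> (forall x, 0 <= f x) -> (forall x, 0 <= g x) ->
    I (fun x => f x + g x) = I f + I g by move=> *; exact: I_add.
  have IS (a : R) f : 0 <= a -> L f -> (forall x, 0 <= f x) ->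
    I (fun x => a * f x) = a * I f by move=> *; exact: I_scale.
  have Ile e A : L e -> (forall x, 0 <= e x <= 1) -> (forall x, ~ A x -> e x = 0) ->
      measurable A -> I e <= outer A.
    move=> Le e01 eA _; apply: daniell_le_outer => // [|x]; last by case/andP: (e01 x).
    by split=> // x; case/andP: (e01 x).
  have Ige e A : L e -> (forall x, 0 <= e x) -> (forall x, A x -> 1 <= e x) ->
    measurable A -> outer A <= I e by move=> *; exact: outer_le_daniell.
  have LI := daniell_layer SL N IA IS Ile Ige outer_ge0 Lh h01.
  have LJ := @daniell_layer _ _ _ _ SL J outer h N
    (fun f g Lf Lg _ _ => RintegralD measurableT (int f Lf) (int g Lg))
    (fun a f _ Lf _ => RintegralZl a measurableT (int f Lf)).
  have {}LJ H1 H2 := LJ H1 H2 outer_ge0 Lh h01.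
  have : N.+1%:R * `|J h - I h| <= outer [set x | (0%:R / N.+1%:R : R) < h x].
    have : \sum_(j < N) outer [set x | j.+1%:R / N.+1%:R < h x] <= N.+1%:R * J h <=
      \sum_(j < N.+1) outer [set x | j%:R / N.+1%:R < h x].
      apply: LJ => [e A Le e01 eA mA|e A Le e0 eA mA].
        rewrite -indI//; apply: le_Rintegral => //; [exact: int|exact: iind|].
        move=> x _; rewrite indicE; case: (boolP (x \in A)) => xA.
          by case/andP: (e01 x).
        by rewrite eA// => /mem_set; apply/negP.
      rewrite -indI//; apply: le_Rintegral => //; [exact: iind|exact: int|].
      move=> x _; rewrite indicE; case: (boolP (x \in A)) => [/[!inE]/eA//|xA].
      exact: e0.
    move: LI; rewrite [in X in _ -> X]big_ord_recl [in X in X -> _]big_ord_recl.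
    set m0 := outer _; set S := \sum_(j < N) _;
    move=> /andP[I1 I2] /andP[J1 J2].
    have -> : N.+1%:R * `|J h - I h| = `|N.+1%:R * J h - N.+1%:R * I h|.
      by rewrite -mulrBr normrM (@ger0_norm _ N.+1%:R)// ltW.
    by rewrite ler_norml; lra.
  move=> /le_trans; apply.
  have [u [[Lu nd uT ur] _ _]] := covers_unit.
  by apply: (@outer_le u); split=> // x _; exact: uT.
apply/eqP; rewrite -subr_eq0 -normr_le0; apply/ler_addgt0Pr => t t0; rewrite add0r.
have := key (Num.truncn (C / t)).
have : C / t < (Num.truncn (C / t)).+1%:R by rewrite truncnS_gt.
rewrite ltr_pdivrMr// => ht /le_lt_trans/(_ ht).
by rewrite ltr_pM2l// => /ltW.
Qed.

Lemma daniell_integral h : Lp h -> \int[daniell_measure]_x h x = I h.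
Proof.
move=> [Lh h0]; have [s hs] := stone_bounded SL Lh.
pose t := Num.max s 1; have t0 : 0 < t by rewrite lt_max ltr01 orbT.
have LhV : Lp (fun x => t^-1 * h x).
  by split; [exact: (stone_scale SL)|move=> x; rewrite mulr_ge0// invr_ge0 ltW].
have hV1 x : t^-1 * h x <= 1.
  rewrite mulrC ler_pdivrMr// mul1r (le_trans (ler_norm _))// (le_trans (hs x))//.
  by rewrite le_max lexx.
have hE : h = fun x => t * (t^-1 * h x).
  by apply/funext => x; rewrite mulrA mulfV ?gt_eqF// mul1r.
rewrite hE I_scale ?ltW// -daniell_integral_le1// RintegralZl//.
by apply: (stone_bounded_integrable SL); case: LhV.
Qed.

(** The second clause bounds the total mass by values of the functional itself. The exact bound on
    the total variation needs it, as the bounds with [C] for the two parts would only add up to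
    [2 * C]. *)
Theorem daniell_representation : exists mu : {finite_measure set T -> \bar R},
  (forall h, Lp h -> \int[mu]_x h x = I h) /\
  forall u r, (forall n, Lp (u n)) -> (forall n x, u n x <= u n.+1 x) ->
    (forall x, exists n, 1 <= u n x) -> (forall n, I (u n) <= r) ->
    fine (mu setT) <= r.
Proof.
exists daniell_measure; split=> [|u r Lu nd uT ur]; first exact: daniell_integral.
by apply: (@outer_le u); split=> // x _; exact: uT.
Qed.

End daniell.

(** * Splitting a bounded functional into two positive ones *)

Section riesz.
Context d (T : measurableType d) (R : realType).
Context (L : set (T -> R)) (SL : stone_lattice L).
Implicit Types (f g h : T -> R).
Variables (Lam : (T -> R) -> R) (C : R).
Hypothesis Lam_lin : forall (a : R) f g, L f -> L g ->
  Lam (fun x => a * f x + g x) = a * Lam f + Lam g.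
Hypothesis Lam_bound : forall f (s : R), L f -> bounded_by s f -> `|Lam f| <= C * s.

Let Lp f := L f /\ forall x, 0 <= f x.

Definition riesz_pos f : R := sup [set Lam g | g in [set g | Lp g /\ forall x, g x <= f x]].

Let Lam_add f g : L f -> L g -> Lam (fun x => f x + g x) = Lam f + Lam g.
Proof.
move=> Lf Lg; have := Lam_lin 1 Lf Lg; rewrite mul1r => <-.
by congr Lam; apply/funext => x; rewrite mul1r.
Qed.

Let Lam0 : Lam (fun=> 0) = 0.
Proof.
have := @Lam_bound (fun=> 0) 0 (stone_0 SL); rewrite mulr0 normr_le0 => H.
by apply/eqP/H => x; rewrite normr0.
Qed.

Let Lam_scale (a : R) f : L f -> Lam (fun x => a * f x) = a * Lam f.
Proof.
move=> Lf; have L0 := stone_0 SL.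
have := Lam_lin a Lf L0; rewrite Lam0 addr0 => <-.
by congr Lam; apply/funext => x; rewrite addr0.
Qed.

Let Lam_sub f g : L f -> L g -> Lam (fun x => f x - g x) = Lam f - Lam g.
Proof.
move=> Lf Lg; have := Lam_lin (-1) Lg Lf; rewrite mulN1r [RHS]addrC => <-.
by congr Lam; apply/funext => x; rewrite mulN1r addrC.
Qed.

Let C_ge0 : 0 <= C.
Proof.
have := @Lam_bound (fun=> 0) 1 (stone_0 SL) (fun x => _).
by rewrite mulr1 => H; apply: le_trans (H _); rewrite ?normr0.
Qed.

Lemma riesz_pos_has_sup f : Lp f ->
  has_sup [set Lam g | g in [set g | Lp g /\ forall x, g x <= f x]].
Proof.
move=> [Lf f0]; split; first by exists (Lam f), f.
have [s fs] := stone_bounded SL Lf.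
exists (C * s) => _ [g [[Lg g0] gf] <-]; apply: le_trans (ler_norm _) _.
apply: Lam_bound => // x; rewrite ger0_norm//.
by apply: le_trans (gf x) _; apply: le_trans (ler_norm _) (fs x).
Qed.

Lemma riesz_pos_ub f g : Lp f -> Lp g -> (forall x, g x <= f x) -> Lam g <= riesz_pos f.
Proof.
by move=> Lf Lg gf; apply: ub_le_sup; [exact: (riesz_pos_has_sup Lf).2|exists g].
Qed.

Lemma riesz_pos_le f (r : R) : Lp f ->
  (forall g, Lp g -> (forall x, g x <= f x) -> Lam g <= r) -> riesz_pos f <= r.
Proof.
move=> Lf H; apply: ge_sup; first exact: (riesz_pos_has_sup Lf).1.
by move=> _ [g [Lg gf] <-]; exact: H.
Qed.

Lemma riesz_pos_ge0 f : Lp f -> 0 <= riesz_pos f.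
Proof.
move=> Lf; have L0 : Lp (fun=> 0) by split=> //; exact: stone_0.
rewrite -Lam0; exact: riesz_pos_ub Lf L0 Lf.2.
Qed.

Let Lp_add f g : Lp f -> Lp g -> Lp (fun x => f x + g x).
Proof.
by move=> [Lf f0] [Lg g0]; split; [exact: (stone_add SL)|move=> x; rewrite addr_ge0].
Qed.

Let Lp_scale (a : R) f : 0 <= a -> Lp f -> Lp (fun x => a * f x).
Proof.
by move=> a0 [Lf f0]; split; [exact: (stone_scale SL)|move=> x; rewrite mulr_ge0].
Qed.

(** Riesz decomposition: a function [w] between 0 and [f + g] is the sum of [min w f], below [f],
    and of a remainder below [g]. *)
Lemma riesz_pos_add f g : Lp f -> Lp g ->
  riesz_pos (fun x => f x + g x) = riesz_pos f + riesz_pos g.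
Proof.
move=> Lf Lg; apply/eqP; rewrite eq_le; apply/andP; split.
  apply: riesz_pos_le; first exact: Lp_add.
  move=> w [Lw w0] wfg; pose w1 x := Num.min (w x) (f x).
  have Lw1 : Lp w1.
    split; first by apply: (stone_min SL) => //; case: Lf.
    by move=> x; rewrite le_min w0; case: Lf => _ ->.
  have w1w x : w1 x <= w x by rewrite ge_min lexx.
  have Lw2 : Lp (fun x => w x - w1 x).
    by split=> [|x]; [apply: (stone_sub SL) => //; case: Lw1|rewrite subr_ge0].
  have -> : Lam w = Lam w1 + Lam (fun x => w x - w1 x).
    by rewrite Lam_sub//; [rewrite addrC subrK|case: Lw1].
  apply: lerD; apply: riesz_pos_ub => // x; first by rewrite ge_min lexx orbT.
  have := wfg x; case: Lg => _ /(_ x); rewrite /w1.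
  by case: (leP (w x) (f x)); lra.
rewrite -lerBrDr; apply: riesz_pos_le => // u Lu uf.
rewrite lerBrDr addrC -lerBrDr; apply: riesz_pos_le => // v Lv vg.
rewrite lerBrDr addrC -Lam_add; [|by case: Lu|by case: Lv].
apply: riesz_pos_ub; try exact: Lp_add.
by move=> x; rewrite lerD.
Qed.

(** The inequality [le], used with [a^-1] on the scaled function, gives its own converse. *)
Lemma riesz_pos_scale (a : R) f : 0 <= a -> Lp f ->
  riesz_pos (fun x => a * f x) = a * riesz_pos f.
Proof.
move=> a0 Lf.
have le (b : R) g : 0 < b -> Lp g -> b * riesz_pos g <= riesz_pos (fun x => b * g x).
  move=> b0 Lg; rewrite mulrC -ler_pdivlMr//; apply: riesz_pos_le => // u Lu ug.
  rewrite ler_pdivlMr// mulrC -Lam_scale; last by case: Lu.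
  apply: riesz_pos_ub; try by apply: Lp_scale => //; exact: ltW.
  by move=> x; rewrite ler_pM2l.
move: a0; rewrite le_eqVlt => /predU1P[<-|a0].
  rewrite mul0r; have := @riesz_pos_add (fun=> 0) (fun=> 0).
  have L0 : Lp (fun=> 0) by split=> //; exact: stone_0.
  move=> /(_ L0 L0).
  rewrite (_ : (fun x => 0 + 0) = fun=> 0); last by apply/funext => x; rewrite addr0.
  rewrite (_ : (fun x => 0 * f x) = fun=> 0); last by apply/funext => x; rewrite mul0r.
  by move/eqP; rewrite -subr_eq0 opprD addrA subrr sub0r oppr_eq0 => /eqP.
apply/eqP; rewrite eq_le le// andbT.
have ai0 : 0 < a^-1 by rewrite invr_gt0.
have := le a^-1 _ ai0 (Lp_scale (ltW a0) Lf).
rewrite (_ : (fun x => a^-1 * _) = f); last first.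
  by apply/funext => x; rewrite mulrA mulVf ?gt_eqF// mul1r.
by rewrite mulrC ler_pdivrMr// mulrC.
Qed.

Lemma riesz_pos_bound f (s : R) : Lp f -> (forall x, f x <= s) -> riesz_pos f <= C * s.
Proof.
move=> Lf fs; apply: riesz_pos_le => // g [Lg g0] gf.
apply: le_trans (ler_norm _) _; apply: Lam_bound => // x.
by rewrite ger0_norm// (le_trans (gf x)).
Qed.

Let riesz_neg f := riesz_pos f - Lam f.

(** For g between 0 and f, the function [2 g - f] is bounded by [s] in absolute value. Hence the two
    parts together, and not each of them separately, satisfy the bound of [Lam]. *)
Lemma riesz_total f (s : R) : Lp f -> (forall x, f x <= s) ->
  riesz_pos f + riesz_neg f <= C * s.
Proof.
move=> Lf fs; rewrite /riesz_neg addrA lerBlDr.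
suff : riesz_pos f <= (C * s + Lam f) / 2 by lra.
apply: riesz_pos_le => // g [Lg g0] gf.
have : `|Lam (fun x => 2 * g x - f x)| <= C * s.
  apply: Lam_bound => [|x].
    by apply: (stone_sub SL); [exact: (stone_scale SL)|case: Lf].
  by rewrite ler_norml; have := g0 x; have := gf x; have := fs x; lra.
rewrite Lam_sub; [|exact: (stone_scale SL)|by case: Lf].
by rewrite Lam_scale// ler_norml => /andP[_]; lra.
Qed.

(** Both total masses are approached along the exhausting sequence. At a common index [riesz_total]
    bounds the sum of the two values by [C], hence the total variation as well. *)
Theorem riesz_representation : exists m : {charge set T -> \bar R},
  (forall h, L h -> charge_int m h = Lam h) /\ tv_norm m <= C.
Proof.
have [mu1 [mu1E mu1T]] := daniell_representation SL riesz_pos_add riesz_pos_scale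
  riesz_pos_ge0 riesz_pos_bound.
have neg_add f g : Lp f -> Lp g ->
    riesz_neg (fun x => f x + g x) = riesz_neg f + riesz_neg g.
  by move=> Lf Lg; rewrite /riesz_neg riesz_pos_add// Lam_add; [lra|case: Lf|case: Lg].
have neg_scale (a : R) f : 0 <= a -> Lp f ->
    riesz_neg (fun x => a * f x) = a * riesz_neg f.
  by move=> a0 Lf; rewrite /riesz_neg riesz_pos_scale// Lam_scale; [lra|case: Lf].
have neg_ge0 f : Lp f -> 0 <= riesz_neg f.
  by move=> Lf; rewrite subr_ge0 riesz_pos_ub.
have neg_bound f (s : R) : Lp f -> (forall x, f x <= s) -> riesz_neg f <= C * s.
  by move=> Lf fs; have := riesz_total Lf fs; have := riesz_pos_ge0 Lf; lra.
have [mu2 [mu2E mu2T]] := daniell_representation SL neg_add neg_scale neg_ge0 neg_bound.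
pose m : {charge set T -> \bar R} :=
  cadd (charge_of_finite_measure mu1) (cscale (-1) (charge_of_finite_measure mu2)).
have mE : diff_of m mu1 mu2.
  move=> A mA; rewrite /m /cadd/= /cscale/= /charge_of_finite_measure.
  rewrite -[cadd _ _ A]/(mu1 A + (-1)%:E * mu2 A)%E.
  by rewrite mulN1e fineB// fin_num_measure.
have intE h : L h -> charge_int m h = \int[mu1]_x h x - \int[mu2]_x h x.
  move=> Lh; have [s hs] := stone_bounded SL Lh.
  exact: (charge_int_diff mE (stone_measurable SL Lh) hs).
have posE h : Lp h -> charge_int m h = Lam h.
  by move=> Lh; rewrite intE ?mu1E ?mu2E//; [rewrite /riesz_neg; lra|case: Lh].
exists m; split=> [h Lh|].
  pose h1 x := Num.max (h x) 0; pose h2 x := h1 x - h x.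
  have Lh1 : Lp h1.
    by split; [exact: (stone_pos SL)|move=> x; rewrite le_max lexx orbT].
  have Lh2 : Lp h2.
    split; first by apply: (stone_sub SL) => //; case: Lh1.
    by move=> x; rewrite subr_ge0 le_max lexx.
  have hE : h = fun x => h1 x - h2 x by apply/funext => x; rewrite /h2; lra.
  have [s1 b1] := stone_bounded SL Lh1.1; have [s2 b2] := stone_bounded SL Lh2.1.
  rewrite [in RHS]hE Lam_sub; [|by case: Lh1|by case: Lh2].
  rewrite -!posE// !intE//; [|by case: Lh2|by case: Lh1].
  have i1 (mu : {finite_measure set T -> \bar R}) := finite_integrable mu (stone_measurable SL Lh1.1) b1.
  have i2 (mu : {finite_measure set T -> \bar R}) := finite_integrable mu (stone_measurable SL Lh2.1) b2.
  have hB (mu : {finite_measure set T -> \bar R}) :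
    \int[mu]_x h x = \int[mu]_x h1 x - \int[mu]_x h2 x.
    by rewrite [in LHS]hE RintegralB//; [exact: i1|exact: i2].
  by rewrite !hB; ring.
apply: le_trans (tv_norm_le_diff mE) _.
have [u [Lu u0 u1 uT]] := stone_unit SL.
have Lpu n : Lp (u n) by split=> // x; case/andP: (u0 n x).
have nd n x : u n x <= u n.+1 x by case/andP: (u0 n x).
have uT1 x : exists n, 1 <= u n x by have [n un] := uT x; exists n; rewrite un.
have mono f g : Lp f -> Lp g -> (forall x, f x <= g x) ->
    riesz_pos f <= riesz_pos g /\ riesz_neg f <= riesz_neg g.
  move=> Lf Lg fg; have Lgf : Lp (fun x => g x - f x).
    by split=> [|x]; [apply: (stone_sub SL); [case: Lg|case: Lf]|rewrite subr_ge0].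
  have gE : (fun x => f x + (g x - f x)) = g by apply/funext => x; lra.
  have := riesz_pos_add Lf Lgf; have := neg_add _ _ Lf Lgf; rewrite gE => -> ->.
  by have := riesz_pos_ge0 Lgf; have := neg_ge0 _ Lgf; lra.
rewrite leNgt; apply/negP => H.
set a := fine (mu1 setT) in H *; set b := fine (mu2 setT) in H *.
(* Half of the supposed excess: an error [t] on each of the two masses uses it up exactly. *)
pose t := (a + b - C) / 2; have t0 : 0 < t by rewrite /t; lra.
have [n1 H1] : exists n, a - t < riesz_pos (u n).
  apply: contrapT => /forallNP H'; suff : a <= a - t by lra.
  by apply: (mu1T u) => // n; rewrite leNgt; apply/negP.
have [n2 H2] : exists n, b - t < riesz_neg (u n).
  apply: contrapT => /forallNP H'; suff : b <= b - t by lra.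
  by apply: (mu2T u) => // n; rewrite leNgt; apply/negP.
have [P1 _] := mono _ _ (Lpu n1) (Lpu (maxn n1 n2)) (fun x => nd_seq_le nd x (leq_maxl n1 n2)).
have [_ P2] := mono _ _ (Lpu n2) (Lpu (maxn n1 n2)) (fun x => nd_seq_le nd x (leq_maxr n1 n2)).
have := riesz_total (Lpu (maxn n1 n2)) (u1 (maxn n1 n2)); rewrite mulr1.
by rewrite /t in H1 H2; lra.
Qed.

End riesz.

(** * Compactness and the Krein-Milman theorem *)

Section chain_compact.
Context {X : topologicalType}.

(** The supersets of members of the chain form a proper filter, and a cluster point of it lies in
    every closed member. *)
Lemma compact_chain (S : set X) (C : set (set X)) :
  compact S -> C !=set0 -> (forall A, C A -> [/\ closed A, A !=set0 & A `<=` S]) ->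
  (forall A B, C A -> C B -> A `<=` B \/ B `<=` A) ->
  exists p, S p /\ forall A, C A -> A p.
Proof.
move=> cS [A0 CA0] CP tot.
pose F : set_system X := [set U | exists2 A, C A & A `<=` U].
have FF : Filter F.
  split; first by exists A0.
  - move=> P Q [A CA AP] [B CB BQ]; have [AB|BA] := tot _ _ CA CB.
      by exists A => // x Ax; split; [exact: AP|exact/BQ/AB].
    by exists B => // x Bx; split; [exact/AP/BA|exact: BQ].
  - by move=> P Q PQ [A CA AP]; exists A => // x /AP/PQ.
have PF : ProperFilter F.
  split=> // -[A CA A0']; have [_ [x Ax] _] := CP _ CA.
  exact: A0' Ax.
have [|p [Sp clp]] := cS F PF; first by exists A0 => //; case: (CP _ CA0).
exists p; split=> // A CA; have [cA _ _] := CP _ CA.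
by apply: cA => U Up; apply: clp => //; exists A.
Qed.

End chain_compact.

Section real_continuity.
Context {X : topologicalType} (R : realType).

Lemma closed_level (q : X -> R) (A : set R) : continuous q -> closed A ->
  closed [set x | A (q x)].
Proof. by move=> cq cA; apply: (@closed_comp _ _ q A) => // x _; exact: cq. Qed.

Lemma sum_continuous (I : Type) (r : seq I) (u : I -> X -> R) :
  (forall i, continuous (u i)) -> continuous (fun x => \sum_(i <- r) u i x).
Proof.
move=> cu; elim: r => [|i r IH].
  rewrite (_ : (fun x => _) = cst 0); first exact: cst_continuous.
  by apply/funext => x; rewrite big_nil.
rewrite (_ : (fun x => _) = fun x => u i x + \sum_(i <- r) u i x).
  by move=> x; apply: cvgD; [exact: cu|exact: IH].
by apply/funext => x; rewrite big_cons.
Qed.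

Lemma scale_continuous (a : R) (u : X -> R) : continuous u ->
  continuous (fun x => a * u x).
Proof. by move=> cu x; apply: cvgM; [exact: cvg_cst|exact: cu]. Qed.

Lemma shift_continuous (a : R) (u : X -> R) : continuous u ->
  continuous (fun x => a + u x).
Proof. by move=> cu x; apply: cvgD; [exact: cvg_cst|exact: cu]. Qed.

Lemma sqr_dist_continuous (a : R) (u : X -> R) : continuous u ->
  continuous (fun x => (u x - a) ^+ 2).
Proof.
by move=> cu x; apply: cvgM; apply: cvgB; try exact: cvg_cst; exact: cu.
Qed.

End real_continuity.

(** * The Krein-Milman theorem in a product of real lines *)

Section krein_milman.
Context (R : realType) (J : choiceType).
Local Notation W := (prod_topology (fun _ : J => R)).
Implicit Types (S F K : set W) (f g h x z : W).

Lemma prod_eval_continuous (j : J) : continuous (fun x : W => x j).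
Proof. by move=> x; exact: (@proj_continuous J (fun _ => R) j x). Qed.

Lemma prod_cvg (F : set_system W) (f : W) : Filter F ->
  (forall j, g j @[g --> F] --> f j) -> F --> f.
Proof.
move=> FF Fj; apply/cvg_sup => j.
apply/cvg_image => [|A /= /(Fj j)].
  apply/seteqP; split=> // r _; exists (fun=> r) => //.
rewrite nbhs_simpl /= => FA; exists ((fun g : W => g j) @^-1` A) => //.
apply/seteqP; split=> [_ [g /= Ag <-]//|r Ar]; exists (fun=> r) => //.
Qed.

Lemma prod_continuous (X : topologicalType) (phi : X -> W) :
  (forall j, continuous (fun t => phi t j)) -> continuous phi.
Proof.
move=> c t; have FF : Filter (phi @ t) by exact: fmap_filter.
exact: (@prod_cvg _ (phi t) FF (fun j => c j t)).
Qed.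

Lemma prod_hausdorff : hausdorff_space W.
Proof. by apply: hausdorff_product => j; exact: Rhausdorff. Qed.

(** Basic neighbourhoods are written with a Euclidean distance in finitely many coordinates, so that
    separation can be done by projecting onto a closed convex set. *)
Lemma prod_nbhs (f : W) (U : set W) : nbhs f U ->
  exists (js : seq J) (e : R), 0 < e /\
    forall x, \sum_(j <- js) (x j - f j) ^+ 2 < e -> U x.
Proof.
pose F : set_system W := [set U | exists (js : seq J) (e : R), 0 < e /\
    forall x, \sum_(j <- js) (x j - f j) ^+ 2 < e -> U x].
have sq_ge0 (js : seq J) x : 0 <= \sum_(j <- js) (x j - f j) ^+ 2.
  by apply: sumr_ge0 => j _; exact: sqr_ge0.
have FF : Filter F.
  split; first by exists [::], 1.
  - move=> P Q [js1 [e1 [e10 H1]]] [js2 [e2 [e20 H2]]].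
    exists (js1 ++ js2), (Num.min e1 e2); split; first by rewrite lt_min e10.
    move=> x; rewrite big_cat/= lt_min => /andP[x1 x2].
    have := sq_ge0 js1 x; have := sq_ge0 js2 x.
    by split; [apply: H1|apply: H2]; lra.
  - by move=> P Q PQ [js [e [e0 H]]]; exists js, e; split=> // x /H/PQ.
suff : F --> f by move=> Ff /Ff.
apply: prod_cvg => j; apply/cvgrPdist_lt => e e0.
exists [:: j], (e ^+ 2); split; first by rewrite exprn_gt0.
move=> x; rewrite big_seq1 -[X in X < _]real_normK ?num_real//.
rewrite [X in _ -> X < _]distrC ltr_pXn2r// ?nnegrE//; exact: ltW.
Qed.

Definition extreme_in K : set W := [set f | K f /\
  forall g h (s : R), K g -> K h -> 0 < s < 1 ->
    f = (fun j => s * g j + (1 - s) * h j) -> g = f /\ h = f].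

Definition hull K : set W := [set f | exists (k : nat) (w : 'I_k -> R) (g : 'I_k -> W),
  [/\ forall i, 0 <= w i, \sum_i w i = 1, forall i, K (g i) &
      f = fun j => \sum_i w i * g i j]].

Lemma hull2 K f g (s : R) : hull K f -> hull K g -> 0 <= s <= 1 ->
  hull K (fun j => s * f j + (1 - s) * g j).
Proof.
move=> [k [w [u [w0 w1 uK fE]]]] [l [v [z [v0 v1 zK gE]]]] /andP[s0 s1].
pose split_fun (T : Type) (a : 'I_k -> T) (b : 'I_l -> T) (i : 'I_(k + l)) :=
  match fintype.split i with inl i1 => a i1 | inr i2 => b i2 end.
have splitl T a b i : split_fun T a b (lshift l i) = a i.
  by rewrite /split_fun -/(unsplit (inl i)) unsplitK.
have splitr T a b i : split_fun T a b (rshift k i) = b i.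
  by rewrite /split_fun -/(unsplit (inr i)) unsplitK.
exists (k + l)%N, (split_fun R (fun i => s * w i) (fun i => (1 - s) * v i)),
  (split_fun W u z); split.
- move=> i; rewrite /split_fun; case: fintype.split => i'; rewrite mulr_ge0//.
  by rewrite subr_ge0.
- rewrite big_split_ord/=; under eq_bigr do rewrite splitl.
  under [X in _ + X]eq_bigr do rewrite splitr.
  by rewrite -!mulr_sumr w1 v1; lra.
- by move=> i; rewrite /split_fun; case: fintype.split.
- apply/funext => j; rewrite fE gE big_split_ord/=.
  under [X in _ = X + _]eq_bigr do rewrite !splitl -mulrA.
  under [X in _ = _ + X]eq_bigr do rewrite !splitr -mulrA.
  by rewrite !mulr_sumr.
Qed.

Lemma hull_sub K : K `<=` hull K.
Proof.
move=> f Kf; exists 1%N, (fun=> 1), (fun=> f); split=> //.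
  by rewrite big_ord1.
by apply/funext => j; rewrite big_ord1 mul1r.
Qed.

Definition face S F := [/\ closed F, F !=set0, F `<=` S &
  forall g h (s : R), S g -> S h -> 0 < s < 1 ->
    F (fun j => s * g j + (1 - s) * h j) -> F g /\ F h].

(** A proper convex combination attains the minimum of an affine function only if both end points
    do. *)
Lemma face_min S F (q : W -> R) : compact S -> face S F -> continuous q ->
  (forall g h (s : R), q (fun j => s * g j + (1 - s) * h j) = s * q g + (1 - s) * q h) ->
  exists2 c : R, face S (F `&` [set x | q x = c]) & forall x, F x -> c <= q x.
Proof.
move=> cS [cF F0 FS Fseg] cq qlin.
have cptF : compact F by apply: subclosed_compact cF cS FS.
have [c cF' cmin] := compact_EVT_min F0 cptF (continuous_subspaceT cq).
rewrite inE in cF'; exists (q c); last by move=> x Fx; apply: cmin; rewrite inE.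
split.
- by apply: closedI => //; apply: (closed_level (A := [set r | r = q c]) cq); exact: closed_eq.
- by exists c.
- by move=> x [/FS].
- move=> g h s Sg Sh /[dup] s01 /andP[s0 s1] [/(Fseg _ _ _ Sg Sh s01)[Fg Fh]] /= qE.
  have qg : q c <= q g by apply: cmin; rewrite inE.
  have qh : q c <= q h by apply: cmin; rewrite inE.
  rewrite qlin in qE.
  have e1 : s * (q g - q c) + (1 - s) * (q h - q c) = 0 by rewrite -qE; ring.
  have e2 : 0 <= s * (q g - q c) by rewrite mulr_ge0 ?subr_ge0// ltW.
  have e3 : 0 <= (1 - s) * (q h - q c) by rewrite mulr_ge0 ?subr_ge0// ltW.
  have : s * (q g - q c) = 0 by lra.
  have : (1 - s) * (q h - q c) = 0 by lra.
  move=> /eqP; rewrite mulf_eq0 !subr_eq0 => /orP[/eqP|/eqP ->]; first by lra.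
  move=> /eqP; rewrite mulf_eq0 !subr_eq0 => /orP[/eqP|/eqP ->]; first by lra.
  by [].
Qed.

(** A minimal face is a single point: by [face_min] every coordinate is constant on it. *)
Lemma extreme_exists S : compact S -> S !=set0 -> exists e, extreme_in S e.
Proof.
move=> cS S0.
have closedS : closed S by apply: compact_closed => //; exact: prod_hausdorff.
have fS : face S S by split.
pose T := {F : set W | face S F}.
(* Reverse inclusion, so that a maximal element for Zorn is a minimal face. *)
pose le (F G : T) : bool := `[< sval G `<=` sval F >].
have [| | | |[F fF] Fmin] := @Zorn T le.
- by move=> F; apply/asboolP.
- by move=> F G H /asboolP FG /asboolP GH; apply/asboolP; exact: subset_trans FG.
- move=> [F fF] [G fG] /asboolP/= FG /asboolP/= GF.
  by apply: eq_exist => /=; apply/seteqP.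
- move=> A totA; have [[F0 AF0]|A0] := pselect (A !=set0); last first.
    by exists (exist _ S fS) => s As; exfalso; apply: A0; exists s.
  pose C := [set G : set W | exists2 F, A F & sval F = G].
  have C0 : C !=set0 by exists (sval F0), F0.
  have CP G : C G -> [/\ closed G, G !=set0 & G `<=` S].
    by move=> [F AF <-]; have [cF F0' FS _] := svalP F.
  have totC G H : C G -> C H -> G `<=` H \/ H `<=` G.
    by move=> [F AF <-] [F' AF' <-]; have [/asboolP|/asboolP] := totA _ _ AF AF'; tauto.
  have [p [Sp Cp]] := compact_chain cS C0 CP totC.
  have fI : face S (\bigcap_(G in C) G).
    split.
    - by apply: closed_bigI => G /CP[].
    - by exists p => G /Cp.
    - by move=> x /(_ _ (ex_intro2 _ _ F0 AF0 erefl)); have [_ _] := CP _ (ex_intro2 _ _ F0 AF0 erefl); apply.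
    - move=> g h s Sg Sh s01 Cs; split=> G CG; have [F AF FE] := CG;
      have [_ _ _ seg] := svalP F; rewrite -FE;
      by have := seg _ _ _ Sg Sh s01 (_ : sval F _); rewrite FE => /(_ (Cs _ CG))[].
  exists (exist _ _ fI) => F AF; apply/asboolP => /= x; apply.
  by exists F.
have [_ [e Fe] FS seg] := fF.
have Fsing p : F p -> p = e.
  move=> Fp; apply/funext => j.
  have [c fc cmin] := face_min cS fF (@prod_eval_continuous j) (fun g h s => erefl).
  have := Fmin (exist _ _ fc); rewrite /le/= => H.
  have /(congr1 sval)/= FE : (exist _ _ fc : T) = exist _ F fF.
    by apply: H; apply/asboolP => x [].
  have [_ ->] : (F `&` [set x | x j = c]) p by rewrite FE.
  by have [_ ->] : (F `&` [set x | x j = c]) e by rewrite FE.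
exists e; split; first exact: FS.
by move=> g h s Sg Sh s01 eE; rewrite eE in Fe; have [/Fsing -> /Fsing ->] := seg _ _ _ Sg Sh s01 Fe.
Qed.

Theorem krein_milman K : compact K -> hull K `<=` K ->
  K = closure (hull (extreme_in K)).
Proof.
move=> cK hK.
have closedK : closed K by apply: compact_closed => //; exact: prod_hausdorff.
have hullmono A B : A `<=` B -> hull A `<=` hull B.
  by move=> AB f [k [w [g [w0 w1 gA fE]]]]; exists k, w, g; split=> // i; exact: AB.
have HK : hull (extreme_in K) `<=` K.
  by apply: subset_trans hK; apply: hullmono => f [].
apply/seteqP; split; last first.
  by rewrite [X in _ `<=` X](closure_id K).1//; exact: closure_subset.
move=> x0 Kx0; apply: contrapT => nx0.
set H := hull (extreme_in K) in HK nx0.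
(* A neighbourhood of [x0] involves finitely many coordinates, so the point [c] of
   [closure H] nearest to [x0] in these coordinates yields a separating functional. *)
have [js [e [e0 sep]]] : exists (js : seq J) (e : R), 0 < e /\
    forall x, H x -> e <= \sum_(j <- js) (x j - x0 j) ^+ 2.
  have [U [nU HU]] : exists U, nbhs x0 U /\ H `&` U = set0.
    apply: contrapT => /forallNP nU; apply: nx0 => U nUx.
    by apply/set0P/eqP => HU; apply: (nU U).
  have [js [e [e0 sU]]] := prod_nbhs nU; exists js, e; split=> // x Hx.
  by rewrite leNgt; apply/negP => /sU Ux; have : (H `&` U) x by []; rewrite HU.
pose q (x : W) := \sum_(j <- js) (x j - x0 j) ^+ 2.
have cq : continuous q.
  by apply: sum_continuous => j; apply: sqr_dist_continuous; exact: prod_eval_continuous.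
have [e1 Ke1] := extreme_exists cK (ex_intro _ _ Kx0).
have He1 : H e1 by exact: hull_sub.
have cC : compact (closure H).
  apply: (subclosed_compact _ cK); first exact: closed_closure.
  by rewrite [X in _ `<=` X](closure_id K).1//; exact: closure_subset.
have C0 : closure H !=set0 by exists e1; exact: subset_closure.
have [c Cc cmin] := compact_EVT_min C0 cC (continuous_subspaceT cq).
rewrite inE in Cc.
have qc : e <= q c.
  have : closed [set x | e <= q x].
    by apply: (closed_level (A := [set r | e <= r]) cq); exact: closed_ge.
  move/closure_id => qE; have : closure [set x | e <= q x] c.
    by apply: closure_subset Cc => x; exact: sep.
  by rewrite -qE.
(* Variational inequality for the nearest point: moving [c] towards [z] cannot decrease [q], and the
   derivative of [q] at [c] in that direction is twice this sum. *)
have key z : H z -> 0 <= \sum_(j <- js) (c j - x0 j) * (z j - c j).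
  move=> Hz; pose D := \sum_(j <- js) (c j - x0 j) * (z j - c j).
  pose Q := \sum_(j <- js) (z j - c j) ^+ 2.
  have Q0 : 0 <= Q by apply: sumr_ge0 => j _; exact: sqr_ge0.
  have st s : 0 < s -> s <= 1 -> 0 <= 2 * D + s * Q.
    move=> s0 s1; pose phi (x : W) : W := fun j => s * z j + (1 - s) * x j.
    have cphi : continuous phi.
      apply: prod_continuous => j; rewrite /phi.
      apply: (@shift_continuous _ _ (s * z j) (fun x : W => (1 - s) * x j)).
      by apply: scale_continuous; exact: prod_eval_continuous.
    have Cphi : closure H (phi c).
      move=> U /cphi /Cc[x [Hx Ux]]; exists (phi x); split=> //.
      by apply: hull2 => //; rewrite s1 ltW.
    have := cmin (phi c); rewrite inE => /(_ Cphi).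
    have -> : q (phi c) = q c + s * (2 * D + s * Q).
      rewrite /q /D /Q mulrDr !mulr_sumr -!big_split/=; apply: eq_bigr => j _.
      by rewrite /phi; ring.
    by rewrite lerDl pmulr_rge0.
  rewrite -/D leNgt; apply/negP => D0.
  have Q1 : 0 < Q + 1 by rewrite ltr_wpDl.
  (* With this step [s * Q] is at most [- D], so [2 * D + s * Q] is at most [D], which is
     negative. *)
  pose s := Num.min 1 (- D / (Q + 1)).
  have D1 : 0 < - D / (Q + 1) by rewrite divr_gt0// oppr_gt0.
  have s0 : 0 < s by rewrite lt_min ltr01.
  have s1 : s <= 1 by rewrite ge_min lexx.
  have := st _ s0 s1.
  have : s * Q <= - D.
    apply: (@le_trans _ _ (- D / (Q + 1) * (Q + 1))); last by rewrite divfK ?gt_eqF.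
    apply: ler_pM => //; first exact: ltW; last by rewrite lerDl.
    by rewrite ge_min lexx orbT.
  lra.
pose l (x : W) := \sum_(j <- js) (c j - x0 j) * x j.
have cl : continuous l.
  by apply: sum_continuous => j; apply: scale_continuous; exact: prod_eval_continuous.
have llin g h (s : R) : l (fun j => s * g j + (1 - s) * h j) = s * l g + (1 - s) * l h.
  by rewrite /l !mulr_sumr -big_split/=; apply: eq_bigr => j _; ring.
have lH z : H z -> l x0 < l z.
  move=> Hz; have := key _ Hz; have : l z - l x0 = q c +
      \sum_(j <- js) (c j - x0 j) * (z j - c j).
    rewrite /l /q -sumrB -big_split/=; apply: eq_bigr => j _; ring.
  lra.
(* An extreme point of the face of [K] where [l] is minimal is extreme in [K], so it lies in [H],
   where [l] exceeds [l x0]. Yet this minimum is at most [l x0]. *)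
have fK : face K K by split=> //; exists x0.
have [m fm mmin] := face_min cK fK cl llin.
have [cF F0 FK Fseg] := fm.
have cptF : compact (K `&` [set x | l x = m]) by apply: subclosed_compact cF cK FK.
have [p [[Kp lp] pext]] := extreme_exists cptF F0.
have Kpe : extreme_in K p.
  split=> // g h s Kg Kh s01 pE.
  have [Fg Fh] : (K `&` [set x | l x = m]) g /\ (K `&` [set x | l x = m]) h.
    by apply: (Fseg g h s) => //; rewrite -pE.
  exact: pext s01 pE.
have := lH _ (hull_sub Kpe); rewrite (lp : l p = m).
by have := mmin _ Kx0; lra.
Qed.

End krein_milman.

(** * Smooth functions and test functions *)

Section derivation_lemmas.
Context (R : realType).
Implicit Types (u v f F : R -> R).
Local Notation mu := (@lebesgue_measure R).

Lemma is_derive_derive1 u (x d : R) : is_derive x 1 u d -> derive1 u x = d.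
Proof. by move=> h; rewrite derive1E derive_val. Qed.

Lemma derivable_is_derive u (x : R) : derivable u x 1 -> is_derive x 1 u (derive1 u x).
Proof. by move=> h; rewrite derive1E; exact: derivableP. Qed.

Lemma derivable_continuous u : (forall x, derivable u x 1) -> continuous u.
Proof.
by move=> du x; apply: differentiable_continuous; apply/derivable1_diffP.
Qed.

Lemma is_derive_continuous u v : (forall x : R, is_derive x 1 u (v x)) -> continuous u.
Proof. by move=> du; apply: derivable_continuous => x; have [] := du x. Qed.

Lemma continuous_integrable_itv f (a b : R) : continuous f ->
  mu.-integrable `[a, b] (EFin \o f).
Proof.
move=> cf; apply: continuous_compact_integrable; first exact: segment_compact.
exact: continuous_subspaceT.
Qed.

Lemma Rintegral_FTC F f (a b : R) : (forall x : R, is_derive x 1 F (f x)) ->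
  continuous f -> a <= b -> \int[mu]_(x in `[a, b]) f x = F b - F a.
Proof.
move=> dF cf; rewrite le_eqVlt => /predU1P[<-|ab].
  by rewrite set_itv1 Rintegral_set1 subrr.
rewrite /Rintegral (@continuous_FTC2 _ f F)//.
- exact: continuous_subspaceT.
- have cF := is_derive_continuous dF.
  split.
  + by move=> x _; have [] := dF x.
  + by apply: cvg_at_right_filter; exact: cF.
  + by apply: cvg_at_left_filter; exact: cF.
- by move=> x _; exact: is_derive_derive1.
Qed.

Lemma Rintegral_itv_split f (a b c : R) : continuous f -> a <= b -> b <= c ->
  \int[mu]_(x in `[a, c]) f x =
  \int[mu]_(x in `[a, b]) f x + \int[mu]_(x in `[b, c]) f x.
Proof.
move=> cf ab bc.
have := @Rintegral_itvB _ f (BLeft a) (BRight c) b (continuous_integrable_itv a c cf).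
rewrite !bnd_simp => /(_ ab bc) E.
rewrite -(@Rintegral_itv_obnd_cbnd _ b (BRight c)); last first.
  apply: integrableS (continuous_integrable_itv b c cf) => //.
  by apply: subset_itvr; rewrite bnd_simp.
by rewrite -E addrC subrK.
Qed.

(** The primitive based at 0 is, for either sign of [x], a difference of two integrals with the same
    left end [a]. The choice of [a] is immaterial, so near a given point one fixed [a] may be
    used. *)
Lemma primitive_exists f : continuous f -> exists F, forall x : R, is_derive x 1 F (f x).
Proof.
move=> cf.
pose G (a x : R) := \int[mu]_(t in `[a, x]) f t - \int[mu]_(t in `[a, 0]) f t.
have GE a b x : a <= b -> b <= x -> b <= 0 -> G a x = G b x.
  move=> ab bx b0; rewrite /G (Rintegral_itv_split cf ab bx).
  by rewrite (Rintegral_itv_split cf ab b0); lra.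
pose F x := G (- `|x|) x.
have FE a x : a <= - `|x| -> G a x = F x.
  move=> ax; apply: GE => //; rewrite ?oppr_le0//.
  by rewrite lerNl -normrN ler_norm.
exists F => x; pose a := - (`|x| + 1).
have ax : a < x by rewrite /a ltrNl -normrN (le_lt_trans (ler_norm _))// ltrDl.
have [dG GD] := @continuous_FTC1_closed R f a x (x + 1) (ltr_pwDr ltr01 (lexx x))
  (continuous_integrable_itv a (x + 1) cf) ax (cf x).
have isG : is_derive x 1 (G a) (f x).
  have := derivable_is_derive dG; rewrite GD => h.
  have := @is_deriveB _ _ _ _ _ x 1 _ _ h (is_derive_cst _ _ _ : is_derive x 1 (cst (\int[mu]_(t in `[a, 0]) f t)) 0).
  by rewrite subr0; exact.
apply: (@near_eq_is_derive _ _ _ (G a)) => //.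
near=> y; apply: FE; rewrite /a lerN2.
have : `|y - x| < 1.
  by near: y; apply: filterS (nbhsx_ballx x _ ltr01) => z; rewrite /ball/= distrC.
by have := ler_normD (y - x) x; rewrite subrK; lra.
Unshelve. all: by end_near. Qed.

End derivation_lemmas.

Section smooth_functions.
Context (R : realType).
Implicit Types (u v : R -> R).

(** Derivability up to order [n], peeled off from the first derivative. In this form stability under
    sums, products and affine substitutions is a plain induction. *)
Fixpoint Ck (n : nat) u : Prop :=
  if n is n'.+1 then (forall x, derivable u x 1) /\ Ck n' (derive1 u) else True.

Lemma derive1nSr u n : (derive1 u)^`(n) = u^`(n.+1).
Proof. by rewrite /derive1n -iterSr. Qed.

Lemma smoothP u : smooth u <-> forall n, Ck n u.
Proof.
split=> [su n|Cu n].
  elim: n u su => //= n IH u su; split=> [x|]; first exact: (su 0%N).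
  by apply: IH => m x; rewrite derive1nSr; exact: su.
elim: n u Cu => [|n IH] u Cu x; first by have [] := Cu 1%N.
by rewrite -derive1nSr; apply: IH => m; have [] := Cu m.+1.
Qed.

Lemma CkS n u : Ck n.+1 u -> Ck n u.
Proof. by elim: n u => //= n IH u [du [dv Cv]]; split=> //; apply: IH. Qed.

Lemma smooth_derivable u (x : R) : smooth u -> derivable u x 1.
Proof. by move=> /(_ 0%N x). Qed.

Lemma smooth_is_derive u (x : R) : smooth u -> is_derive x 1 u (derive1 u x).
Proof. by move=> su; apply/derivable_is_derive/smooth_derivable. Qed.

Lemma smooth_derive u : smooth u -> smooth (derive1 u).
Proof. by move=> su n x; rewrite derive1nSr; exact: su. Qed.

Lemma smooth_continuous u : smooth u -> continuous u.
Proof. by move=> su; apply: derivable_continuous => x; exact: smooth_derivable. Qed.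

Lemma smooth_primitive u v : (forall x : R, is_derive x 1 u (v x)) -> smooth v -> smooth u.
Proof.
move=> du sv; apply/smoothP => -[//|n]; split; first by move=> x; have [] := du x.
rewrite (_ : derive1 u = v); first by have /smoothP := sv.
by apply/funext => x; exact: is_derive_derive1.
Qed.

Lemma Ck_cst n (a : R) : Ck n (cst a).
Proof.
elim: n a => //= n IH a; split=> [x|]; first exact: derivable_cst.
by rewrite (_ : derive1 (cst a) = cst 0)//; apply/funext => x; rewrite derive1_cst.
Qed.

Lemma derive1D_fun u v : (forall x, derivable u x 1) -> (forall x, derivable v x 1) ->
  derive1 (fun x => u x + v x) = (fun x => derive1 u x + derive1 v x).
Proof.
move=> du dv; apply/funext => x; apply: is_derive_derive1.
by apply: is_deriveD; exact: derivable_is_derive.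
Qed.

Lemma derive1M_fun u v : (forall x, derivable u x 1) -> (forall x, derivable v x 1) ->
  derive1 (fun x => u x * v x) = (fun x => derive1 u x * v x + u x * derive1 v x).
Proof.
move=> du dv; apply/funext => x; apply: is_derive_derive1.
have := is_deriveM (derivable_is_derive (du x)) (derivable_is_derive (dv x)).
by move/is_derive_eq; apply; rewrite addrC /GRing.scale/= [v x * _]mulrC.
Qed.

Lemma CkD n u v : Ck n u -> Ck n v -> Ck n (fun x => u x + v x).
Proof.
elim: n u v => //= n IH u v [du Cu] [dv Cv]; split.
  by move=> x; apply: derivableD.
by rewrite derive1D_fun//; exact: (IH _ _ Cu Cv).
Qed.

Lemma CkM n u v : Ck n u -> Ck n v -> Ck n (fun x => u x * v x).
Proof.
elim: n u v => // n IH u v Cu Cv; have [du Cu'] := Cu; have [dv Cv'] := Cv.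
split; first by move=> x; apply: derivableM.
rewrite derive1M_fun//; apply: CkD; apply: IH => //; exact: CkS.
Qed.

Lemma smooth_cst (a : R) : smooth (fun=> a).
Proof. by apply/smoothP => n; exact: Ck_cst. Qed.

Lemma smoothD u v : smooth u -> smooth v -> smooth (fun x => u x + v x).
Proof. by move=> /smoothP su /smoothP sv; apply/smoothP => n; exact: CkD. Qed.

Lemma smoothM u v : smooth u -> smooth v -> smooth (fun x => u x * v x).
Proof. by move=> /smoothP su /smoothP sv; apply/smoothP => n; exact: CkM. Qed.

Lemma smoothZ (a : R) u : smooth u -> smooth (fun x => a * u x).
Proof. by move=> su; apply: smoothM su; exact: smooth_cst. Qed.

Lemma is_derive_affine u (a b x : R) : derivable u (a * x + b) 1 ->
  is_derive x 1 (fun y => u (a * y + b)) (a * derive1 u (a * x + b)).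
Proof.
move=> /derivable_is_derive du.
have da : is_derive x 1 (fun y : R => a * y + b) a.
  have := @is_deriveD _ _ _ (fun y : R => a * y) (cst b) x 1 a 0.
  rewrite addr0; apply.
  have := @is_deriveZ _ _ _ (@id R) a x 1 1 (is_derive_id _ _).
  by rewrite /GRing.scale/= mulr1.
by have := @is_derive1_comp _ u _ x _ _ du da; rewrite mulrC.
Qed.

Lemma smooth_affine u (a b : R) : smooth u -> smooth (fun x => u (a * x + b)).
Proof.
move=> /smoothP su; apply/smoothP => n; elim: n u su => // n IH u su.
have du x : derivable u x 1 by have [] := su 1%N.
split; first by move=> x; have [] := is_derive_affine (du (a * x + b)).
rewrite (_ : derive1 _ = fun x => a * derive1 u (a * x + b)).
  by apply: CkM; [exact: Ck_cst|apply: IH => m; have [] := su m.+1].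
by apply/funext => x; apply/is_derive_derive1/is_derive_affine.
Qed.

Lemma is_derive_expZ (a x : R) :
  is_derive x 1 (fun y => expR (a * y)) (a * expR (a * x)).
Proof.
have := @is_derive_affine expR a 0 x; rewrite addr0 => h.
have -> : (fun y => expR (a * y)) = (fun y => expR (a * y + 0)).
  by apply/funext => y; rewrite addr0.
have d := is_derive_expR (a * x); have [dx _] := d.
by have := h dx; rewrite (is_derive_derive1 d).
Qed.

End smooth_functions.

Section test_functions.
Context (R : realType).
Implicit Types (u v psi : R -> R).
Local Notation mu := (@lebesgue_measure R).

Definition vanishes_outside u (B : R) := forall x, B < `|x| -> u x = 0.

Lemma test_funP psi : test_fun psi <-> smooth psi /\ exists B, vanishes_outside psi B.
Proof.
split=> [[spsi cpsi]|[spsi [B psiB]]]; split=> //.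
  have [B [_ HB]] := compact_bounded cpsi.
  exists (B + 1) => x xB; apply/eqP; apply: contraTT xB => px; rewrite -leNgt.
  by apply: (HB (B + 1)); [rewrite ltrDl|exact: subset_closure].
apply: (subclosed_compact _ (@segment_compact _ (- B) B)); first exact: closed_closure.
rewrite [X in _ `<=` X](closure_id _).1; last exact: interval_closed.
apply: closure_subset => x /= px; rewrite in_itv/= -ler_norml leNgt.
by apply/negP => /psiB /eqP; apply/negP.
Qed.

Lemma test_smooth psi : test_fun psi -> smooth psi.
Proof. by case. Qed.

Lemma test_continuous psi : test_fun psi -> continuous psi.
Proof. by case=> /smooth_continuous. Qed.

Lemma vanishes_le u (B B' : R) : B <= B' -> vanishes_outside u B -> vanishes_outside u B'.
Proof. by move=> BB uB x xB; apply: uB; exact: le_lt_trans xB. Qed.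

Lemma test_mul_smooth u psi : smooth u -> test_fun psi -> test_fun (fun x => psi x * u x).
Proof.
move=> su /test_funP[sp [B pB]]; apply/test_funP; split; first exact: smoothM.
by exists B => x /pB ->; rewrite mul0r.
Qed.

Lemma test_scale (a : R) psi : test_fun psi -> test_fun (fun x => a * psi x).
Proof.
move=> tp; rewrite (_ : (fun x => _) = fun x => psi x * a).
  by apply: test_mul_smooth => //; exact: smooth_cst.
by apply/funext => x; rewrite mulrC.
Qed.

Lemma test_add u v : test_fun u -> test_fun v -> test_fun (fun x => u x + v x).
Proof.
move=> /test_funP[su [B uB]] /test_funP[sv [B' vB]]; apply/test_funP.
split; first exact: smoothD.
exists (Num.max B B') => x; rewrite gt_max => /andP[/uB -> /vB ->].
by rewrite addr0.
Qed.

Lemma test_0 : test_fun (fun=> 0 : R).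
Proof. by apply/test_funP; split; [exact: smooth_cst|exists 0]. Qed.

Lemma test_sum (I : Type) (r : seq I) (u : I -> R -> R) :
  (forall i, test_fun (u i)) -> test_fun (fun x => \sum_(i <- r) u i x).
Proof.
move=> tu; elim: r => [|i r IH].
  by rewrite (_ : (fun x => _) = fun=> 0); [exact: test_0|apply/funext => x; rewrite big_nil].
have -> : (fun x => \sum_(j <- i :: r) u j x) = fun x => u i x + \sum_(j <- r) u j x.
  by apply/funext => x; rewrite big_cons.
exact: test_add.
Qed.

Lemma derive1_local0 u (x : R) : (\forall y \near x, u y = 0) -> derive1 u x = 0.
Proof.
move=> u0; apply: is_derive_derive1.
apply: (@near_eq_is_derive _ _ _ (cst 0)) => //.
by apply: filterS u0 => y ->.
Qed.

Lemma vanishes_derive u (B : R) : vanishes_outside u B -> vanishes_outside (derive1 u) B.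
Proof.
move=> uB x xB; apply: derive1_local0.
have : nbhs x [set y | B < `|y|].
  apply: (@open_nbhs_nbhs _ x); split=> //.
  apply: (@open_comp _ _ (fun y : R => `|y|) [set y | B < y]); last exact: open_gt.
  by move=> y _; exact: norm_continuous.
by apply: filterS => y /uB.
Qed.

Lemma test_derive psi : test_fun psi -> test_fun (derive1 psi).
Proof.
move=> /test_funP[sp [B pB]]; apply/test_funP; split; first exact: smooth_derive.
by exists B; exact: vanishes_derive.
Qed.

Lemma test_affine psi (a b : R) : a != 0 -> test_fun psi ->
  test_fun (fun x => psi (a * x + b)).
Proof.
move=> a0 /test_funP[sp [B pB]]; apply/test_funP; split; first exact: smooth_affine.
exists ((B + `|b|) / `|a|) => x; rewrite ltr_pdivrMr ?normr_gt0// => xB.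
apply: pB; have := ler_normB (a * x + b) b.
by rewrite addrK normrM mulrC; lra.
Qed.

Lemma Rintegral_zero_outside f (D : set R) : (forall x, ~ D x -> f x = 0) ->
  \int[mu]_x f x = \int[mu]_(x in D) f x.
Proof.
move=> fD; rewrite [RHS]Rintegral_mkcond; apply: eq_Rintegral => x _.
by rewrite patchE; case: ifPn => // /negP; rewrite inE => /fD.
Qed.

Lemma Rintegral_vanishes f (B : R) : vanishes_outside f B ->
  \int[mu]_x f x = \int[mu]_(x in `[- B, B]) f x.
Proof.
move=> fB; apply: Rintegral_zero_outside => x; rewrite /= in_itv/= -ler_norml.
by move=> /negP; rewrite -ltNge => /fB.
Qed.

Lemma integrable_vanishes f (B : R) : continuous f -> vanishes_outside f B ->
  mu.-integrable setT (EFin \o f).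
Proof.
move=> cf fB; have := continuous_integrable_itv (- B) B cf.
rewrite integrable_mkcond//; apply: eq_integrable => // x _.
rewrite /= patchE; case: ifPn => //; rewrite notin_setE/= in_itv/= -ler_norml.
by move=> /negP; rewrite -ltNge => /fB ->.
Qed.

Lemma Rintegral_derive_test F f (B : R) : (forall x : R, is_derive x 1 F (f x)) ->
  continuous f -> vanishes_outside F B -> \int[mu]_x f x = 0.
Proof.
move=> dF cf FB.
have fE : f = derive1 F by apply/funext => x; rewrite (is_derive_derive1 (dF x)).
have fB : vanishes_outside f B by rewrite fE; exact: vanishes_derive.
pose c := `|B| + 1; have c0 : 0 < c by rewrite ltr_pwDr.
have Bc : B < c by rewrite (le_lt_trans (ler_norm B))// ltrDl.
rewrite (Rintegral_vanishes (vanishes_le (ltW Bc) fB)).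
rewrite (Rintegral_FTC dF cf); last by rewrite ge0_cp// ltW.
by rewrite !FB ?subrr ?normrN// gtr0_norm.
Qed.

End test_functions.

(** * Green's functions *)

Section green_calculus.
Context (R : realType).
Implicit Types (u v f g eta psi chi : R -> R) (alpha a b c : R).
Local Notation mu := (@lebesgue_measure R).

(** With [a = - alpha], the value [c = 1] gives [D - alpha] and [c = -1] its formal adjoint. *)
Definition dop c a u : R -> R := fun x => c * derive1 u x + a * u x.

Lemma dop_smooth c a u : smooth u -> smooth (dop c a u).
Proof. by move=> su; exact: (@smoothD _ _ _ (@smoothZ _ c _ (@smooth_derive _ _ su)) (@smoothZ _ a _ su)). Qed.

Lemma iter_dop_smooth c a n u : smooth u -> smooth (iter n (dop c a) u).
Proof. by move=> su; elim: n => [|n IH]; [exact: su|exact: (@dop_smooth c a _ IH)]. Qed.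

Lemma dop_test c a u : test_fun u -> test_fun (dop c a u).
Proof. by move=> tu; exact: test_add (test_scale c (test_derive tu)) (test_scale a tu). Qed.

Lemma iter_dop_test c a n u : test_fun u -> test_fun (iter n (dop c a) u).
Proof. by move=> tu; elim: n => // n IH; rewrite iterS; exact: (dop_test c a IH). Qed.

Lemma dopD c a (r : R) u v : smooth u -> smooth v ->
  dop c a (fun x => r * u x + v x) = fun x => r * dop c a u x + dop c a v x.
Proof.
move=> su sv; apply/funext => x; rewrite /dop.
rewrite derive1D_fun; [|by move=> y; apply: smooth_derivable; exact: smoothZ|by move=> y; exact: smooth_derivable].
have dr : is_derive x 1 (fun x => r * u x) (r * derive1 u x).
  exact: (is_deriveZ r (smooth_is_derive x su)).
by rewrite (is_derive_derive1 dr); ring.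
Qed.

Lemma iter_dopD c a n (r : R) u v : smooth u -> smooth v ->
  iter n (dop c a) (fun x => r * u x + v x) =
  fun x => r * iter n (dop c a) u x + iter n (dop c a) v x.
Proof.
move=> su sv; elim: n => // n; rewrite !iterS => ->.
exact: (@dopD c a r _ _ (@iter_dop_smooth c a n _ su) (@iter_dop_smooth c a n _ sv)).
Qed.

Lemma iter_dop_derive c a n u : smooth u ->
  iter n (dop c a) (derive1 u) = derive1 (iter n (dop c a) u).
Proof.
move=> su; elim: n => // n; rewrite !iterS => ->; set w := iter n _ u.
have sw : smooth w := @iter_dop_smooth c a n _ su.
have sdw := smooth_derive sw.
apply/funext => x; apply/esym/is_derive_derive1.
apply: (@is_deriveD _ _ _ (fun y => c * derive1 w y) (fun y => a * w y)).
  exact: (is_deriveZ c (smooth_is_derive x sdw)).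
exact: (is_deriveZ a (smooth_is_derive x sw)).
Qed.

Lemma continuous_mul f g : continuous f -> continuous g -> continuous (fun x => f x * g x).
Proof. by move=> cf cg x; apply: cvgM; [exact: cf|exact: cg]. Qed.

Lemma continuous_add f g : continuous f -> continuous g -> continuous (fun x => f x + g x).
Proof. by move=> cf cg x; apply: cvgD; [exact: cf|exact: cg]. Qed.

Lemma integrable_mul_test v psi : continuous v -> test_fun psi ->
  mu.-integrable setT (EFin \o (fun x => v x * psi x)).
Proof.
move=> cv tp; have [_ [B pB]] := (test_funP psi).1 tp.
apply: (@integrable_vanishes _ _ B); last by move=> x /pB ->; rewrite mulr0.
by apply: continuous_mul => //; exact: test_continuous.
Qed.

Lemma regular_lin v (r : R) psi chi : continuous v -> test_fun psi -> test_fun chi ->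
  regular v (fun x => r * psi x + chi x) = r * regular v psi + regular v chi.
Proof.
move=> cv tp tc; rewrite /regular -RintegralZl//; last exact: integrable_mul_test.
rewrite -RintegralD//; last 2 first.
- have := integrable_mul_test cv (test_scale r tp); apply: eq_integrable => // x _.
  by rewrite /= mulrCA.
- exact: integrable_mul_test.
by apply: eq_Rintegral => x _; ring.
Qed.

Lemma regular_scale v (r : R) psi : continuous v -> test_fun psi ->
  regular v (fun x => r * psi x) = r * regular v psi.
Proof.
move=> cv tp; rewrite /regular -RintegralZl//; last exact: integrable_mul_test.
by apply: eq_Rintegral => x _; rewrite mulrCA.
Qed.

(** Transpose of [dop c a]. Thus [opL] tests against iterates of [dop (-1) (- alpha)], and [opLadj]
    against iterates of [dop 1 (- alpha)]. *)
Definition fop c a (U : functional R) : functional R :=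
  fun psi => c * U (derive1 psi) + a * U psi.

Lemma opLE alpha N (T : functional R) : opL alpha N T = iter N (fop (-1) (- alpha)) T.
Proof.
elim: N => //= N IH; rewrite -/(opL alpha N T) IH.
by apply/funext => psi; rewrite /dderiv /fop mulN1r mulNr.
Qed.

Lemma opLadjE alpha N (T : functional R) : opLadj alpha N T = iter N (fop 1 (- alpha)) T.
Proof.
elim: N => //= N IH; rewrite -/(opLadj alpha N T) IH.
by apply/funext => psi; rewrite /dderiv /fop opprK mul1r mulNr.
Qed.

Lemma fop_regular c a N v psi : continuous v -> test_fun psi ->
  iter N (fop c a) (regular v) psi = regular v (iter N (dop c a) psi).
Proof.
move=> cv; elim: N psi => //= N IH psi tp; rewrite /fop !IH//; last exact: test_derive.
have tN : test_fun (iter N (dop c a) psi) by exact: iter_dop_test.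
rewrite iter_dop_derive; last exact: test_smooth.
rewrite -(regular_scale a cv tN) -regular_lin//; first exact: test_derive.
exact: test_scale.
Qed.

(** The Green's function before truncation to nonnegative times. The index is shifted:
    [gexp alpha k] belongs to [green alpha k.+1]. *)
Definition gexp alpha (k : nat) (t : R) : R := t ^+ k * expR (alpha * t) / k`!%:R.

Lemma greenE alpha k t : green alpha k.+1 t = if 0 <= t then gexp alpha k t else 0.
Proof. by []. Qed.

Lemma gexp0 alpha k : gexp alpha k 0 = (k == 0%N)%:R.
Proof. by rewrite /gexp mulr0 expR0; case: k => [|k]; rewrite ?expr0 ?mul1r ?fact0 ?invr1// expr0n/= !mul0r. Qed.

(** The image of [gexp alpha k] under [D - alpha]. *)
Definition gexp_pred alpha k : R -> R := if k is k'.+1 then gexp alpha k' else fun=> 0.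

Lemma is_derive_exprn (k : nat) (t : R) :
  is_derive t 1 (fun y : R => y ^+ k.+1) (k.+1%:R * t ^+ k).
Proof.
elim: k => [|k IH].
  rewrite (_ : (fun y => _) = id); last by apply/funext => y; rewrite expr1.
  by rewrite expr0 mulr1; exact: is_derive_id.
rewrite (_ : (fun y => _) = fun y => y ^+ k.+1 * y); last by apply/funext => y; rewrite exprSr.
have := is_deriveM IH (is_derive_id t 1); move/is_derive_eq; apply.
by rewrite /GRing.scale/= exprS -[in RHS]natr1; ring.
Qed.

Lemma is_derive_gexp alpha k (t : R) : is_derive t 1 (gexp alpha k)
  (alpha * gexp alpha k t + gexp_pred alpha k t).
Proof.
have de := is_derive_expZ alpha t.
case: k => [|k].
  rewrite (_ : gexp alpha 0 = fun y => expR (alpha * y)); last first.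
    by apply/funext => y; rewrite /gexp expr0 mul1r fact0 divr1.
  by rewrite addr0.
have dX := is_derive_exprn k t.
rewrite (_ : gexp alpha k.+1 = fun y => (k.+1`!%:R)^-1 * (y ^+ k.+1 * expR (alpha * y))); last first.
  by apply/funext => y; rewrite /gexp mulrC.
have := is_deriveZ (k.+1`!%:R)^-1 (is_deriveM dX de).
move/is_derive_eq; apply; rewrite /GRing.scale/= /gexp_pred /gexp factS natrM.
have k0 : k`!%:R != 0 :> R by rewrite pnatr_eq0 -lt0n fact_gt0.
by field; rewrite k0/= addrC natr1 pnatr_eq0.
Qed.

Lemma gexp_continuous alpha k : continuous (gexp alpha k).
Proof. exact: (is_derive_continuous (is_derive_gexp alpha k)). Qed.

Lemma gexp_pred_continuous alpha k : continuous (gexp_pred alpha k).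
Proof. by case: k => [|k]; [exact: cst_continuous|exact: gexp_continuous]. Qed.

Lemma is_derive_sub_comp f (d y x : R) : is_derive (y - x) 1 f d ->
  is_derive x 1 (fun z => f (y - z)) (- d).
Proof.
move=> df; have [fd fE] := df.
have := @is_derive_affine _ f (-1) y x; rewrite mulN1r [- x + y]addrC => /(_ fd).
rewrite (is_derive_derive1 df) mulN1r.
by rewrite (_ : (fun z => f (-1 * z + y)) = fun z => f (y - z))//; apply/funext => z; rewrite mulN1r addrC.
Qed.

Lemma continuous_sub_comp f (y : R) : continuous f -> continuous (fun z => f (y - z)).
Proof.
move=> cf x; apply: (@continuous_comp _ _ _ (fun z => y - z) f); last exact: cf.
by apply: cvgB; [exact: cvg_cst|exact: cvg_id].
Qed.

Lemma continuous_subr_comp f (y : R) : continuous f -> continuous (fun z => f (z - y)).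
Proof.
move=> cf x; apply: (@continuous_comp _ _ _ (fun z => z - y) f); last exact: cf.
by apply: cvgB; [exact: cvg_id|exact: cvg_cst].
Qed.

Lemma derive1_left0 eta a x : (forall z, z < a -> eta z = 0) -> x < a -> derive1 eta x = 0.
Proof.
move=> e0 xa; apply: derive1_local0.
have : nbhs x [set y | y < a] by apply: open_nbhs_nbhs; split=> //; exact: open_lt.
by apply: filterS => y /e0.
Qed.

Lemma derive1_right0 eta b x : (forall z, b < z -> eta z = 0) -> b < x -> derive1 eta x = 0.
Proof.
move=> e0 xa; apply: derive1_local0.
have : nbhs x [set y | b < y] by apply: open_nbhs_nbhs; split=> //; exact: open_gt.
by apply: filterS => y /e0.
Qed.

(** One integration by parts lowers the order of the Green's function by one. At the lowest order
    only the boundary term at [x = y] remains, as [gexp alpha 0] is 1 at the origin. *)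
Lemma green_left alpha k eta a y : smooth eta -> (forall x, x < a -> eta x = 0) ->
  \int[mu]_x (green alpha k.+1 (y - x) * dop 1 (- alpha) eta x) =
  if k is k'.+1 then \int[mu]_x (green alpha k (y - x) * eta x) else eta y.
Proof.
(* A point strictly to the left of [y] and of the support of [eta], so that all integrals run over
   [[a', y]]. *)
move=> se ea; pose a' := Num.min a y - 1.
have a'a : a' < a by rewrite /a' ltrBlDr (le_lt_trans (_ : _ <= a))// ?ge_min ?lexx// ltrDl.
have a'y : a' < y by rewrite /a' ltrBlDr (le_lt_trans (_ : _ <= y))// ?ge_min ?lexx ?orbT// ltrDl.
have restr n h : (forall x, x < a -> h x = 0) ->
    \int[mu]_x (green alpha n.+1 (y - x) * h x) =
    \int[mu]_(x in `[a', y]) (gexp alpha n (y - x) * h x).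
  move=> ha; rewrite (@Rintegral_zero_outside _ _ `[a', y]).
    by apply: eq_Rintegral => x; rewrite inE/= in_itv/= => /andP[_ xy]; rewrite greenE subr_ge0 xy.
  move=> x /=; rewrite in_itv/= => /negP; rewrite negb_and -!ltNge => /orP[xa|yx].
    by rewrite ha ?mulr0// (lt_trans xa).
  by rewrite greenE subr_ge0 leNgt yx mul0r.
have ce := smooth_continuous se; have cde := smooth_continuous (smooth_derive se).
have cg n : continuous (fun x => gexp alpha n (y - x)).
  by apply: continuous_sub_comp; exact: gexp_continuous.
have cD : continuous (dop 1 (- alpha) eta) by exact/smooth_continuous/dop_smooth.
pose rest x := gexp_pred alpha k (y - x) * eta x.
have crest : continuous rest.
  by apply: continuous_mul => //; apply: continuous_sub_comp; exact: gexp_pred_continuous.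
rewrite restr; last by move=> x xa; rewrite /dop (derive1_left0 ea xa) ea// !mulr0 addr0.
have dF (x : R) : is_derive x 1 (fun z => gexp alpha k (y - z) * eta z)
    (gexp alpha k (y - x) * dop 1 (- alpha) eta x - rest x).
  have := is_deriveM (is_derive_sub_comp (is_derive_gexp alpha k (y - x))) (smooth_is_derive x se).
  by move/is_derive_eq; apply; rewrite /GRing.scale/= /dop /rest; ring.
have cM : continuous (fun x => gexp alpha k (y - x) * dop 1 (- alpha) eta x) by exact: continuous_mul.
have cF : continuous (fun x => gexp alpha k (y - x) * dop 1 (- alpha) eta x - rest x).
  by apply: continuous_add => // x; apply: cvgN; exact: crest.
have := Rintegral_FTC dF cF (ltW a'y).
rewrite RintegralB//; [|exact: continuous_integrable_itv|exact: continuous_integrable_itv].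
rewrite (ea a')// mulr0 subr0 subrr gexp0.
have -> : \int[mu]_(x in `[a', y]) rest x =
    if k is k'.+1 then \int[mu]_x (green alpha k (y - x) * eta x) else 0.
  rewrite /rest; case: k {dF cM cF rest crest} => [|k']; last by rewrite restr.
  rewrite (_ : (fun x => _) = fun=> 0) ?Rintegral_cst ?mul0r//.
  by apply/funext => x; rewrite mul0r.
by case: k {dF cM cF rest crest} => [|k'] /=; rewrite ?mul1r ?mul0r; lra.
Qed.

(** Mirror image of [green_left]: the integration is in the other variable of the Green's function,
    which calls for the adjoint operator and for [eta] vanishing on the right. *)
Lemma green_right alpha k eta b y : smooth eta -> (forall x, b < x -> eta x = 0) ->
  \int[mu]_x (green alpha k.+1 (x - y) * dop (-1) (- alpha) eta x) =
  if k is k'.+1 then \int[mu]_x (green alpha k (x - y) * eta x) else eta y.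
Proof.
move=> se ea; pose b' := Num.max b y + 1.
have bb' : b < b' by rewrite /b' (le_lt_trans (_ : b <= Num.max b y))// ?le_max ?lexx// ltrDl.
have yb' : y < b' by rewrite /b' (le_lt_trans (_ : y <= Num.max b y))// ?le_max ?lexx ?orbT// ltrDl.
have restr n h : (forall x, b < x -> h x = 0) ->
    \int[mu]_x (green alpha n.+1 (x - y) * h x) =
    \int[mu]_(x in `[y, b']) (gexp alpha n (x - y) * h x).
  move=> ha; rewrite (@Rintegral_zero_outside _ _ `[y, b']).
    by apply: eq_Rintegral => x; rewrite inE/= in_itv/= => /andP[xy _]; rewrite greenE subr_ge0 xy.
  move=> x /=; rewrite in_itv/= => /negP; rewrite negb_and -!ltNge => /orP[yx|xa].
    by rewrite greenE subr_ge0 leNgt yx mul0r.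
  by rewrite ha ?mulr0// (lt_trans bb').
have ce := smooth_continuous se; have cde := smooth_continuous (smooth_derive se).
have cg n : continuous (fun x => gexp alpha n (x - y)).
  by apply: continuous_subr_comp; exact: gexp_continuous.
have cD : continuous (dop (-1) (- alpha) eta) by exact/smooth_continuous/dop_smooth.
pose rest x := gexp_pred alpha k (x - y) * eta x.
have crest : continuous rest.
  by apply: continuous_mul => //; apply: continuous_subr_comp; exact: gexp_pred_continuous.
rewrite restr; last by move=> x xa; rewrite /dop (derive1_right0 ea xa) ea// !mulr0 addr0.
have dF (x : R) : is_derive x 1 (fun z => gexp alpha k (z - y) * eta z)
    (rest x - gexp alpha k (x - y) * dop (-1) (- alpha) eta x).
  have [gd _] := is_derive_gexp alpha k (1 * x - y).
  have := is_deriveM (is_derive_affine gd) (smooth_is_derive x se).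
  rewrite (is_derive_derive1 (is_derive_gexp alpha k (1 * x - y))).
  rewrite (_ : (fun z => gexp alpha k (1 * z - y)) = fun z => gexp alpha k (z - y)); last first.
    by apply/funext => z; rewrite mul1r.
  by rewrite !mul1r; move/is_derive_eq; apply; rewrite /GRing.scale/= /dop /rest; ring.
have cM : continuous (fun x => gexp alpha k (x - y) * dop (-1) (- alpha) eta x) by exact: continuous_mul.
have cF : continuous (fun x => rest x - gexp alpha k (x - y) * dop (-1) (- alpha) eta x).
  by apply: continuous_add => // x; apply: cvgN; exact: cM.
have := Rintegral_FTC dF cF (ltW yb').
rewrite RintegralB//; [|exact: continuous_integrable_itv|exact: continuous_integrable_itv].
rewrite (ea b')// mulr0 sub0r subrr gexp0.
have -> : \int[mu]_(x in `[y, b']) rest x =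
    if k is k'.+1 then \int[mu]_x (green alpha k (x - y) * eta x) else 0.
  rewrite /rest; case: k {dF cM cF rest crest} => [|k']; last by rewrite restr.
  rewrite (_ : (fun x => _) = fun=> 0) ?Rintegral_cst ?mul0r//.
  by apply/funext => x; rewrite mul0r.
by case: k {dF cM cF rest crest} => [|k'] /=; rewrite ?mul1r ?mul0r; lra.
Qed.

Lemma iter_dop_left0 c b n eta a : (forall x, x < a -> eta x = 0) ->
  forall x, x < a -> iter n (dop c b) eta x = 0.
Proof.
move=> ea; elim: n => //= n IH x xa.
by rewrite /dop (derive1_left0 IH xa) IH// !mulr0 addr0.
Qed.

Lemma iter_dop_right0 c b n eta a : (forall x, a < x -> eta x = 0) ->
  forall x, a < x -> iter n (dop c b) eta x = 0.
Proof.
move=> ea; elim: n => //= n IH x xa.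
by rewrite /dop (derive1_right0 IH xa) IH// !mulr0 addr0.
Qed.

Lemma green_left_iter alpha k eta a y : smooth eta -> (forall x, x < a -> eta x = 0) ->
  \int[mu]_x (green alpha k.+1 (y - x) * iter k.+1 (dop 1 (- alpha)) eta x) = eta y.
Proof.
move=> se ea; elim: k => [|k IH] /=.
  exact: (green_left alpha 0 y se ea).
have := green_left alpha k.+1 y (@iter_dop_smooth 1 (- alpha) k.+1 _ se)
  (@iter_dop_left0 1 (- alpha) k.+1 _ _ ea).
by move=> ->.
Qed.

Lemma green_right_iter alpha k eta b y : smooth eta -> (forall x, b < x -> eta x = 0) ->
  \int[mu]_x (green alpha k.+1 (x - y) * iter k.+1 (dop (-1) (- alpha)) eta x) = eta y.
Proof.
move=> se ea; elim: k => [|k IH] /=.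
  exact: (green_right alpha 0 y se ea).
have := green_right alpha k.+1 y (@iter_dop_smooth (-1) (- alpha) k.+1 _ se)
  (@iter_dop_right0 (-1) (- alpha) k.+1 _ _ ea).
by move=> ->.
Qed.

End green_calculus.

(** * Iterated causal and anticausal primitives *)

Section chains.
Context (R : realType).
Implicit Types (u v f g eta psi chi : R -> R) (alpha a b c : R).
Local Notation mu := (@lebesgue_measure R).

(** Variation of constants: [F] is a primitive of [expR (- beta * x) * f x], normalised to vanish at
    [p]. *)
Lemma ode_solve beta f p : continuous f -> exists u,
  [/\ forall x : R, is_derive x 1 u (beta * u x + f x), u p = 0 & smooth f -> smooth u].
Proof.
move=> cf; pose e x := expR (- beta * x).
have ce : continuous e by exact: (is_derive_continuous (is_derive_expZ (- beta))).
have [F dF] := primitive_exists (continuous_mul ce cf).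
have dE (x : R) := is_derive_expZ beta x.
pose u x := expR (beta * x) * (F x - F p).
have du (x : R) : is_derive x 1 u (beta * u x + f x).
  have dF' : is_derive x 1 (fun y => F y - F p) (e x * f x).
    by have := is_deriveB (dF x) (is_derive_cst (F p) x 1); rewrite subr0.
  have := is_deriveM (dE x) dF'; move/is_derive_eq; apply.
  have ee : expR (beta * x) * e x = 1.
    by rewrite /e -expRD mulNr subrr expR0.
  rewrite -[X in _ = _ + X]mul1r -ee /GRing.scale/= /u; ring.
exists u; split; [exact: du|by rewrite /u subrr mulr0|].
move=> /smoothP sf; apply/smoothP => n; elim: n => [//|n IH]; split.
  by move=> x; have [] := du x.
rewrite (_ : derive1 u = fun x => beta * u x + f x).
  by apply: CkD (sf n); apply: CkM IH; exact: Ck_cst.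
by apply/funext => x; exact: is_derive_derive1.
Qed.

(** Left of [a] the product of [u] with the integrating factor has zero derivative, and it vanishes
    at [a]. *)
Lemma ode_left beta f a : continuous f -> (forall x, x < a -> f x = 0) -> exists u,
  [/\ forall x : R, is_derive x 1 u (beta * u x + f x),
      forall x, x < a -> u x = 0 & smooth f -> smooth u].
Proof.
move=> cf fa; have [u [du ua su]] := ode_solve beta a cf.
exists u; split=> // x xa.
pose e x := expR (- beta * x).
have dv (y : R) : is_derive y 1 (fun y => e y * u y) (e y * f y).
  have := is_deriveM (is_derive_expZ (- beta) y) (du y); move/is_derive_eq; apply.
  by rewrite /GRing.scale/= /e; ring.
have ce : continuous e by exact: (is_derive_continuous (is_derive_expZ (- beta))).
have := Rintegral_FTC dv (continuous_mul ce cf) (ltW xa).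
rewrite ua mulr0 sub0r -(@Rintegral_itv_bndo_bndc _ (BLeft x)); last first.
  apply: integrableS (continuous_integrable_itv x a (continuous_mul ce cf)) => //.
  by apply: subset_itvl; rewrite bnd_simp.
rewrite (@eq_Rintegral _ _ _ _ _ (fun=> 0)); last first.
  by move=> y; rewrite inE/= in_itv/= => /andP[_ ya]; rewrite fa ?mulr0.
rewrite Rintegral_cst// mul0r => /eqP; rewrite eq_sym oppr_eq0 mulf_eq0 /e.
by rewrite (gt_eqF (expR_gt0 _)) => /eqP.
Qed.

Lemma ode_right beta f b : continuous f -> (forall x, b < x -> f x = 0) -> exists u,
  [/\ forall x : R, is_derive x 1 u (beta * u x + f x),
      forall x, b < x -> u x = 0 & smooth f -> smooth u].
Proof.
move=> cf fb; have [u [du ub su]] := ode_solve beta b cf.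
exists u; split=> // x bx.
pose e x := expR (- beta * x).
have dv (y : R) : is_derive y 1 (fun y => e y * u y) (e y * f y).
  have := is_deriveM (is_derive_expZ (- beta) y) (du y); move/is_derive_eq; apply.
  by rewrite /GRing.scale/= /e; ring.
have ce : continuous e by exact: (is_derive_continuous (is_derive_expZ (- beta))).
have := Rintegral_FTC dv (continuous_mul ce cf) (ltW bx).
rewrite ub mulr0 subr0 -(@Rintegral_itv_obnd_cbnd _ b); last first.
  apply: integrableS (continuous_integrable_itv b x (continuous_mul ce cf)) => //.
  by apply: subset_itvr; rewrite bnd_simp.
rewrite (@eq_Rintegral _ _ _ _ _ (fun=> 0)); last first.
  by move=> y; rewrite inE/= in_itv/= => /andP[yb _]; rewrite fb ?mulr0.
rewrite Rintegral_cst// mul0r => /eqP; rewrite eq_sym mulf_eq0 /e.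
by rewrite (gt_eqF (expR_gt0 _)) => /eqP.
Qed.

(** [U k] is the solution of [(D - alpha)^k (U k) = psi] that vanishes on the left. For positive [k]
    it is the convolution of [psi] with the Green's function of order [k], by [left_chain_green]. *)
Record left_chain alpha a psi (U : nat -> R -> R) : Prop := LeftChain {
  lchain0 : U 0%N = psi;
  lchainS : forall k (x : R), is_derive x 1 (U k.+1) (alpha * U k.+1 x + U k x);
  lchain_left : forall k x, x < a -> U k x = 0;
  lchain_smooth : forall k, smooth (U k) }.

Lemma left_chain_exists alpha a psi : smooth psi -> (forall x, x < a -> psi x = 0) ->
  exists U, left_chain alpha a psi U.
Proof.
move=> sp pa.
(* The conditions on [f] stand inside the conclusion so that the choice function is total and can be
   iterated. *)
have : forall f, exists u, (smooth f /\ (forall x, x < a -> f x = 0)) ->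
  [/\ forall x : R, is_derive x 1 u (alpha * u x + f x),
      forall x, x < a -> u x = 0 & smooth u].
  move=> f; have [[sf fa]|nf] := pselect (smooth f /\ (forall x, x < a -> f x = 0)).
    have [u [du ua su]] := ode_left alpha (smooth_continuous sf) fa.
    by exists u => _; split; [exact: du|exact: ua|exact: su].
  by exists f.
move=> /choice[S SP]; pose U k := iter k S psi.
have PU k : smooth (U k) /\ forall x, x < a -> U k x = 0.
  by elim: k => [|k IH]; [split|have [] := SP _ IH].
exists U; split=> [//|k x|k|k]; last 2 first.
- exact: (PU k).2.
- exact: (PU k).1.
by have [] := SP _ (PU k).
Qed.

(** Here [(- D - alpha) (W k.+1) = W k], with solutions vanishing on the right. The starting
    function is only continuous, since it will be a function of [space_CL] type times a cutoff. *)
Record right_chain alpha b (c0 : R -> R) (W : nat -> R -> R) : Prop := RightChain {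
  rchain0 : W 0%N = c0;
  rchainS : forall k (x : R), is_derive x 1 (W k.+1) (- alpha * W k.+1 x - W k x);
  rchain_right : forall k x, b < x -> W k x = 0;
  rchain_continuous : forall k, continuous (W k) }.

Lemma right_chain_exists alpha b (c0 : R -> R) : continuous c0 -> (forall x, b < x -> c0 x = 0) ->
  exists W, right_chain alpha b c0 W.
Proof.
move=> cc cb.
have : forall f, exists u, (continuous f /\ (forall x, b < x -> f x = 0)) ->
  [/\ forall x : R, is_derive x 1 u (- alpha * u x - f x),
      forall x, b < x -> u x = 0 & continuous u].
  move=> f; have [[cf fb]|nf] := pselect (continuous f /\ (forall x, b < x -> f x = 0)).
    have cNf : continuous (fun x => - f x) by move=> x; apply: cvgN; exact: cf.
    have fNb x : b < x -> - f x = 0 by move=> /fb ->; rewrite oppr0.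
    have [u [du ub _]] := ode_right (- alpha) cNf fNb.
    by exists u => _; split=> //; exact: (is_derive_continuous du).
  by exists f.
move=> /choice[S SP]; pose W k := iter k S c0.
have PW k : continuous (W k) /\ forall x, b < x -> W k x = 0.
  by elim: k => [|k IH]; [split|have [] := SP _ IH].
exists W; split=> [//|k x|k|k]; last 2 first.
- exact: (PW k).2.
- exact: (PW k).1.
by have [] := SP _ (PW k).
Qed.

Lemma vanishes_between f a b : (forall x, x < a -> f x = 0) -> (forall x, b < x -> f x = 0) ->
  vanishes_outside f (`|a| + `|b|).
Proof.
move=> fa fb x; have := ler_norm b; have := ler_norm (- a); rewrite normrN.
have := normr_ge0 a; have := normr_ge0 b.
move=> b0 a0 h1 h2; case: (leP 0 x) => x0 xab; [apply: fb|apply: fa]; move: xab.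
  by rewrite (@ger0_norm _ x)//; lra.
by rewrite (@ltr0_norm _ x)//; lra.
Qed.

(** Each integration by parts moves one index from [U] to [W]. Boundary terms are absent because [U]
    vanishes on the left and [W] on the right. *)
Lemma chain_pairing alpha a b (c0 : R -> R) psi W U : left_chain alpha a psi U ->
  right_chain alpha b c0 W -> forall k,
  \int[mu]_x (c0 x * U k x) = \int[mu]_x (W k x * psi x).
Proof.
move=> [U0 US Ua sU] [W0 WS Wb cW].
have cU k : continuous (U k) by exact: smooth_continuous.
suff H k j : \int[mu]_x (W j x * U k x) = \int[mu]_x (W (j + k)%N x * U 0%N x).
  by move=> k; rewrite -W0 H U0.
elim: k j => [|k IH] j; first by rewrite addn0.
rewrite addnS -addSn -IH; apply/eqP; rewrite -subr_eq0 -oppr_eq0 opprB; apply/eqP.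
have van (f g : R -> R) : (forall x, x < a -> g x = 0) -> (forall x, b < x -> f x = 0) ->
    vanishes_outside (fun x => f x * g x) (`|a| + `|b|).
  by move=> ga fb; apply: vanishes_between => x h; [rewrite ga ?mulr0|rewrite fb ?mul0r].
have int i l : mu.-integrable setT (EFin \o (fun x => W i x * U l x)).
  apply: (integrable_vanishes (continuous_mul (cW i) (cU l))).
  by apply: van; [exact: Ua|exact: Wb].
rewrite -RintegralB//.
have dF (x : R) : is_derive x 1 (fun x => W j.+1 x * U k.+1 x)
    (W j.+1 x * U k x - W j x * U k.+1 x).
  have := is_deriveM (WS j x) (US k x); move/is_derive_eq; apply.
  by rewrite /GRing.scale/=; ring.
apply: (Rintegral_derive_test dF).
  apply: continuous_add; first exact: continuous_mul.
  by move=> x; apply: cvgN; exact: (continuous_mul (cW j) (cU k.+1)).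
by apply: van; [exact: Ua|exact: Wb].
Qed.

Lemma left_chain_dop alpha a psi U k : left_chain alpha a psi U ->
  dop 1 (- alpha) (U k.+1) = U k.
Proof.
by move=> [_ US _ _]; apply/funext => x; rewrite /dop (is_derive_derive1 (US k x)); lra.
Qed.

Lemma left_chain_green alpha a psi U k y : left_chain alpha a psi U ->
  \int[mu]_x (green alpha k.+1 (y - x) * psi x) = U k.+1 y.
Proof.
move=> LC; have [U0 US Ua sU] := LC.
rewrite -(green_left_iter alpha k y (sU k.+1) (Ua k.+1)).
congr Rintegral; apply/funext => x; congr (_ * _).
suff -> : iter k.+1 (dop 1 (- alpha)) (U k.+1) = U 0%N by rewrite U0.
by elim: k.+1 => [//|n IH]; rewrite iterSr (left_chain_dop _ LC) IH.
Qed.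

(** The factor 1 gives the right-hand side the shape [r * u + v] expected by [iter_dopD]. *)
Lemma dop_leibniz alpha a psi U k chi : left_chain alpha a psi U -> smooth chi ->
  dop 1 (- alpha) (fun x => chi x * U k.+1 x) =
  fun x => 1 * (derive1 chi x * U k.+1 x) + chi x * U k x.
Proof.
move=> LC sc; rewrite -(left_chain_dop k LC); have sU := @lchain_smooth _ _ _ _ LC k.+1.
apply/funext => x; rewrite /dop derive1M_fun; first ring.
  by move=> y; exact: smooth_derivable.
by move=> y; exact: smooth_derivable.
Qed.

(* Makes [green_conv] well defined: integrations by parts move the adjoint operator
   from the definition of [space_CL] onto the causal primitives [U k] of [psi]. *)
Lemma dop_product_representable alpha n k v chi : continuous v -> test_fun chi -> (n <= k)%N ->
  exists w : R -> R, continuous w /\ forall a psi U, test_fun psi ->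
    left_chain alpha a psi U ->
    \int[mu]_x (v x * iter n (dop 1 (- alpha)) (fun x => chi x * U k x) x) =
    \int[mu]_x (w x * psi x).
Proof.
move=> cv; elim: n k chi => [|n IH] k chi tc nk.
  have [_ [B cB]] := (test_funP chi).1 tc.
  have cvc : continuous (fun x => v x * chi x) by apply: continuous_mul => //; exact: test_continuous.
  have [|W RC] := right_chain_exists alpha (b := `|B|) cvc.
    by move=> x Bx; rewrite cB ?mulr0// (le_lt_trans (ler_norm B))// (lt_le_trans Bx)// ler_norm.
  (* The [k]-th anticausal primitive of [v * chi] depends on neither [psi] nor [U], as required of
     [w]. *)
  exists (W k); split; first exact: (rchain_continuous RC).
  move=> a psi U _ LC; rewrite -(chain_pairing LC RC k) /=.
  by apply: eq_Rintegral => x _; rewrite mulrA.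
case: k nk => // k nk.
(* By Leibniz one operator either differentiates the cutoff or lowers the index of [U]. The bound
   [n <= k] leaves enough indices for the remaining operators. *)
have [w1 [cw1 H1]] := IH k.+1 _ (test_derive tc) (leqW nk).
have [w2 [cw2 H2]] := IH k _ tc nk.
exists (fun x => w1 x + w2 x); split; first exact: continuous_add.
move=> a psi U tp LC; rewrite iterSr (dop_leibniz k LC (test_smooth tc)).
have sU j : smooth (U j) by case: LC.
have t1 : test_fun (fun x => derive1 chi x * U k.+1 x).
  by apply: test_mul_smooth (test_derive tc); exact: sU.
have t2 : test_fun (fun x => chi x * U k x) by apply: test_mul_smooth tc; exact: sU.
rewrite (iter_dopD _ _ _ _ (@test_smooth _ _ t1) (@test_smooth _ _ t2)).
under eq_Rintegral => x _ do rewrite mul1r mulrDr.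
rewrite RintegralD//; last 2 first.
- by apply: integrable_mul_test => //; exact: (iter_dop_test _ _ n t1).
- by apply: integrable_mul_test => //; exact: (iter_dop_test _ _ n t2).
rewrite (H1 _ _ _ tp LC) (H2 _ _ _ tp LC) -RintegralD//; last 2 first.
- exact: integrable_mul_test.
- exact: integrable_mul_test.
by apply: eq_Rintegral => x _; ring.
Qed.

End chains.

(** * Approximation by test functions *)

Section bumps.
Context (R : realType).
Implicit Types (u v f g psi : R -> R) (a b c d e x : R).
Local Notation mu := (@lebesgue_measure R).

Lemma continuous_close g x0 e : continuous g -> 0 < e ->
  exists2 d, 0 < d & forall y, `|y - x0| <= d -> `|g y - g x0| < e.
Proof.
move=> cg e0.
have : \forall y \near x0, `|g x0 - g y| < e by exact (@cvgr_dist_lt _ _ _ _ _ g (g x0) (cg x0) e e0).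
move=> /nbhs_ballP [d /= d0 H]; exists (d / 2); first by rewrite divr_gt0.
move=> y yd; rewrite distrC; apply: H; rewrite /ball/= distrC (le_lt_trans yd)//.
by rewrite ltr_pdivrMr// mulr_natr mulr2n ltrDl.
Qed.

Lemma Rintegral_gt0 g B x0 : continuous g -> (forall x, 0 <= g x) ->
  vanishes_outside g B -> 0 < g x0 -> 0 < \int[mu]_x g x.
Proof.
move=> cg g0 gB gx0.
have [e e0 He] := @continuous_close g x0 _ cg (divr_gt0 gx0 (ltr0Sn R 1)).
have ge x : `|x - x0| <= e -> g x0 / 2 <= g x.
  by move=> /He; rewrite ltr_norml => /andP[+ _]; lra.
have ig := integrable_vanishes cg gB.
apply: (@lt_le_trans _ _ (\int[mu]_(x in `[x0 - e, x0 + e]) (g x0 / 2))).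
  rewrite Rintegral_cst //=.
  have mI : fine (mu `[x0 - e, x0 + e]) = e + e.
    rewrite lebesgue_measure_itv/= lte_fin; case: ifPn => [_|]; last by rewrite -leNgt; lra.
    by rewrite -EFinD/=; lra.
  by rewrite mI mulr_gt0 ?addr_gt0// divr_gt0.
rewrite Rintegral_mkcond; apply: le_Rintegral => //.
- rewrite -restrict_EFin; apply/integrable_restrict => //=; rewrite setTI.
  by apply: continuous_integrable_itv; exact: cst_continuous.
- move=> x _; rewrite patchE; case: ifPn => // /[!inE]/=; rewrite in_itv/= => xe.
  by apply: ge; rewrite ler_norml; lra.
Qed.

(* The cutoff of an admissible system, translated and squared, is such a bump. *)
Hypothesis bump : exists b : R -> R, [/\ test_fun b, forall x, 0 <= b x & 0 < b 0].

Lemma localized_bump x0 e : 0 < e -> exists psi : R -> R,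
  [/\ test_fun psi, forall x, 0 <= psi x, 0 < psi x0 & forall x, e <= `|x - x0| -> psi x = 0].
Proof.
move=> e0; have [b [tb b0 b00]] := bump; have [_ [B bB]] := (test_funP b).1 tb.
(* A dilation that shrinks the support of [b], of radius less than [|B| + 1], to radius less than
   [e]. *)
pose k := (`|B| + 1) / e; have k0 : 0 < k by rewrite divr_gt0// ltr_pwDr.
exists (fun x => b (k * x + - (k * x0))); split.
- by apply: test_affine => //; rewrite gt_eqF.
- by move=> x; exact: b0.
- by rewrite subrr.
- move=> x xe; apply: bB; rewrite -mulrBr normrM gtr0_norm//.
  apply: (@lt_le_trans _ _ (`|B| + 1)); first by rewrite (le_lt_trans (ler_norm B))// ltrDl.
  have -> : `|B| + 1 = k * e by rewrite divfK ?gt_eqF.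
  by rewrite ler_pM2l.
Qed.

Lemma fundamental_lemma f (O : set R) : continuous f -> open O ->
  (forall psi, test_fun psi -> (forall x, ~ O x -> psi x = 0) ->
     \int[mu]_x (f x * psi x) = 0) ->
  forall x, O x -> f x = 0.
Proof.
move=> cf oO H x0 Ox0.
suff key g : continuous g -> (forall psi, test_fun psi -> (forall x, ~ O x -> psi x = 0) ->
     \int[mu]_x (g x * psi x) = 0) -> ~ 0 < g x0.
  case: (ltgtP (f x0) 0) => // fx0; exfalso; last exact: key cf H fx0.
  apply: (key (fun x => - 1 * f x)); last by rewrite mulN1r oppr_gt0.
    by apply: continuous_mul => //; exact: cst_continuous.
  move=> psi tp pO; rewrite -[RHS](mulr0 (-1)) -(H psi tp pO) -RintegralZl//.
    by apply: eq_Rintegral => x _; rewrite mulrA.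
  exact: integrable_mul_test.
move=> cg Hg gx0.
have [d d0 Hd] := continuous_close x0 cg gx0.
have /nbhs_ballP[d' /= d'0 Hd'] : nbhs x0 O by exact: open_nbhs_nbhs.
pose e := Num.min d d'; have e0 : 0 < e by rewrite lt_min d0.
have [psi [tp p0 px0 pe]] := localized_bump x0 e0.
have [_ [B pB]] := (test_funP psi).1 tp.
have near y : psi y != 0 -> O y /\ 0 < g y.
  move=> py; have : `|y - x0| < e.
    by rewrite ltNge; apply/negP => /pe E; rewrite E eqxx in py.
  rewrite lt_min => /andP[yd yd']; split.
    by apply: Hd'; rewrite /ball/= distrC.
  by have := Hd y (ltW yd); rewrite ltr_norml => /andP[+ _]; lra.
have : 0 < \int[mu]_x (g x * psi x).
  apply: (@Rintegral_gt0 _ B x0).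
  - by apply: continuous_mul => //; exact: test_continuous.
  - move=> y; have [->|/near[_ gy]] := eqVneq (psi y) 0; first by rewrite mulr0.
    by rewrite mulr_ge0// ltW.
  - by move=> y /pB ->; rewrite mulr0.
  - by rewrite mulr_gt0.
rewrite Hg ?ltxx// => x nO; apply/eqP/negPn/negP => /near[].
by move=> /nO.
Qed.

(** A primitive of the bump function, normalised by its total increase. *)
Lemma smooth_step : exists (S : R -> R) (B : R), [/\ 0 < B, smooth S,
  forall x, 0 <= S x <= 1, forall x, x <= - B -> S x = 0 & forall x, B <= x -> S x = 1].
Proof.
have [b [tb b0 b00]] := bump; have [sb [B' bB']] := (test_funP b).1 tb.
pose B := `|B'| + 1; have B0 : 0 < B by rewrite ltr_pwDr.
have B'B : B' < B by rewrite (le_lt_trans (ler_norm B'))// ltrDl.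
have bB := vanishes_le (ltW B'B) bB'.
have cb : continuous b := smooth_continuous sb.
have [P dP] := primitive_exists cb.
have FTC := Rintegral_FTC dP cb.
have Pmono x y : x <= y -> P x <= P y.
  by move=> xy; rewrite -subr_ge0 -FTC//; apply: Rintegral_ge0.
have Pl x : x <= - B -> P x = P (- B).
  move=> xB; apply/eqP; rewrite eq_sym -subr_eq0 -FTC//.
  rewrite (@eq_Rintegral _ _ _ _ _ (fun=> 0)) ?Rintegral_cst ?mul0r//.
  move=> y; rewrite inE/= in_itv/= => /andP[_ yB]; apply: bB'.
  by rewrite ler0_norm; lra.
have Pr x : B <= x -> P x = P B.
  move=> xB; apply/eqP; rewrite -subr_eq0 -FTC//.
  rewrite (@eq_Rintegral _ _ _ _ _ (fun=> 0)) ?Rintegral_cst ?mul0r//.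
  move=> y; rewrite inE/= in_itv/= => /andP[yB _]; apply: bB'.
  by rewrite ger0_norm; lra.
pose D := P B - P (- B).
have D0 : 0 < D.
  rewrite /D -FTC; last by rewrite ge0_cp// ltW.
  by rewrite -(Rintegral_vanishes bB); exact: Rintegral_gt0 cb b0 bB b00.
have PB x : P (- B) <= P x <= P B.
  apply/andP; split.
    by have [/Pl ->//|/ltW/Pmono] := leP x (- B).
  by have [/Pr ->//|/ltW/Pmono] := leP B x.
exists (fun x => D^-1 * (P x + - P (- B))), B; split=> //.
- have sP : smooth P := @smooth_primitive _ _ _ dP sb.
  exact: (@smoothZ _ D^-1 _ (@smoothD _ _ _ sP (@smooth_cst _ (- P (- B))))).
- move=> x; have /andP[PB1 PB2] := PB x.
  apply/andP; split; first by apply: mulr_ge0; rewrite ?invr_ge0 ?(ltW D0)// subr_ge0.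
  rewrite mulrC ler_pdivrMr// mul1r lerD2r.
  exact: PB2.
- by move=> x /Pl ->; rewrite subrr mulr0.
- by move=> x /Pr ->; rewrite mulVf ?gt_eqF.
Qed.

Lemma indicator_approx c d : exists psi : nat -> R -> R,
  [/\ forall n, test_fun (psi n), forall n x, 0 <= psi n x <= 1 &
   forall x, psi n x @[n --> \oo] --> (\1_(`]c, d[%classic) x : R)].
Proof.
have [S [B [B0 sS S01 Sl Sr]]] := smooth_step.
(* The shift by [B] places the whole rise of the step inside the interval: the function is 0 up to
   [c] and equals 1 once [n * (x - c)] is at least [2 * B]. *)
pose p n x := S (n%:R * x + (- (n%:R * c) - B)).
pose q n x := S (- (n%:R) * x + (n%:R * d - B)).
have pl n x : x <= c -> p n x = 0.
  move=> xc; apply: Sl; have : n%:R * x <= n%:R * c by rewrite ler_wpM2l.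
  lra.
have ql n x : d <= x -> q n x = 0.
  move=> xd; apply: Sl; have : n%:R * d <= n%:R * x by rewrite ler_wpM2l.
  lra.
have large y : 0 < y -> exists N, forall n, (N <= n)%N -> 2 * B <= n%:R * y.
  move=> y0; exists (Num.truncn (2 * B / y)).+1 => n Nn.
  rewrite -ler_pdivrMr// ltW//.
  have : (Num.truncn (2 * B / y)).+1%:R <= n%:R :> R by rewrite ler_nat.
  by apply: lt_le_trans; rewrite truncnS_gt.
exists (fun n x => p n x * q n x); split.
- move=> n; apply/test_funP; split.
    exact: (@smoothM _ _ _ (@smooth_affine _ _ _ _ sS) (@smooth_affine _ _ _ _ sS)).
  exists (`|c| + `|d|); apply: vanishes_between => x xx.
    by rewrite pl ?mul0r// ltW.
  by rewrite ql ?mulr0// ltW.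
- move=> n x; have /andP[p0 p1] := S01 (n%:R * x + (- (n%:R * c) - B)).
  have /andP[q0 q1] := S01 (- n%:R * x + (n%:R * d - B)).
  by rewrite mulr_ge0//= mulr_ile1.
- move=> x; rewrite indicE mem_setE in_itv/=.
  have [xc|xc] := leP x c; rewrite /=.
    by apply: cvg_near_cst; apply: nearW => n; rewrite pl ?mul0r.
  have [xd|xd] := leP d x; rewrite /=.
    by apply: cvg_near_cst; apply: nearW => n; rewrite ql ?mulr0.
  have [N1 H1] := large (x - c) (etrans (subr_gt0 _ _) xc).
  have [N2 H2] := large (d - x) (etrans (subr_gt0 _ _) xd).
  apply: cvg_near_cst; exists (N1 + N2)%N => //= n Nn.
  have n1 : (N1 <= n)%N := leq_trans (leq_addr _ _) Nn.
  have n2 : (N2 <= n)%N := leq_trans (leq_addl _ _) Nn.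
  have -> : p n x = 1 by apply: Sr; have := H1 _ n1; rewrite mulrBr; lra.
  have -> : q n x = 1 by apply: Sr; have := H2 _ n2; rewrite mulrBr; lra.
  by rewrite mulr1.
Qed.

End bumps.

(** * Admissible systems and their kernels *)

Section admissible_systems.
Context (R : realType) (alpha : R) (k : nat).
Local Notation N := k.+1.
Local Notation mu := (@lebesgue_measure R).
Implicit Types (T : functional R) (psi chi : R -> R).

Definition test_linear T := forall (r : R) psi chi, test_fun psi -> test_fun chi ->
  T (fun x => r * psi x + chi x) = r * T psi + T chi.

Lemma CL_linear n T : space_CL alpha n T -> test_linear T.
Proof.
move=> [p [phi [v [a [[_ tphi _] [cv _] TE]]]]] r psi chi tp tc.
have trc : test_fun (fun x => r * psi x + chi x) by apply: test_add => //; exact: test_scale.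
rewrite !TE// !opLadjE !fop_regular//.
rewrite iter_dopD; [|exact: test_smooth|exact: test_smooth].
rewrite regular_lin//; [|exact: iter_dop_test|exact: iter_dop_test].
rewrite mulrDr -!addrA; congr (_ + _); rewrite addrCA; congr (_ + _).
rewrite mulr_sumr -big_split/=; apply: eq_bigr => i _.
by rewrite regular_lin//; [ring|exact: test_continuous].
Qed.

Lemma test_linear0 T : test_linear T -> T (fun=> 0) = 0.
Proof.
move=> lT; have := lT 1 (fun=> 0) (fun=> 0) (@test_0 R) (@test_0 R).
rewrite (_ : (fun x => _) = fun=> 0); last by apply/funext => x; rewrite mulr0 addr0.
by rewrite mul1r => /eqP; rewrite -subr_eq0 opprD addrA subrr sub0r oppr_eq0 => /eqP.
Qed.

Lemma test_linear_sum T (I : Type) (r : seq I) (a : I -> R) (u : I -> R -> R) :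
  test_linear T -> (forall i, test_fun (u i)) ->
  T (fun x => \sum_(i <- r) a i * u i x) = \sum_(i <- r) a i * T (u i).
Proof.
move=> lT tu; elim: r => [|i r IH].
  rewrite big_nil (_ : (fun x => _) = fun=> 0) ?test_linear0//.
  by apply/funext => x; rewrite big_nil.
rewrite big_cons -IH -lT//; last by apply: test_sum => j; exact: test_scale.
by congr T; apply/funext => x; rewrite big_cons.
Qed.

Lemma test_linear_supp T (A : set R) psi chi : test_linear T -> supported_in T A ->
  test_fun psi -> test_fun chi ->
  closure [set x | psi x != chi x] `&` A = set0 -> T psi = T chi.
Proof.
move=> lT sT tp tc E.
have tn : test_fun (fun x => (-1) * chi x + psi x) by apply: test_add => //; exact: test_scale.
have := sT _ tn; rewrite lT// mulN1r => H; apply/eqP; rewrite -subr_eq0 addrC H//.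
rewrite (_ : [set x | _] = [set x | psi x != chi x])//.
by apply/seteqP; split => x /=; rewrite mulN1r addrC subr_eq0.
Qed.

Variable S : admissible_system alpha N.
Local Notation lo := (sys_lo S).
Local Notation hi := (sys_hi S).
Local Notation chi := (cutoff lo hi).

Let Tlin m : test_linear (sys_phi S m).
Proof. exact: (CL_linear (sys_CL S m)). Qed.

(* Duality excludes the junk value [cutoff lo hi = 0] and an empty support interval. *)
Lemma cutoff_spec : [/\ test_fun chi, forall x, lo - 1 <= x <= hi + 1 -> chi x = 1 & lo <= hi].
Proof.
have dual := sys_dual S ord0 ord0.
have [[chi0 chi0P]|nochi] := pselect (exists chi0 : R -> R, test_fun chi0 /\
    forall x, lo - 1 <= x <= hi + 1 -> chi0 x = 1); last first.
  move: dual; rewrite /cpairing /cutoff xgetPN; last exact/forallNP.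
  rewrite (_ : (fun x => _) = fun=> 0) ?test_linear0//; last first.
    by apply/funext => x; rewrite mul0r.
  by move=> /eqP; rewrite eq_sym oner_eq0.
have [tc c1] : test_fun chi /\ forall x, lo - 1 <= x <= hi + 1 -> chi x = 1.
  by rewrite /cutoff; case: xgetP => [w _ //|/(_ chi0) nc]; case: nc.
split=> //; rewrite leNgt; apply/negP => hilo.
move: dual; rewrite /cpairing (@sys_supp _ _ _ S ord0).
- by move=> /eqP; rewrite eq_sym oner_eq0.
- apply: test_mul_smooth tc; have [sp _ _ _] := sys_basis S; exact: sp.
- by rewrite set_itv_ge ?setI0// bnd_simp -ltNge.
Qed.

Lemma system_bump : exists b : R -> R, [/\ test_fun b, forall x, 0 <= b x & 0 < b 0].
Proof.
have [tc c1 lohi] := cutoff_spec.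
have tc' : test_fun (fun x => chi (1 * x + lo)) by apply: test_affine => //; exact: oner_neq0.
exists (fun x => chi (1 * x + lo) * chi (1 * x + lo)); split.
- have [s' _] := tc'; exact: (@test_mul_smooth _ _ _ s' tc').
- by move=> x; rewrite -expr2 sqr_ge0.
- by rewrite mulr0 add0r c1 ?mulr1//; lra.
Qed.

Lemma test_left_chain psi : test_fun psi -> exists a U, left_chain alpha a psi U.
Proof.
move=> /test_funP[sp [B pB]]; exists (- `|B|).
apply: left_chain_exists => // x xB; apply: pB.
by have := ler_norm B; have := ler_norm (- x); rewrite normrN; lra.
Qed.

Definition sys_conv (m : 'I_N) : R -> R := green_conv alpha N lo hi (sys_phi S m).

(** The choice in [green_conv] is not the default value: a continuous representative exists. The
    convolution with [psi] is the causal primitive [U N], and every piece of an element of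
    [space_CL] is covered by [dop_product_representable]. *)
Lemma sys_conv_spec m : continuous (sys_conv m) /\
  forall psi a U, test_fun psi -> left_chain alpha a psi U ->
    regular (sys_conv m) psi = sys_phi S m (fun y => chi y * U N y).
Proof.
have [tc c1 lohi] := cutoff_spec.
suff [w [cw wE]] : exists w : R -> R, continuous w /\ forall psi a U, test_fun psi ->
    left_chain alpha a psi U -> regular w psi = sys_phi S m (fun y => chi y * U N y).
  have GU psi a U : test_fun psi -> left_chain alpha a psi U ->
      cpairing lo hi (sys_phi S m) (fun y => \int[mu]_x (green alpha N (y - x) * psi x)) =
      sys_phi S m (fun y => chi y * U N y).
    move=> tp LC; rewrite /cpairing; congr (sys_phi S m _); apply/funext => y.
    by rewrite (left_chain_green k y LC).
  have [cg gE] : continuous (sys_conv m) /\ forall psi, test_fun psi ->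
      regular (sys_conv m) psi = cpairing lo hi (sys_phi S m)
        (fun y => \int[mu]_x (green alpha N (y - x) * psi x)).
    rewrite /sys_conv /green_conv; case: xgetP => [w0 _ //|/(_ w) nw]; case: nw.
    split=> // psi tp.
    have [a [U LC]] := test_left_chain tp.
    by rewrite (GU _ _ _ tp LC) (wE _ _ _ tp LC).
  split=> // psi a U tp LC; by rewrite gE// (GU _ _ _ tp LC).
have [p [phi [v [a [[_ tphi _] [cv _] TE]]]]] := sys_CL S m.
(* The part of [sys_phi] that carries the adjoint operator uses all [N] integrations by parts; the
   test functions [phi i] below use none. *)
have [w0 [cw0 H0]] := dop_product_representable alpha cv tc (leqnn N).
have : forall i, exists w : R -> R, continuous w /\ forall a psi U, test_fun psi ->
    left_chain alpha a psi U ->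
    \int[mu]_x (phi i x * (chi x * U N x)) = \int[mu]_x (w x * psi x).
  move=> i; exact: (dop_product_representable alpha (test_continuous (tphi i)) tc (leq0n N)).
move=> /choice[w wP].
have cs : continuous (fun x => \sum_i a i * w i x).
  by apply: sum_continuous => i; apply: scale_continuous; have [] := wP i.
exists (fun x => w0 x + \sum_i a i * w i x); split; first exact: continuous_add.
move=> psi b U tp LC.
have tU : test_fun (fun y => chi y * U N y).
  by apply: test_mul_smooth tc; exact: (@lchain_smooth _ _ _ _ _ LC N).
rewrite TE// opLadjE fop_regular// /regular (H0 _ _ _ tp LC).
transitivity (\int[mu]_x (w0 x * psi x + (\sum_i a i * w i x) * psi x)); last first.
  rewrite RintegralD//; [|exact: integrable_mul_test|exact: integrable_mul_test].
  congr (_ + _).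
  under [RHS]eq_bigr => i _ do rewrite ((wP i).2 _ _ _ tp LC).
  have cw i : continuous (w i) by have [] := wP i.
  elim: (index_enum _) {cs} => [|i r IH].
    rewrite big_nil (@eq_Rintegral _ _ _ _ _ (fun=> 0)) ?Rintegral_cst ?mul0r//.
    by move=> x _; rewrite big_nil mul0r.
  rewrite big_cons -IH.
  transitivity (\int[mu]_x (a i * (w i x * psi x) + (\sum_(j <- r) a j * w j x) * psi x)); first by apply: eq_Rintegral => x _; rewrite big_cons mulrDl mulrA.
  have cs : continuous (fun x => \sum_(j <- r) a j * w j x).
    by apply: sum_continuous => j; apply: scale_continuous.
  rewrite RintegralD//; [|by have := integrable_mul_test (scale_continuous (a := a i) (cw i)) tp; apply: eq_integrable => // x _; rewrite /= mulrA|exact: integrable_mul_test].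
  by rewrite RintegralZl//; exact: integrable_mul_test.
by apply: eq_Rintegral => x _; rewrite mulrDl.
Qed.

End admissible_systems.

Lemma integrable_bounded_support (R : realType) (B C : R) (f : R -> R) :
  measurable_fun setT f -> vanishes_outside f B -> (forall x, `|f x| <= C) ->
  (@lebesgue_measure R).-integrable setT (EFin \o f).
Proof.
move=> mf fB fC.
have : (@lebesgue_measure R).-integrable `[- B, B] (EFin \o f).
  apply: measurable_bounded_integrable => //.
  - by rewrite /= lebesgue_measure_itv/=; case: ifPn => _; rewrite -?EFinD ltry.
  - exact: measurable_funTS.
  - exists C; split; first by rewrite num_real.
    by move=> M sM x _ /=; rewrite (le_trans (fC x))// ltW.
rewrite integrable_mkcond//; apply: eq_integrable => // x _.
rewrite /= patchE; case: ifPn => //; rewrite notin_setE/= in_itv/= -ler_norml.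
by move=> /negP; rewrite -ltNge => /fB ->.
Qed.

(** * Exponential polynomials in the null space *)

Section null_space_exponentials.
Context (R : realType) (alpha : R).
Local Notation mu := (@lebesgue_measure R).
Implicit Types (u v psi : R -> R) (j n : nat).

Lemma continuous_bounded_itv u (B : R) : continuous u ->
  exists C : R, forall x : R, `|x| <= B -> `|u x| <= C.
Proof.
move=> cu; have [B0|B0] := ltP B 0.
  by exists 0 => x xB; have := normr_ge0 x; lra.
have cn : {within `[- B, B], continuous (fun x => `|u x|)}.
  by apply: continuous_subspaceT => x; apply: continuous_comp; [exact: cu|exact: norm_continuous].
have [|c _ cM] := EVT_max _ cn; first by lra.
exists `|u c| => x xB; apply: cM; rewrite in_itv/=; move: xB; rewrite ler_norml => /andP[]; lra.
Qed.

Lemma regular_distribution u : continuous u -> is_distribution (regular u).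
Proof.
move=> cu; split; first by move=> a v w tv tw; exact: regular_lin.
move=> B; have [C uC] := continuous_bounded_itv B cu.
exists (`|C| * (`|B| + `|B|)), 0%N => psi s tp pB ps.
(* For negative [B] the test function is zero, and the sign of [s] has to be read off its bound. *)
have [B0|B0] := ltP B 0.
  have p0 : psi = fun=> 0.
    by apply/funext => x; apply: pB; rewrite (lt_le_trans B0).
  have : `|psi 0| <= s by exact: (ps 0%N 0).
  rewrite p0 normr0 => s0.
  rewrite /regular (@eq_Rintegral _ _ _ _ _ (fun=> 0)) ?Rintegral_cst ?mul0r ?normr0//.
    by rewrite !mulr_ge0// addr_ge0.
  by move=> x _; rewrite mulr0.
rewrite (ger0_norm B0).
rewrite /regular (@Rintegral_vanishes _ _ B); last by move=> x /pB ->; rewrite mulr0.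
have iup : mu.-integrable `[- B, B] (EFin \o (fun x => u x * psi x)).
  by apply: continuous_integrable_itv; apply: continuous_mul => //; exact: test_continuous.
apply: (le_trans (le_normr_Rintegral _ iup)) => //.
have -> : `|C| * (B + B) * s = \int[mu]_(x in `[- B, B]) (`|C| * s).
  rewrite Rintegral_cst//= lebesgue_measure_itv/= lte_fin; case: ifPn => BB.
    by rewrite -EFinD/=; lra.
  rewrite -leNgt in BB; have -> : B = 0 by lra.
  by rewrite /= addr0 !mulr0 mul0r.
apply: le_Rintegral => //.
- by apply: continuous_integrable_itv => x; apply: (@continuous_comp R R R (fun y => u y * psi y) (fun y => `|y|)); [exact: (continuous_mul cu (test_continuous tp))|exact: norm_continuous].
- by apply: continuous_integrable_itv; exact: cst_continuous.
- move=> x /=; rewrite in_itv/= => /andP[xl xr]; rewrite normrM.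
  apply: ler_pM => //; last exact: (ps 0%N x).
  by apply: (le_trans _ (ler_norm C)); apply: uC; rewrite ler_norml xl.
Qed.

(** Integrating by parts turns the adjoint on the test function into [D - alpha] on [gexp alpha j],
    which lowers [j] until nothing is left. *)
Lemma gexp_annihilated j n psi : (j < n)%N -> test_fun psi ->
  \int[mu]_x (gexp alpha j x * iter n (dop (-1) (- alpha)) psi x) = 0.
Proof.
elim: n j psi => // n IH j psi jn tp.
set phi := iter n (dop (-1) (- alpha)) psi.
have tphi : test_fun phi by exact: iter_dop_test.
have sphi := test_smooth tphi.
have cphi := test_continuous tphi.
have cdphi : continuous (derive1 phi) := test_continuous (test_derive tphi).
have [_ [B pB]] := (test_funP phi).1 tphi.
have d (x : R) : is_derive x 1 (fun x => gexp alpha j x * phi x)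
   (gexp alpha j x * derive1 phi x + phi x * (alpha * gexp alpha j x + gexp_pred alpha j x)).
  have d1 := is_derive_gexp alpha j x; have d2 := smooth_is_derive x sphi.
  exact: is_deriveM.
have cd : continuous (fun x => gexp alpha j x * derive1 phi x +
    phi x * (alpha * gexp alpha j x + gexp_pred alpha j x)).
  apply: continuous_add; first by apply: continuous_mul => //; exact: gexp_continuous.
  apply: continuous_mul => //; apply: continuous_add; last exact: gexp_pred_continuous.
  by apply: continuous_mul; [exact: cst_continuous|exact: gexp_continuous].
have E := Rintegral_derive_test d cd (_ : vanishes_outside _ B).
have {}E : \int[mu]_x (gexp alpha j x * derive1 phi x +
    phi x * (alpha * gexp alpha j x + gexp_pred alpha j x)) = 0.
  by apply: E => x /pB ->; rewrite mulr0.
have E2 : \int[mu]_x (gexp_pred alpha j x * phi x) = 0.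
  case: j jn {d cd E} => [_|j jn] /=.
    rewrite (@eq_Rintegral _ _ _ _ _ (fun=> 0)) ?Rintegral_cst ?mul0r// => x _.
    by rewrite mul0r.
  exact: IH.
transitivity (\int[mu]_x ((-1) * (gexp alpha j x * derive1 phi x +
    phi x * (alpha * gexp alpha j x + gexp_pred alpha j x)) + gexp_pred alpha j x * phi x)).
  by apply: eq_Rintegral => x _; rewrite iterS -/phi /dop; ring.
have ip : mu.-integrable setT (EFin \o (fun x => gexp_pred alpha j x * phi x)).
  exact: (integrable_mul_test (@gexp_pred_continuous R alpha j) tphi).
have id' : mu.-integrable setT (EFin \o (fun x => gexp alpha j x * derive1 phi x +
    phi x * (alpha * gexp alpha j x + gexp_pred alpha j x))).
  apply: (@integrable_vanishes _ _ B cd) => x xB.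
  by rewrite (vanishes_derive pB xB) pB// mulr0 mul0r addr0.
have id2 := integrableZl measurableT (-1) id'.
rewrite RintegralD//.
by rewrite RintegralZl// E E2 mulr0 addr0.
Qed.

Lemma gexp_null_space j n : (j < n)%N -> null_space alpha n (regular (gexp alpha j)).
Proof.
move=> jn; split; first by apply: regular_distribution; exact: gexp_continuous.
move=> psi tp; rewrite opLE fop_regular//; last exact: gexp_continuous.
exact: gexp_annihilated.
Qed.

(** The binomial theorem for divided powers; it separates the variables [t] and [x]. *)
Lemma gexp_sub j x t :
  gexp alpha j (t - x) = \sum_(i < j.+1) gexp alpha i t * gexp alpha (j - i) (- x).
Proof.
rewrite /gexp exprDn mulr_suml mulr_suml [LHS](reindex_inj rev_ord_inj)/=.
apply: eq_bigr => i _; rewrite subSS.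
have ij : (i <= j)%N by rewrite -ltnS.
rewrite subKn// bin_sub// mulrDr expRD -mulr_natr.
have f1 : (i`!)%:R != 0 :> R by rewrite pnatr_eq0 -lt0n fact_gt0.
have f2 : ((j - i)`!)%:R != 0 :> R by rewrite pnatr_eq0 -lt0n fact_gt0.
have f3 : (j`!)%:R != 0 :> R by rewrite pnatr_eq0 -lt0n fact_gt0.
have bf : 'C(j, i)%:R * (i`!)%:R * ((j - i)`!)%:R = (j`!)%:R :> R.
  by rewrite -!natrM -mulnA bin_fact.
rewrite -bf; field.
rewrite f1 f2 /=; apply: contraNneq f3 => c0; by rewrite -bf c0 !mul0r.
Qed.

End null_space_exponentials.

(** * Support, bounds and measurability of the kernel *)

Section kernels.
Context (R : realType) (alpha : R) (k : nat).
Local Notation N := k.+1.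
Local Notation mu := (@lebesgue_measure R).
Implicit Types (psi : R -> R).
Variable S : admissible_system alpha N.
Local Notation p := (sys_p S).
Local Notation lo := (sys_lo S).
Local Notation hi := (sys_hi S).
Local Notation chi := (cutoff lo hi).

Lemma sys_p_smooth n : smooth (p n).
Proof. by have [sp _ _ _] := sys_basis S; exact: sp. Qed.

Lemma sys_p_continuous n : continuous (p n).
Proof. exact: smooth_continuous (@sys_p_smooth n). Qed.

Lemma sys_p_annihilated n psi : test_fun psi ->
  \int[mu]_x (p n x * iter N (dop (-1) (- alpha)) psi x) = 0.
Proof.
move=> tp; have [_ np _ _] := sys_basis S; have [_ /(_ _ tp)] := np n.
by rewrite opLE fop_regular//; exact: sys_p_continuous.
Qed.

Lemma Rintegral_sum_test (I : Type) (r : seq I) (a : I -> R) (u : I -> R -> R) psi :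
  (forall i, continuous (u i)) -> test_fun psi ->
  \int[mu]_x ((\sum_(i <- r) a i * u i x) * psi x) =
  \sum_(i <- r) a i * \int[mu]_x (u i x * psi x).
Proof.
move=> cu tp; elim: r => [|i r IH].
  rewrite big_nil (@eq_Rintegral _ _ _ _ _ (fun=> 0)) ?Rintegral_cst ?mul0r//.
  by move=> x _; rewrite big_nil mul0r.
rewrite big_cons -IH.
transitivity (\int[mu]_x (a i * (u i x * psi x) + (\sum_(j <- r) a j * u j x) * psi x)).
  by apply: eq_Rintegral => x _; rewrite big_cons mulrDl mulrA.
have cs : continuous (fun x => \sum_(j <- r) a j * u j x).
  by apply: sum_continuous => j; apply: scale_continuous.
have iu : mu.-integrable setT (EFin \o (fun x => u i x * psi x)) by exact: integrable_mul_test.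
have iau : mu.-integrable setT (EFin \o (fun x => a i * (u i x * psi x))).
  exact: (integrableZl measurableT (a i) iu).
rewrite RintegralD//; last exact: integrable_mul_test.
by rewrite RintegralZl.
Qed.

Lemma continuous_eq u v (O : set R) : continuous u -> continuous v -> open O ->
  (forall psi, test_fun psi -> (forall x, ~ O x -> psi x = 0) -> regular u psi = regular v psi) ->
  forall x, O x -> u x = v x.
Proof.
move=> cu cv oO uv x Ox; apply/eqP; rewrite -subr_eq0; apply/eqP; move: x Ox.
have cN : continuous (fun x => - v x) by move=> y; apply: cvgN; exact: cv.
apply: (fundamental_lemma (system_bump S) (continuous_add cu cN) oO) => psi tp pO.
have := uv psi tp pO; rewrite /regular => E.
transitivity (\int[mu]_x (u x * psi x - v x * psi x)).
  by apply: eq_Rintegral => y _; rewrite mulrBl.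
by rewrite RintegralB// ?E ?subrr//; exact: integrable_mul_test.
Qed.

(** Every [gexp alpha j] with [j <= k] lies in the null space and expands in the basis [p]. Hence
    the Green's function, where it is not truncated, is a finite sum of products; this is what the
    correction terms of the kernel can cancel. *)
Lemma green_separated : exists q : 'I_N -> R -> R, (forall n, continuous (q n)) /\
  forall t x : R, gexp alpha k (t - x) = \sum_n p n t * q n x.
Proof.
have [_ _ _ span] := sys_basis S.
have /choice[A AP] (j : 'I_N) : exists a : 'I_N -> R,
    forall x, gexp alpha j x = \sum_n a n * p n x.
  have [a aP] := span _ (gexp_null_space alpha (ltn_ord j)).
  exists a => x; apply: (@continuous_eq (gexp alpha j) (fun x => \sum_n a n * p n x) setT) => //.
  - exact: gexp_continuous.
  - by apply: sum_continuous => n; apply: scale_continuous; exact: sys_p_continuous.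
  - exact: openT.
  - move=> psi tp _; rewrite aP// /regular Rintegral_sum_test// => n; exact: sys_p_continuous.
exists (fun n x => \sum_(i < N) A i n * gexp alpha (k - i) (- x)); split.
  move=> n; apply: sum_continuous => i; apply: scale_continuous => x.
  by apply: continuous_comp; [exact: opp_continuous|exact: gexp_continuous].
move=> t x; rewrite gexp_sub.
under eq_bigr => i _ do rewrite AP mulr_suml.
rewrite exchange_big/=; apply: eq_bigr => n _; rewrite mulr_sumr; apply: eq_bigr => i _.
by ring.
Qed.

(** For [psi] supported beyond [hi + 1], the causal primitive vanishes on a neighbourhood of the
    support of [sys_phi]. *)
Lemma sys_conv_right m (x : R) : hi + 1 < x -> sys_conv S m x = 0.
Proof.
have [cc cE] := sys_conv_spec S m; have [tchi chi1 lohi] := cutoff_spec S.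
move: x; apply: (@continuous_eq (sys_conv S m) (fun=> 0) [set x | hi + 1 < x]) => //.
- exact: cst_continuous.
move=> psi tp p0.
have pl x : x < hi + 1 -> psi x = 0 by move=> xh; apply: p0 => /=; lra.
have [U LC] := left_chain_exists alpha (test_smooth tp) pl.
rewrite (cE _ _ _ tp LC) /regular (@eq_Rintegral _ _ _ _ _ (fun=> 0)); last first.
  by move=> x _; rewrite mul0r.
rewrite Rintegral_cst// mul0r.
have tU : test_fun (fun y => chi y * U N y).
  exact: (@test_mul_smooth _ _ _ (@lchain_smooth _ _ _ _ _ LC N) tchi).
apply: (sys_supp m tU); rewrite -subset0 => x [clx /=]; rewrite in_itv/= => /andP[_ xhi].
have o : open [set y : R | y < hi + 1] by exact: open_lt.
have hx : x < hi + 1 by lra.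
have [y []] := clx [set y | y < hi + 1] (open_nbhs_nbhs (conj o hx)).
by move=> /= + yh; rewrite (lchain_left LC)// mulr0 eqxx.
Qed.

(** For [psi] supported before [lo - 1], the Green's function is not truncated near the support of
    [sys_phi]. There the causal primitive is a combination of the [p n], and duality selects its
    [m]-th coefficient. *)
Lemma sys_conv_left q m (x : R) : (forall n, continuous (q n)) ->
  (forall t x, gexp alpha k (t - x) = \sum_n p n t * q n x) ->
  x < lo - 1 -> sys_conv S m x = q m x.
Proof.
move=> cq qE; have [cc cE] := sys_conv_spec S m; have [tchi chi1 lohi] := cutoff_spec S.
have Tl := CL_linear (sys_CL S m).
move: x; apply: (@continuous_eq (sys_conv S m) (q m) [set x | x < lo - 1]) => //.
move=> psi tp p0.
have [a [U LC]] := test_left_chain alpha tp.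
rewrite (cE _ _ _ tp LC).
pose c n := \int[mu]_x (q n x * psi x).
have tU : test_fun (fun y => chi y * U N y).
  exact: (@test_mul_smooth _ _ _ (@lchain_smooth _ _ _ _ _ LC N) tchi).
have tcp n : test_fun (fun y => chi y * p n y).
  exact: (@test_mul_smooth _ _ _ (@sys_p_smooth n) tchi).
have tcs : test_fun (fun y => \sum_n c n * (chi y * p n y)).
  by apply: test_sum => n; exact: test_scale.
have UE y : lo - 1 < y -> U N y = \sum_n c n * p n y.
  move=> ly; rewrite -(left_chain_green k y LC).
  under [RHS]eq_bigr do rewrite mulrC.
  rewrite -(Rintegral_sum_test _ _ cq tp); apply: eq_Rintegral => x _.
  rewrite greenE subr_ge0 -qE; case: ifPn => // xy.
  by rewrite p0 ?mulr0//=; rewrite -ltNge in xy; lra.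
rewrite (test_linear_supp Tl (@sys_supp _ _ _ S m) tU tcs).
  rewrite test_linear_sum// (bigD1 m)//= big1 ?addr0; last first.
    move=> n nm; have := sys_dual S n m; rewrite /cpairing => ->.
    by rewrite (negbTE nm) mulr0.
  by have := sys_dual S m m; rewrite /cpairing => ->; rewrite eqxx mulr1.
rewrite -subset0 => x [clx /=]; rewrite in_itv/= => /andP[xlo _].
have o : open [set y : R | lo - 1 < y] by exact: open_gt.
have lx : lo - 1 < x by lra.
have [y []] := clx [set y | lo - 1 < y] (open_nbhs_nbhs (conj o lx)).
move=> /= + ly; rewrite UE// mulr_sumr => /eqP; apply.
by apply: eq_bigr => n _; ring.
Qed.

Lemma kernel_phiE (t x : R) :
  kernel_phi S t x = green alpha N (t - x) - \sum_n sys_conv S n x * p n t.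
Proof. by []. Qed.

(** Far to the right both terms of the kernel vanish; far to the left they cancel, by
    [sys_conv_left] and the separated form of the Green's function. *)
Lemma kernel_phi_support (B : R) : exists L : R, forall t x : R, `|t| <= B -> L < `|x| ->
  kernel_phi S t x = 0.
Proof.
have [q [cq qE]] := green_separated.
exists (`|B| + `|lo| + `|hi| + 1) => t x tB xL; rewrite kernel_phiE greenE subr_ge0.
have := ler_norm B; have := ler_norm t; have := ler_norm (- t); rewrite normrN.
have := ler_norm (- lo); have := ler_norm hi; rewrite normrN.
have := normr_ge0 lo; have := normr_ge0 hi.
move=> h1 h2 h3 h4 h5 h6 h7.
have [x0|x0] := leP 0 x.
  rewrite (ger0_norm x0) in xL; rewrite ifF; last by apply/negbTE; rewrite -ltNge; lra.
  by rewrite big1 ?subrr// => n _; rewrite sys_conv_right ?mul0r//; lra.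
rewrite (ltr0_norm x0) in xL; rewrite ifT; last by lra.
rewrite qE; apply/eqP; rewrite subr_eq0; apply/eqP; apply: eq_bigr => n _.
have xlo : x < lo - 1 by lra.
by rewrite (sys_conv_left n cq qE xlo) mulrC.
Qed.

Lemma kernel_phi_bounded (B : R) : exists C : R, forall t x : R, `|t| <= B ->
  `|kernel_phi S t x| <= C.
Proof.
have [L LP] := kernel_phi_support B.
have [C0 g0] := continuous_bounded_itv (`|B| + `|L|) (@gexp_continuous R alpha k).
have /choice[Cc cP] n := continuous_bounded_itv L (sys_conv_spec S n).1.
have /choice[Cp pP] n := continuous_bounded_itv B (@sys_p_continuous n).
exists (`|C0| + \sum_n `|Cc n| * `|Cp n|) => t x tB.
have s0 : 0 <= \sum_n `|Cc n| * `|Cp n| by apply: sumr_ge0 => n _; rewrite mulr_ge0.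
have [xL|xL] := ltP L `|x|; first by rewrite (LP t x tB xL) normr0 addr_ge0.
rewrite kernel_phiE; apply: (le_trans (ler_normB _ _)); apply: lerD.
  rewrite greenE; case: ifPn => _; last by rewrite normr0.
  apply: (le_trans (g0 (t - x) _)); last exact: ler_norm.
  by apply: (le_trans (ler_normB _ _)); rewrite lerD// (le_trans tB, le_trans xL)// ler_norm.
apply: (le_trans (ler_norm_sum _ _ _)); apply: ler_sum => n _; rewrite normrM.
apply: ler_pM => //; first exact: le_trans (cP n x xL) (ler_norm _).
exact: le_trans (pP n t tB) (ler_norm _).
Qed.

Lemma green_measurable n : measurable_fun setT (green alpha n : R -> R).
Proof.
(* Since [0.-1 = 0], the function [green alpha 0] coincides with [green alpha 1]. *)
case: n => [|n].
  rewrite (_ : green _ _ = fun t => if 0 <= t then gexp alpha 0 t else 0).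
    by apply: measurable_fun_ifT => //; [exact: measurable_fun_ler|exact: continuous_measurable_fun (@gexp_continuous R alpha 0)].
  by [].
rewrite (_ : green _ _ = fun t => if 0 <= t then gexp alpha n t else 0).
  by apply: measurable_fun_ifT => //; [exact: measurable_fun_ler|exact: continuous_measurable_fun (@gexp_continuous R alpha n)].
by apply/funext => t; rewrite greenE.
Qed.

Lemma kernel_phi_measurable : measurable_fun setT (fun z : R * R => kernel_phi S z.1 z.2).
Proof.
have cm (f : R -> R) : continuous f -> measurable_fun setT f by exact: continuous_measurable_fun.
apply: measurable_funB.
  apply: measurableT_comp; first exact: green_measurable.
  by apply: measurable_funB.
apply: measurable_sum => n; apply: measurable_funM.
  by apply: measurableT_comp => //; apply: cm; have [] := sys_conv_spec S n.
by apply: measurableT_comp => //; apply: cm; exact: sys_p_continuous.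
Qed.

Lemma kernel_phi_pairing psi (x : R) : test_fun psi ->
  \int[mu]_t (kernel_phi S t x * iter N (dop (-1) (- alpha)) psi t) = psi x.
Proof.
move=> tp.
set phi := iter N (dop (-1) (- alpha)) psi.
have tphi : test_fun phi by exact: iter_dop_test.
have [sp [B pB]] := (test_funP psi).1 tp.
have [sphi [B' phiB]] := (test_funP phi).1 tphi.
have [C0 g0] := continuous_bounded_itv (`|B'| + `|x|) (@gexp_continuous R alpha k).
have [Cf f0] := continuous_bounded_itv B' (test_continuous tphi).
have ig : mu.-integrable setT (EFin \o (fun t => green alpha N (t - x) * phi t)).
  apply: (@integrable_bounded_support _ B' (`|C0| * `|Cf|)).
  - apply: measurable_funM; last by apply: continuous_measurable_fun; exact: test_continuous.
    apply: measurableT_comp; first exact: green_measurable.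
    exact: measurable_funB.
  - by move=> t /phiB ->; rewrite mulr0.
  - move=> t; have [/phiB ->|tB] := ltP B' `|t|; first by rewrite mulr0 normr0 mulr_ge0.
    rewrite normrM; apply: ler_pM => //; last exact: le_trans (f0 t tB) (ler_norm _).
    rewrite greenE; case: ifPn => _; last by rewrite normr0.
    apply: (le_trans (g0 (t - x) _)); last exact: ler_norm.
    by apply: (le_trans (ler_normB _ _)); rewrite lerD// (le_trans tB)// ler_norm.
have cp n : continuous (p n) by exact: sys_p_continuous.
have cs : continuous (fun t => \sum_n sys_conv S n x * p n t).
  by apply: sum_continuous => n; apply: scale_continuous.
transitivity (\int[mu]_t (green alpha N (t - x) * phi t - (\sum_n sys_conv S n x * p n t) * phi t)).
  by apply: eq_Rintegral => t _; rewrite -mulrBl.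
rewrite RintegralB//; last exact: integrable_mul_test.
rewrite Rintegral_sum_test// big1 ?subr0; last first.
  by move=> n _; rewrite sys_p_annihilated ?mulr0.
apply: (@green_right_iter _ alpha k psi `|B|) => // t tB.
by apply: pB; rewrite (le_lt_trans (ler_norm B))// (lt_le_trans tB)// ler_norm.
Qed.

End kernels.

Lemma Rintegral_bounded_support (R : realType) (B C : R) (f : R -> R) :
  measurable_fun setT f -> vanishes_outside f B -> (forall x, `|f x| <= C) ->
  `|\int[@lebesgue_measure R]_t f t| <= C * (`|B| + `|B|).
Proof.
move=> mf fB fC.
have fB' : vanishes_outside f `|B|.
  by move=> t tB; apply: fB; rewrite (le_lt_trans (ler_norm B)).
have fi := integrable_bounded_support mf fB fC.
rewrite (Rintegral_vanishes fB').
have iI : (@lebesgue_measure R).-integrable `[- `|B|, `|B|] (EFin \o f).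
  exact: integrableS fi.
apply: (le_trans (le_normr_Rintegral _ iI)) => //.
have -> : C * (`|B| + `|B|) = \int[@lebesgue_measure R]_(t in `[- `|B|, `|B|]) C.
  rewrite Rintegral_cst//= lebesgue_measure_itv/= lte_fin; case: ifPn => BB.
    by rewrite -EFinD/=; lra.
  rewrite -leNgt in BB; have -> : `|B| = 0 by have := normr_ge0 B; lra.
  by rewrite /= addr0 !mulr0.
apply: le_Rintegral => //.
- exact: integrable_norm.
- by apply: continuous_integrable_itv; exact: cst_continuous.
Qed.

(** * Uniqueness of the coordinates *)

Section fubini_charge.
Context d (T : measurableType d) (R : realType).
Local Notation mu := (@lebesgue_measure R).
Implicit Types (nu : {finite_measure set T -> \bar R}) (m : {charge set T -> \bar R}).

Lemma EFin_Rintegral d' (T' : measurableType d') (nu : {measure set T' -> \bar R}) (f : T' -> R) :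
  nu.-integrable setT (EFin \o f) -> (\int[nu]_x f x)%:E = (\int[nu]_x (f x)%:E)%E.
Proof. by move=> fi; rewrite /Rintegral fineK//; exact: integrable_fin_num. Qed.

Variables (G : R * T -> R) (B C : R).
Hypothesis mG : measurable_fun setT G.
Hypothesis GC : forall z, `|G z| <= C.
Hypothesis GB : forall t x, B < `|t| -> G (t, x) = 0.

Let mG1 x : measurable_fun setT (fun t => G (t, x)).
Proof. by apply: measurableT_comp => //; exact: measurable_pair2. Qed.

Let mG2 t : measurable_fun setT (fun x => G (t, x)).
Proof. by apply: measurableT_comp => //; exact: measurable_pair1. Qed.

Let iG1 x : mu.-integrable setT (EFin \o (fun t => G (t, x))).
Proof.
apply: (@integrable_bounded_support _ B C) => //.
by move=> t; exact: GB.
Qed.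

Let iG2 nu t : nu.-integrable setT (EFin \o (fun x => G (t, x))).
Proof. by apply: (@finite_integrable _ _ _ _ _ C) => // x; exact: GC. Qed.

(** The integrand is bounded and supported in [[- B, B]] in its first variable, uniformly in the
    second, hence integrable for the product of Lebesgue measure with a finite measure. *)
Lemma fubini_finite nu :
  [/\ mu.-integrable setT (EFin \o (fun t => \int[nu]_x G (t, x))),
      measurable_fun setT (fun x => \int[mu]_t G (t, x)) &
      \int[mu]_t (\int[nu]_x G (t, x)) = \int[nu]_x (\int[mu]_t G (t, x))].
Proof.
have FE : (EFin \o (fun t => \int[nu]_x G (t, x))) = fubini_F nu (EFin \o G).
  by apply/funext => t; rewrite /= EFin_Rintegral//; exact: iG2.
have GE : (EFin \o (fun x => \int[mu]_t G (t, x))) = fubini_G mu (EFin \o G).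
  by apply/funext => x; rewrite /= EFin_Rintegral//; exact: iG1.
have C0 : 0 <= C by exact: le_trans (normr_ge0 (G point)) (GC point).
have mGE : measurable_fun setT (EFin \o G) by exact/measurable_EFinP.
have iG : (mu \x nu)%E.-integrable setT (EFin \o G).
  apply/(integrable21ltyP mu nu mGE).
  have bnd x : (\int[mu]_t `|(EFin \o G) (t, x)| <= (C * (`|B| + `|B|))%:E)%E.
    have mn : measurable_fun setT (fun t => `|G (t, x)|) by exact: measurableT_comp.
    have nB : vanishes_outside (fun t => `|G (t, x)|) B by move=> t /GB ->; rewrite normr0.
    have nC t : `| `|G (t, x)| | <= C by rewrite normr_id; exact: GC.
    have := Rintegral_bounded_support mn nB nC.
    rewrite -lee_fin; apply: le_trans.
    by rewrite -EFin_Rintegral ?lee_fin ?ler_norm//; exact: integrable_bounded_support mn nB nC.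
  apply: (@le_lt_trans _ _ (\int[nu]_x (C * (`|B| + `|B|))%:E)%E).
    apply: ge0_le_integral => //.
    - by move=> x _; exact: integral_ge0.
    - apply: (@measurable_fun_fubini_tonelli_G _ _ _ _ R mu (abse \o (EFin \o G))) => [|x]; last exact: abse_ge0.
      exact: (measurableT_comp _ mGE).
  by rewrite integral_cst// lte_mul_pinfty// ?lee_fin ?mulr_ge0 ?addr_ge0// finite_lty.
split.
- rewrite FE; exact: integrable_fubini_F.
- by have := measurable_fubini_G iG; rewrite -/(fubini_G mu _) -GE => /measurable_EFinP.
- rewrite /Rintegral; congr fine.
  transitivity (\int[mu]_t fubini_F nu (EFin \o G) t)%E; first by rewrite -FE.
  transitivity (\int[nu]_x fubini_G mu (EFin \o G) x)%E; last by rewrite -GE.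
  exact: Fubini.
Qed.

End fubini_charge.

Section pairing.
Context (R : realType) (u : R -> R) (tu : test_fun u).
Local Notation mu := (@lebesgue_measure R).

(** Integrability travels with the value, so that a sum of pairings needs no separate integrability
    argument. *)
Definition pairing (f : R -> R) (r : R) :=
  mu.-integrable setT (EFin \o (fun t => f t * u t)) /\ \int[mu]_t (f t * u t) = r.

Lemma pairing_add f g (r s : R) : pairing f r -> pairing g s ->
  pairing (fun t => f t + g t) (r + s).
Proof.
move=> [fi <-] [gi <-]; have E : (fun t => (f t + g t) * u t) = fun t => f t * u t + g t * u t.
  by apply/funext => t; rewrite mulrDl.
rewrite /pairing E; split; last by rewrite RintegralD.
exact: (integrableD measurableT fi gi).
Qed.

Lemma pairing_scale (a : R) f (r : R) : pairing f r -> pairing (fun t => a * f t) (a * r).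
Proof.
move=> [fi <-]; have E : (fun t => (a * f t) * u t) = fun t => a * (f t * u t).
  by apply/funext => t; rewrite mulrA.
rewrite /pairing E; split; last by rewrite RintegralZl.
exact: (integrableZl measurableT a fi).
Qed.

Lemma pairing_continuous f : continuous f -> pairing f (\int[mu]_t (f t * u t)).
Proof. by move=> cf; split=> //; exact: integrable_mul_test. Qed.

Lemma pairing_0 : pairing (fun=> 0) 0.
Proof.
have := pairing_continuous (@cst_continuous R R 0); rewrite (@eq_Rintegral _ _ _ _ _ (fun=> 0)) ?Rintegral_cst ?mul0r//.
by move=> t _; rewrite mul0r.
Qed.

Lemma pairing_sum (I : Type) (r : seq I) (f : I -> R -> R) (v : I -> R) :
  (forall i, pairing (f i) (v i)) ->
  pairing (fun t => \sum_(i <- r) f i t) (\sum_(i <- r) v i).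
Proof.
move=> H; elim: r => [|i r IH].
  rewrite big_nil (_ : (fun t => _) = fun=> 0); first exact: pairing_0.
  by apply/funext => t; rewrite big_nil.
rewrite big_cons (_ : (fun t => _) = fun t => f i t + \sum_(j <- r) f j t); last first.
  by apply/funext => t; rewrite big_cons.
exact: pairing_add.
Qed.

Lemma pairing_unique f (r s : R) : pairing f r -> pairing f s -> r = s.
Proof. by move=> [_ <-] [_ <-]. Qed.

(** Fubini for each Jordan part. The test function confines [t] to a bounded set, so local bounds on
    [K] suffice. *)
Lemma pairing_charge d (T : measurableType d) (m : {charge set T -> \bar R})
    (K : R -> T -> R) (k : T -> R) :
  measurable_fun setT (fun z : R * T => K z.1 z.2) ->
  (forall B, exists C : R, forall t x, `|t| <= B -> `|K t x| <= C) ->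
  (forall x, \int[mu]_t (K t x * u t) = k x) ->
  pairing (fun t => charge_int m (K t)) (charge_int m k) /\
  measurable_fun setT k /\ exists s : R, bounded_by s k.
Proof.
move=> mK bK kE.
have [su [B uB]] := (test_funP u).1 tu.
have [C KC] := bK B; have [Cu uC] := continuous_bounded_itv B (test_continuous tu).
pose G z := K z.1 z.2 * u z.1.
have mG : measurable_fun setT G.
  apply: measurable_funM => //; apply: measurableT_comp => //.
  by apply: continuous_measurable_fun; exact: test_continuous.
have GC z : `|G z| <= `|C| * `|Cu|.
  rewrite /G normrM; have [tB|tB] := leP `|z.1| B; last by rewrite (uB _ tB) normr0 mulr0 mulr_ge0.
  by apply: ler_pM => //; [exact: le_trans (KC _ _ tB) (ler_norm _)|exact: le_trans (uC _ tB) (ler_norm _)].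
have GB t x : B < `|t| -> G (t, x) = 0 by move=> /uB; rewrite /G /= => ->; rewrite mulr0.
have kE' : k = fun x => \int[mu]_t G (t, x) by apply/funext => x; rewrite -kE.
have [i1 mk E1] := fubini_finite mG GC GB (jpos m).
have [i2 _ E2] := fubini_finite mG GC GB (jneg m).
have mGx x : measurable_fun setT (fun t => G (t, x)).
  by apply: measurableT_comp => //; exact: measurable_pair2.
have mKt t : measurable_fun setT (K t).
  exact: (measurableT_comp mK (pair1_measurable t)).
have FE t : charge_int m (K t) * u t = \int[jpos m]_x G (t, x) - \int[jneg m]_x G (t, x).
  rewrite /G /=; have [tB|tB] := leP `|t| B; last first.
    have K0 : (fun x => K t x * u t) = fun=> 0 by apply/funext => x; rewrite (uB _ tB) mulr0.
    by rewrite K0 !Rintegral_cst// !mul0r subrr (uB _ tB) mulr0.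
  by rewrite !RintegralZr ?mulrBl//; apply: (@finite_integrable _ _ _ _ _ C) => // x; exact: KC.
split; last first.
  rewrite kE'; split=> //; exists (`|C| * `|Cu| * (`|B| + `|B|)) => x.
  by apply: Rintegral_bounded_support => // t; exact: GB.
rewrite /pairing (_ : (fun t => _) = fun t => \int[jpos m]_x G (t, x) - \int[jneg m]_x G (t, x)); last first.
  by apply/funext => t; rewrite FE.
split; first exact: (integrableB measurableT i1 i2).
by rewrite RintegralB// E1 E2 kE'.
Qed.

End pairing.

Section vanishing_charges.
Context d (T : measurableType d) (R : realType).
Implicit Types (m : {charge set T -> \bar R}) (A : set T).

Definition zero_charge m := forall A, measurable A -> fine (m A) = 0.

Lemma zero_charge_int m (h : T -> R) (s : R) : zero_charge m ->
  measurable_fun setT h -> bounded_by s h -> charge_int m h = 0.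
Proof.
move=> m0 mh hs; have : comb_charge m (-1) m m by move=> A mA; rewrite !m0// mulr0 addr0.
by move=> /comb_charge_int => /(_ h s mh hs); rewrite mulN1r addNr.
Qed.

Lemma zero_charge_generated m (G : set (set T)) (g : nat -> set T) :
  G `<=` measurable -> (forall n, G (g n)) -> \bigcup_n (g n) = setT -> setI_closed G ->
  (forall A, measurable A -> <<s G >> A) ->
  (forall A, G A -> fine (m A) = 0) -> zero_charge m.
Proof.
move=> Gm Gg gT GI Ggen G0 A mA.
have mfin nu B : measurable B -> (nu : {finite_measure set T -> \bar R}) B = (fine (nu B))%:E.
  by move=> mB; rewrite fineK// fin_num_measure.
have E : jpos m A = jneg m A.
  apply: (@g_sigma_algebra_measure_unique _ R T G Gm g Gg gT (jpos m) (jneg m) GI) => //.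
  - move=> B GB; apply: (etrans (mfin (jpos m) B (Gm _ GB))).
    apply: (etrans _ (esym (mfin (jneg m) B (Gm _ GB)))); congr EFin.
    by have := diff_of_jordan m (Gm _ GB); rewrite G0// => /esym/eqP; rewrite subr_eq0 => /eqP ->.
  - by move=> k; rewrite (le_lt_trans (le_measure _ _ _ (@subsetT _ _))) ?inE//; [exact: Gm|exact: finite_lty].
  - exact: Ggen.
by rewrite diff_of_jordan// E subrr.
Qed.

End vanishing_charges.

(** * Intervals and rectangles as generators of the Borel sets *)

Section rectangles.
Context (R : realType).

Definition intervals : set (set R) := [set A | exists a b, A = `]a, b[%classic].
Definition rectangles : set (set (R * R)) := [set A `*` B | A in intervals & B in intervals].

Lemma intervals_setI : setI_closed intervals.
Proof.
move=> _ _ [a [b ->]] [a' [b' ->]]; exists (Num.max a a'), (Num.min b b').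
apply/seteqP; split=> x /=; rewrite !in_itv/= gt_max lt_min.
  by move=> [/andP[-> ->] /andP[-> ->]].
by move=> /andP[/andP[-> ->] /andP[-> ->]].
Qed.

Lemma intervals_cover : \bigcup_n `](- n%:R)%R, (n%:R)%R[%classic = [set: R].
Proof.
apply/seteqP; split => // x _; exists (Num.truncn `|x|).+1 => //=.
by rewrite in_itv/= -ltr_norml truncnS_gt.
Qed.

Lemma intervals_measurable : intervals `<=` @measurable _ (measurableTypeR R).
Proof. by move=> _ [a [b ->]]; exact: measurable_itv. Qed.

Lemma intervals_generate (A : set (measurableTypeR R)) : measurable A -> <<s intervals >> A.
Proof. by rewrite RGenOpens.measurableE. Qed.

Lemma rectangles_setI : setI_closed rectangles.
Proof.
move=> _ _ [A iA [B iB <-]] [A' iA' [B' iB' <-]].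
by exists (A `&` A'); [exact: intervals_setI|exists (B `&` B'); [exact: intervals_setI|rewrite setXI]].
Qed.

Lemma rectangles_measurable :
  rectangles `<=` @measurable _ (measurableTypeR R * measurableTypeR R)%type.
Proof.
by move=> _ [A iA [B iB <-]]; apply: measurableX; exact: intervals_measurable.
Qed.

Lemma rectangles_cover :
  \bigcup_n (`](- n%:R)%R, (n%:R)%R[ `*` `](- n%:R)%R, (n%:R)%R[) = [set: R * R].
Proof.
apply/seteqP; split => // x _; exists (Num.truncn (Num.max `|x.1| `|x.2|)).+1 => //=.
have := truncnS_gt (Num.max `|x.1| `|x.2|); rewrite gt_max => /andP[h1 h2].
by rewrite !in_itv/= -!ltr_norml.
Qed.

(** The product sigma-algebra is generated by preimages under the two projections, and a strip over
    an open interval is a countable union of bounded rectangles. *)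
Lemma rectangles_generate (A : set (measurableTypeR R * measurableTypeR R)) :
  measurable A -> <<s rectangles >> A.
Proof.
rewrite measurable_prod_measurableType.
have [s0 sC sU] : sigma_algebra setT <<s rectangles >> by exact: smallest_sigma_algebra.
have sI (B B' : set (R * R)) : <<s rectangles >> B -> <<s rectangles >> B' -> <<s rectangles >> (B `&` B').
  exact: (@measurableI _ (g_sigma_algebraType rectangles)).
have preim (p : R * R -> R) : (forall a b, <<s rectangles >> (p @^-1` `]a, b[)) ->
    forall A0 : set (measurableTypeR R), measurable A0 -> <<s rectangles >> (p @^-1` A0).
  move=> pI A0 /intervals_generate.
  apply: (@smallest_sub _ _ _ [set A0 : set R | <<s rectangles >> (p @^-1` A0)]); last first.
    by move=> _ [a [b ->]]; exact: pI.
  split=> [|B /= sB|F /= sF]; rewrite /=.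
  - by rewrite preimage_set0.
  - by rewrite setTD preimage_setC -setTD; exact: sC.
  - by rewrite preimage_bigcup; exact: sU.
have fstI : forall a b : R, <<s rectangles >> (fst @^-1` `]a, b[).
  move=> a b; rewrite -setXT -intervals_cover setX_bigcupr; apply: sU => n.
  by apply: sub_sigma_algebra; exists `]a, b[%classic; [exists a, b|exists `](- n%:R)%R, (n%:R)%R[%classic => //; exists (- n%:R), (n%:R)].
have sndI : forall a b : R, <<s rectangles >> (snd @^-1` `]a, b[).
  move=> a b; rewrite -setTX -intervals_cover setX_bigcupl; apply: sU => n.
  by apply: sub_sigma_algebra; exists `](- n%:R)%R, (n%:R)%R[%classic; [exists (- n%:R), (n%:R)|exists `]a, b[%classic => //; exists a, b].
apply: smallest_sub => // _ [B mB [B' mB' <-]].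
rewrite (_ : B `*` B' = fst @^-1` B `&` snd @^-1` B')//.
by apply: sI; exact: preim.
Qed.

End rectangles.

Section uniqueness_by_test_functions.
Context (R : realType).
Hypothesis bump : exists b : R -> R, [/\ test_fun b, forall x, 0 <= b x & 0 < b 0].

Lemma zero_charge1 (m : meas1 R) :
  (forall psi, test_fun psi -> charge_int m psi = 0) -> zero_charge m.
Proof.
move=> H; apply: (@zero_charge_generated _ (measurableTypeR R) R m (@intervals R) _ (@intervals_measurable R) _
  (@intervals_cover R) (@intervals_setI R) (@intervals_generate R)).
  by move=> n; exists (- n%:R), (n%:R).
move=> _ [c [d ->]]; have [psi [tp p01 pcvg]] := indicator_approx bump c d.
rewrite -charge_int_indic//.
have mp n : measurable_fun setT (psi n).
  by apply: continuous_measurable_fun; exact: test_continuous.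
have pb n : bounded_by 1 (psi n) by move=> x; have /andP[? ?] := p01 n x; rewrite ger0_norm.
have := @charge_int_cvg _ _ R m psi _ 1 mp pb (measurable_indic _) pcvg.
move=> /(_ (measurable_itv _)) cv.
have : charge_int m (psi n) @[n --> \oo] --> (0 : R).
  by apply: cvg_near_cst; apply: nearW => n; rewrite H.
by move=> /(cvg_unique (@Rhausdorff R) cv).
Qed.

Lemma zero_charge2 (m : meas2 R) :
  (forall psi1 psi2, test_fun psi1 -> test_fun psi2 ->
     charge_int m (fun x => psi1 x.1 * psi2 x.2) = 0) -> zero_charge m.
Proof.
move=> H; apply: (@zero_charge_generated _ (measurableTypeR R * measurableTypeR R)%type R m (@rectangles R) _
  (@rectangles_measurable R) _ (@rectangles_cover R) (@rectangles_setI R) (@rectangles_generate R)).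
  by move=> n; eexists; [by exists (- n%:R), (n%:R)|eexists; [by exists (- n%:R), (n%:R)|]].
move=> _ [_ [c [d ->]] [_ [c' [d' ->]] <-]].
have [psi [tp p01 pcvg]] := indicator_approx bump c d.
have [psi' [tp' p01' pcvg']] := indicator_approx bump c' d'.
have mrect : measurable (`]c, d[%classic `*` `]c', d'[%classic : set (measurableTypeR R * measurableTypeR R)).
  by apply: measurableX; exact: measurable_itv.
rewrite -charge_int_indic//.
pose u n (x : R * R) := psi n x.1 * psi' n x.2.
have mp n : measurable_fun setT (psi n).
  by apply: continuous_measurable_fun; exact: test_continuous.
have mp' n : measurable_fun setT (psi' n).
  by apply: continuous_measurable_fun; exact: test_continuous.
have mu n : measurable_fun (setT : set (measurableTypeR R * measurableTypeR R)) (u n).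
  by apply: measurable_funM; apply: measurableT_comp.
have pb n : bounded_by 1 (u n).
  move=> x; have /andP[? ?] := p01 n x.1; have /andP[? ?] := p01' n x.2.
  by rewrite /u ger0_norm ?mulr_ge0// mulr_ile1.
have ucvg x : u n x @[n --> \oo] --> (\1_(`]c, d[%classic `*` `]c', d'[%classic) x : R).
  rewrite (_ : \1_ _ x = \1_(`]c, d[%classic) x.1 * \1_(`]c', d'[%classic) x.2 :> R).
    by apply: cvgM; [exact: pcvg|exact: pcvg'].
  by rewrite !indicE in_setX; case: (_ \in _); case: (_ \in _); rewrite /= ?mulr1 ?mulr0.
have cv := @charge_int_cvg _ _ R m u _ 1 mu pb (measurable_indic mrect) ucvg.
have : charge_int m (u n) @[n --> \oo] --> (0 : R).
  by apply: cvg_near_cst; apply: nearW => n; rewrite H.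
by move=> /(cvg_unique (@Rhausdorff R) cv).
Qed.

End uniqueness_by_test_functions.

Lemma sum_separate (R : realType) (alpha : R) (k : nat) (S : admissible_system alpha k.+1)
    (a : 'I_k.+1 -> R) : (forall t, \sum_n a n * sys_p S n t = 0) -> forall n, a n = 0.
Proof.
move=> a0; have [_ _ ind _] := sys_basis S; apply: ind => psi tp.
rewrite /regular -(Rintegral_sum_test _ _ (@sys_p_continuous _ _ _ S) tp).
by rewrite (@eq_Rintegral _ _ _ _ _ (fun=> 0)) ?Rintegral_cst ?mul0r// => x _; rewrite a0 mul0r.
Qed.

(** * Injectivity of the synthesis map *)

Section synthesis.
Context (R : realType) (alpha1 alpha2 : R) (k1 k2 : nat).
Variables (S1 : admissible_system alpha1 k1.+1) (S2 : admissible_system alpha2 k2.+1).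
Implicit Types (c : coords R k1.+1 k2.+1) (t : R).
Local Notation mu := (@lebesgue_measure R).
Local Notation K1 := (kernel_phi S1).
Local Notation K2 := (kernel_phi S2).
Local Notation p1 := (sys_p S1).
Local Notation p2 := (sys_p S2).

Lemma kernel_section (alpha : R) k (S : admissible_system alpha k.+1) t :
  measurable_fun setT (kernel_phi S t) /\ exists s, bounded_by s (kernel_phi S t).
Proof.
split; first exact: (measurableT_comp (kernel_phi_measurable S) (pair1_measurable t)).
by have [C KC] := kernel_phi_bounded S `|t|; exists C => x; exact: KC.
Qed.

Lemma kernel_phi_integrable (alpha : R) k (S : admissible_system alpha k.+1) (u : R -> R) (x : R) :
  test_fun u -> mu.-integrable setT (EFin \o (fun t => kernel_phi S t x * u t)).
Proof.
move=> tu; have [su [B uB]] := (test_funP u).1 tu.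
have [C KC] := kernel_phi_bounded S B; have [Cu uC] := continuous_bounded_itv B (test_continuous tu).
apply: (@integrable_bounded_support _ B (`|C| * `|Cu|)).
- apply: measurable_funM; last by apply: continuous_measurable_fun; exact: test_continuous.
  exact: (measurableT_comp (kernel_phi_measurable S) (pair2_measurable x)).
- by move=> t /uB ->; rewrite mulr0.
- move=> t; have [tB|/uB ->] := leP `|t| B; last by rewrite mulr0 normr0 mulr_ge0.
  rewrite normrM; apply: ler_pM => //; first exact: le_trans (KC _ _ tB) (ler_norm _).
  exact: le_trans (uC _ tB) (ler_norm _).
Qed.

Lemma kernel_product_section t1 t2 :
  measurable_fun setT (fun x : measurableTypeR R * measurableTypeR R => K1 t1 x.1 * K2 t2 x.2) /\
  exists s, bounded_by s (fun x : R * R => K1 t1 x.1 * K2 t2 x.2).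
Proof.
have [m1 [s1 b1]] := kernel_section S1 t1; have [m2 [s2 b2]] := kernel_section S2 t2.
split; first by apply: measurable_funM; apply: measurableT_comp.
exists (`|s1| * `|s2|) => x; rewrite normrM; apply: ler_pM => //.
  exact: le_trans (b1 _) (ler_norm _).
exact: le_trans (b2 _) (ler_norm _).
Qed.

Definition eq_coords c c' := [/\ eq_charge (co_m c) (co_m c'),
  forall n, eq_charge (co_m1 c n) (co_m1 c' n), forall n, eq_charge (co_m2 c n) (co_m2 c' n) &
  co_d c = co_d c'].

Definition comb_coords c (a : R) c1 c2 := [/\ comb_charge (co_m c) a (co_m c1) (co_m c2),
  forall n, comb_charge (co_m1 c n) a (co_m1 c1 n) (co_m1 c2 n),
  forall n, comb_charge (co_m2 c n) a (co_m2 c1 n) (co_m2 c2 n) &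
  co_d c = a *: co_d c1 + co_d c2].

Lemma comb_coords_exists a c1 c2 : exists c, comb_coords c a c1 c2.
Proof.
have [m mP] := comb_charge_exists a (co_m c1) (co_m c2).
have /choice[m1 m1P] n := comb_charge_exists a (co_m1 c1 n) (co_m1 c2 n).
have /choice[m2 m2P] n := comb_charge_exists a (co_m2 c1 n) (co_m2 c2 n).
by exists (Build_coords m m1 m2 (a *: co_d c1 + co_d c2)).
Qed.

Lemma synth_comb c a c1 c2 : comb_coords c a c1 c2 -> forall t1 t2,
  synth S1 S2 c t1 t2 = a * synth S1 S2 c1 t1 t2 + synth S1 S2 c2 t1 t2.
Proof.
move=> [cm cm1 cm2 cd] t1 t2; rewrite /synth.
have [mK [s Ks]] := kernel_product_section t1 t2.
have [mK1 [s1 Ks1]] := kernel_section S1 t1; have [mK2 [s2 Ks2]] := kernel_section S2 t2.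
rewrite (comb_charge_int cm mK Ks).
have -> : \sum_(n < k1.+1) p1 n t1 * charge_int (co_m1 c n) (K2 t2) =
   a * (\sum_(n < k1.+1) p1 n t1 * charge_int (co_m1 c1 n) (K2 t2)) +
   \sum_(n < k1.+1) p1 n t1 * charge_int (co_m1 c2 n) (K2 t2).
  rewrite mulr_sumr -big_split/=; apply: eq_bigr => n _.
  by rewrite (comb_charge_int (cm1 n) mK2 Ks2); ring.
have -> : \sum_(n < k2.+1) charge_int (co_m2 c n) (K1 t1) * p2 n t2 =
   a * (\sum_(n < k2.+1) charge_int (co_m2 c1 n) (K1 t1) * p2 n t2) +
   \sum_(n < k2.+1) charge_int (co_m2 c2 n) (K1 t1) * p2 n t2.
  rewrite mulr_sumr -big_split/=; apply: eq_bigr => n _.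
  by rewrite (comb_charge_int (cm2 n) mK1 Ks1); ring.
have -> : \sum_(n < k1.+1) \sum_(n' < k2.+1) co_d c n n' * p1 n t1 * p2 n' t2 =
   a * (\sum_(n < k1.+1) \sum_(n' < k2.+1) co_d c1 n n' * p1 n t1 * p2 n' t2) +
   \sum_(n < k1.+1) \sum_(n' < k2.+1) co_d c2 n n' * p1 n t1 * p2 n' t2.
  rewrite mulr_sumr -big_split/=; apply: eq_bigr => n _.
  rewrite mulr_sumr -big_split/=; apply: eq_bigr => n' _.
  by rewrite cd !mxE; ring.
by ring.
Qed.

Section vanishing_synthesis.
Variable c : coords R k1.+1 k2.+1.
Hypothesis c0 : forall t1 t2, synth S1 S2 c t1 t2 = 0.

Let pairing_p1 (psi : R -> R) (tp : test_fun psi) n :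
  pairing (iter k1.+1 (dop (-1) (- alpha1)) psi) (p1 n) 0.
Proof.
rewrite -(sys_p_annihilated S1 n tp); apply: pairing_continuous; first exact: iter_dop_test.
exact: sys_p_continuous.
Qed.

Let pairing_p2 (psi : R -> R) (tp : test_fun psi) n :
  pairing (iter k2.+1 (dop (-1) (- alpha2)) psi) (p2 n) 0.
Proof.
rewrite -(sys_p_annihilated S2 n tp); apply: pairing_continuous; first exact: iter_dop_test.
exact: sys_p_continuous.
Qed.

(** Only the terms whose first factor is a kernel survive a pairing in the first variable. As [t2]
    stays free, the result can be either paired once more or separated in the second variable. *)
Lemma vanishing_synth1 (psi : R -> R) t2 : test_fun psi ->
  charge_int (co_m c) (fun x => psi x.1 * K2 t2 x.2) +
  \sum_n p2 n t2 * charge_int (co_m2 c n) psi = 0.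
Proof.
move=> tp; set u := iter k1.+1 (dop (-1) (- alpha1)) psi.
have tu : test_fun u by exact: iter_dop_test.
have [mK2 [s2 Ks2]] := kernel_section S2 t2.
have P1 : pairing u (fun t1 => charge_int (co_m c) (fun x => K1 t1 x.1 * K2 t2 x.2))
    (charge_int (co_m c) (fun x => psi x.1 * K2 t2 x.2)).
  have [] // := @pairing_charge R u tu _ _ (co_m c) (fun t1 x => K1 t1 x.1 * K2 t2 x.2)
    (fun x => psi x.1 * K2 t2 x.2).
  - apply: measurable_funM; last by apply: measurableT_comp => //; exact: measurableT_comp.
    have := kernel_phi_measurable S1 => mK.
    have mp : measurable_fun setT (fun z : R * (R * R) => (z.1, z.2.1)).
      by apply: measurable_fun_pair => //; exact: measurableT_comp.
    exact: (measurableT_comp mK mp).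
  - move=> B; have [C KC] := kernel_phi_bounded S1 B; exists (`|C| * `|s2|) => t x tB.
    rewrite normrM; apply: ler_pM => //; first exact: le_trans (KC _ _ tB) (ler_norm _).
    exact: le_trans (Ks2 _) (ler_norm _).
  - move=> x; rewrite -(kernel_phi_pairing S1 x.1 tp) -/u.
    transitivity (\int[mu]_t (K2 t2 x.2 * (K1 t x.1 * u t))).
      by apply: eq_Rintegral => t _; ring.
    rewrite [RHS]mulrC; apply: RintegralZl => //; exact: kernel_phi_integrable.
have P2 : pairing u (fun t1 => \sum_(n < k1.+1) p1 n t1 * charge_int (co_m1 c n) (K2 t2)) 0.
  have := @pairing_sum R u tu _ (index_enum 'I_k1.+1)
    (fun n t1 => charge_int (co_m1 c n) (K2 t2) * p1 n t1) (fun n => charge_int (co_m1 c n) (K2 t2) * 0)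
    (fun n => pairing_scale (charge_int (co_m1 c n) (K2 t2)) (pairing_p1 tp n)).
  rewrite [X in pairing _ _ X]big1 => [|n _]; last by rewrite mulr0.
  by congr pairing; apply/funext => t; apply: eq_bigr => n _; rewrite mulrC.
have P3 : pairing u (fun t1 => \sum_(n < k2.+1) charge_int (co_m2 c n) (K1 t1) * p2 n t2)
    (\sum_(n < k2.+1) p2 n t2 * charge_int (co_m2 c n) psi).
  rewrite (_ : (fun t1 => _) = fun t1 => \sum_(n < k2.+1) p2 n t2 * charge_int (co_m2 c n) (K1 t1)); last first.
    by apply/funext => t; apply: eq_bigr => n _; rewrite mulrC.
  apply: pairing_sum => // n; apply: pairing_scale.
  have [] // := @pairing_charge R u tu _ _ (co_m2 c n) (fun t1 => K1 t1) psi.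
  - exact: kernel_phi_measurable.
  - by move=> B; have [C KC] := kernel_phi_bounded S1 B; exists C => t x tB; exact: KC.
  - by move=> x; rewrite -(kernel_phi_pairing S1 x tp).
have P4 : pairing u (fun t1 => \sum_(n < k1.+1) \sum_(n' < k2.+1) co_d c n n' * p1 n t1 * p2 n' t2) 0.
  have := @pairing_sum R u tu _ (index_enum 'I_k1.+1)
    (fun n t1 => (\sum_(n' < k2.+1) co_d c n n' * p2 n' t2) * p1 n t1)
    (fun n => (\sum_(n' < k2.+1) co_d c n n' * p2 n' t2) * 0)
    (fun n => pairing_scale (\sum_(n' < k2.+1) co_d c n n' * p2 n' t2) (pairing_p1 tp n)).
  rewrite [X in pairing _ _ X]big1 => [|n _]; last by rewrite mulr0.
  congr pairing; apply/funext => t; apply: eq_bigr => n _; rewrite mulr_suml.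
  by apply: eq_bigr => n' _; ring.
have P := pairing_add (pairing_add (pairing_add P1 P2) P3) P4.
have Z := pairing_0 tu.
move: P; rewrite (_ : (fun t => _) = fun=> 0); last by apply/funext => t1; exact: (c0 t1 t2).
by move=> /pairing_unique/(_ Z); rewrite !addr0.
Qed.

Lemma vanishing_synth_m : zero_charge (co_m c).
Proof.
apply: (zero_charge2 (system_bump S1)) => psi1 psi2 tp1 tp2.
set u := iter k2.+1 (dop (-1) (- alpha2)) psi2.
have tu : test_fun u by exact: iter_dop_test.
have [B b1] : exists B : R, forall x, `|psi1 x| <= B.
  have [_ [B pB]] := (test_funP psi1).1 tp1.
  have [C pC] := continuous_bounded_itv B (test_continuous tp1).
  exists `|C| => x; have [xB|/pB ->] := leP `|x| B; last by rewrite normr0.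
  exact: le_trans (pC _ xB) (ler_norm _).
have P1 : pairing u (fun t2 => charge_int (co_m c) (fun x => psi1 x.1 * K2 t2 x.2))
    (charge_int (co_m c) (fun x => psi1 x.1 * psi2 x.2)).
  have [] // := @pairing_charge R u tu _ _ (co_m c) (fun t2 x => psi1 x.1 * K2 t2 x.2)
    (fun x => psi1 x.1 * psi2 x.2).
  - apply: measurable_funM.
      apply: (measurableT_comp (continuous_measurable_fun (test_continuous tp1))).
      exact: measurableT_comp.
    have mp : measurable_fun setT (fun z : R * (R * R) => (z.1, z.2.2)).
      by apply: measurable_fun_pair => //; exact: measurableT_comp.
    exact: (measurableT_comp (kernel_phi_measurable S2) mp).
  - move=> B'; have [C KC] := kernel_phi_bounded S2 B'; exists (B * `|C|) => t x tB.
    by rewrite normrM; apply: ler_pM => //; exact: le_trans (KC _ _ tB) (ler_norm _).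
  - move=> x; rewrite -(kernel_phi_pairing S2 x.2 tp2) -/u.
    transitivity (\int[mu]_t (psi1 x.1 * (K2 t x.2 * u t))).
      by apply: eq_Rintegral => t _; ring.
    by rewrite RintegralZl//; exact: kernel_phi_integrable.
have P2 : pairing u (fun t2 => \sum_n p2 n t2 * charge_int (co_m2 c n) psi1) 0.
  have := @pairing_sum R u tu _ (index_enum 'I_k2.+1)
    (fun n t2 => charge_int (co_m2 c n) psi1 * p2 n t2) (fun n => charge_int (co_m2 c n) psi1 * 0)
    (fun n => pairing_scale (charge_int (co_m2 c n) psi1) (pairing_p2 tp2 n)).
  rewrite [X in pairing _ _ X]big1 => [|n _]; last by rewrite mulr0.
  by congr pairing; apply/funext => t; apply: eq_bigr => n _; rewrite mulrC.
have := pairing_add P1 P2.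
rewrite (_ : (fun t => _) = fun=> 0); last by apply/funext => t2; exact: vanishing_synth1.
by move=> /pairing_unique/(_ (pairing_0 tu)); rewrite addr0.
Qed.

(** Once the measure on the plane is gone, the identity paired in [t1] is a linear relation between
    the functions [p2 n]. *)
Lemma vanishing_synth_m2 n : zero_charge (co_m2 c n).
Proof.
apply: (zero_charge1 (system_bump S1)) => psi tp; move: n.
apply: (@sum_separate _ _ _ S2 (fun n => charge_int (co_m2 c n) psi)) => t2.
have [C pC] : exists C : R, forall x, `|psi x| <= C.
  have [_ [B pB]] := (test_funP psi).1 tp.
  have [C pC] := continuous_bounded_itv B (test_continuous tp).
  exists `|C| => x; have [xB|/pB ->] := leP `|x| B; last by rewrite normr0.
  exact: le_trans (pC _ xB) (ler_norm _).
have [mK2 [s2 Ks2]] := kernel_section S2 t2.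
have := vanishing_synth1 t2 tp.
rewrite (@zero_charge_int _ _ _ _ _ (C * `|s2|) vanishing_synth_m); first last.
- move=> x; rewrite normrM; apply: ler_pM => //; exact: le_trans (Ks2 _) (ler_norm _).
- apply: measurable_funM; last exact: measurableT_comp.
  by apply: measurableT_comp => //; apply: continuous_measurable_fun; exact: test_continuous.
by rewrite add0r => E; rewrite -[RHS]E; apply: eq_bigr => n _; rewrite mulrC.
Qed.

Let vanishing_synth2 t2 n :
  charge_int (co_m1 c n) (K2 t2) + \sum_(n' < k2.+1) co_d c n n' * p2 n' t2 = 0.
Proof.
move: n; apply: (@sum_separate _ _ _ S1 (fun n => charge_int (co_m1 c n) (K2 t2) +
  \sum_(n' < k2.+1) co_d c n n' * p2 n' t2)) => t1.
have := c0 t1 t2; rewrite /synth.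
have [mK [s Ks]] := kernel_product_section t1 t2.
have [mK1 [s1 Ks1]] := kernel_section S1 t1.
rewrite (zero_charge_int vanishing_synth_m mK Ks) add0r.
rewrite [X in _ + X + _]big1 ?addr0 => [|n _]; last first.
  by rewrite (zero_charge_int (vanishing_synth_m2 n) mK1 Ks1) mul0r.
rewrite -big_split/= => E; rewrite -[RHS]E; apply: eq_bigr => n _.
rewrite mulrDl mulrC; congr (_ + _); rewrite mulr_suml; apply: eq_bigr => n' _.
by ring.
Qed.

Lemma vanishing_synth_m1 n : zero_charge (co_m1 c n).
Proof.
apply: (zero_charge1 (system_bump S1)) => psi tp.
set u := iter k2.+1 (dop (-1) (- alpha2)) psi.
have tu : test_fun u by exact: iter_dop_test.
have P1 : pairing u (fun t2 => charge_int (co_m1 c n) (K2 t2)) (charge_int (co_m1 c n) psi).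
  have [] // := @pairing_charge R u tu _ _ (co_m1 c n) (fun t2 => K2 t2) psi.
  - exact: kernel_phi_measurable.
  - by move=> B; have [C KC] := kernel_phi_bounded S2 B; exists C => t x tB; exact: KC.
  - by move=> x; rewrite -(kernel_phi_pairing S2 x tp).
have P2 : pairing u (fun t2 => \sum_(n' < k2.+1) co_d c n n' * p2 n' t2) 0.
  have := @pairing_sum R u tu _ (index_enum 'I_k2.+1)
    (fun n' t2 => co_d c n n' * p2 n' t2) (fun n' => co_d c n n' * 0)
    (fun n' => pairing_scale (co_d c n n') (pairing_p2 tp n')).
  by rewrite [X in pairing _ _ X]big1 => [|n' _]; last by rewrite mulr0.
have := pairing_add P1 P2.
rewrite (_ : (fun t => _) = fun=> 0); last by apply/funext => t2; exact: vanishing_synth2.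
by move=> /pairing_unique/(_ (pairing_0 tu)); rewrite addr0.
Qed.

Lemma vanishing_synth_d : co_d c = 0.
Proof.
apply/matrixP => n n'; rewrite mxE; move: n'.
apply: (@sum_separate _ _ _ S2 (fun n' => co_d c n n')) => t2.
have [mK2 [s2 Ks2]] := kernel_section S2 t2.
by have := vanishing_synth2 t2 n; rewrite (zero_charge_int (vanishing_synth_m1 n) mK2 Ks2) add0r.
Qed.

End vanishing_synthesis.

Lemma synth_inj c c' : (forall t1 t2, synth S1 S2 c t1 t2 = synth S1 S2 c' t1 t2) ->
  eq_coords c c'.
Proof.
move=> E; have [c0 c0P] := comb_coords_exists (-1) c c'.
have Z t1 t2 : synth S1 S2 c0 t1 t2 = 0 by rewrite (synth_comb c0P) E mulN1r addNr.
have [cm cm1 cm2 cd] := c0P.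
split=> [A mA|n A mA|n A mA|].
- by have := cm _ mA; rewrite (vanishing_synth_m Z)//; lra.
- by have := cm1 n _ mA; rewrite (vanishing_synth_m1 Z)//; lra.
- by have := cm2 n _ mA; rewrite (vanishing_synth_m2 Z)//; lra.
- by move: cd; rewrite (vanishing_synth_d Z) scaleN1r => /esym/eqP; rewrite addrC subr_eq0 => /eqP.
Qed.

End synthesis.

(** * The predual *)

Section vanishing_functions.
Context (R : realType) (X : topologicalType).
Local Notation vc := (@vanishing_continuous R X).
Implicit Types (f g h : X -> R).

Lemma min_fun_continuous f g : continuous f -> continuous g ->
  continuous (fun x => Num.min (f x) (g x)).
Proof. by move=> cf cg x; exact: (@continuous_min R X f g x (cf x) (cg x)). Qed.

Lemma vanishing_lin (a : R) f g : vc f -> vc g -> vc (fun x => a * f x + g x).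
Proof.
move=> [cf vf] [cg vg]; split.
  by move=> x; apply: cvgD; [apply: cvgM; [exact: cvg_cst|exact: cf]|exact: cg].
move=> e e0.
have a0 : 0 < `|a| + 1 by rewrite ltr_pwDr.
have [A cA HA] := vf (e / 2 / (`|a| + 1)) (divr_gt0 (divr_gt0 e0 (ltr0Sn _ 1)) a0).
have [B cB HB] := vg (e / 2) (divr_gt0 e0 (ltr0Sn _ 1)).
exists (A `|` B); first exact: compactU.
move=> x nAB; have {}HA := HA x (fun ax => nAB (or_introl ax)).
have {}HB := HB x (fun bx => nAB (or_intror bx)).
apply: (le_lt_trans (ler_normD _ _)); rewrite normrM.
have : `|a| * `|f x| <= (`|a| + 1) * `|f x| by rewrite ler_wpM2r// lerDl.
have : (`|a| + 1) * `|f x| < e / 2 by rewrite mulrC -ltr_pdivlMr.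
lra.
Qed.

Lemma vanishing_min f g : vc f -> vc g -> vc (fun x => Num.min (f x) (g x)).
Proof.
move=> [cf vf] [cg vg]; split; first exact: min_fun_continuous.
move=> e e0; have [A cA HA] := vf e e0; have [B cB HB] := vg e e0.
exists (A `|` B); first exact: compactU.
move=> x nAB; have {}HA := HA x (fun ax => nAB (or_introl ax)).
have {}HB := HB x (fun bx => nAB (or_intror bx)).
by rewrite minEle; case: ifP.
Qed.

Lemma vanishing_min1 f : vc f -> vc (fun x => Num.min (f x) 1).
Proof.
move=> [cf vf]; split; first by apply: min_fun_continuous => //; exact: cst_continuous.
move=> e e0; have [A cA HA] := vf e e0; exists A => // x /HA fe.
rewrite minEle; case: ifPn => // f1; rewrite -ltNge in f1.
rewrite normr1 (lt_trans f1)//; exact: le_lt_trans (ler_norm _) fe.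
Qed.

Lemma vanishing_bounded f : vc f -> exists s : R, forall x, `|f x| <= s.
Proof.
move=> [cf vf]; have [A cA HA] := vf 1 ltr01.
have cfA : compact (f @` A) by apply: continuous_compact => //; exact: continuous_subspaceT.
have [M [_ MP]] := compact_bounded cfA.
exists (`|M| + 2) => x; have [Ax|/HA f1] := pselect (A x).
  apply: (MP (`|M| + 2)) => //.
  by have := ler_norm M; lra.
by have := normr_ge0 M; lra.
Qed.

(** The sets where [u n] is at least [e] are closed, nested and contained in a compact set. If none
    were empty, [compact_chain] would give a point where [u n] does not become small. *)
Lemma vanishing_dini (u : nat -> X -> R) : (forall n, vc (u n)) ->
  (forall n x, 0 <= u n.+1 x <= u n x) ->
  (forall x (e : R), 0 < e -> exists n, u n x < e) ->
  forall e : R, 0 < e -> exists n, forall x, u n x < e.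
Proof.
move=> vu ud u0 e e0; apply: contrapT => /forallNP H.
have mono n m x : (n <= m)%N -> u m x <= u n x.
  elim: m => [|m IH]; first by rewrite leqn0 => /eqP ->.
  rewrite leq_eqVlt => /predU1P[<-//|]; rewrite ltnS => /IH; apply: le_trans.
  by have /andP[] := ud m x.
have [A cA HA] := (vu 0%N).2 e e0.
pose F n := [set x | e <= u n x].
have FA n : F n `<=` A.
  move=> x /= ex; apply: contrapT => /HA; have := mono 0%N n x (leq0n n); rewrite /F/= in ex.
  have := ler_norm (u 0%N x); lra.
have [|||p [_ pP]] := @compact_chain X A [set F n | n in setT] cA.
- by exists (F 0%N), 0%N.
- move=> _ [n _ <-]; split; [|by have /existsNP[x /negP] := H n; rewrite -leNgt; exists x|exact: FA].
  by apply: (@closed_level _ _ (u n) [set y | e <= y]); [exact: (vu n).1|exact: closed_ge].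
- move=> _ _ [n _ <-] [m _ <-]; have [nm|/ltnW nm] := leqP n m; [right|left];
  by move=> x /= /le_trans; apply; exact: mono.
have [n] := u0 p e e0.
by rewrite ltNge (pP (F n))//; exists n.
Qed.

Lemma vanishing_compact_support h (A : set X) : continuous h -> compact A ->
  (forall x, ~ A x -> h x = 0) -> vc h.
Proof. by move=> ch cA h0; split=> // e e0; exists A => // x /h0 ->; rewrite normr0. Qed.

Lemma vanishing_exhaustion (rho : X -> R) : continuous rho ->
  (forall r : R, compact [set x | rho x <= r]) ->
  exists u, [/\ forall n, vc (u n), forall n x, 0 <= u n x <= u n.+1 x,
    forall n x, u n x <= 1 & forall x, exists n, u n x = 1].
Proof.
move=> cr cpt.
pose u n x : R := Num.max (Num.min (n.+1%:R - rho x) 1) 0; exists u; split.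
- move=> n; apply: (vanishing_compact_support _ (cpt n.+1%:R)).
    move=> x; apply: (@continuous_max R X _ (fun=> 0) x); last exact: cvg_cst.
    apply: min_fun_continuous => //; last exact: cst_continuous.
    by move=> y; apply: cvgB; [exact: cvg_cst|exact: cr].
  move=> x /= /negP; rewrite -ltNge => rx.
  by rewrite /u max_r// ge_min; apply/orP; left; lra.
- move=> n x; rewrite /u le_max lexx orbT/= ge_max !le_max lexx orbT andbT le_min !ge_min lexx !orbT andbT.
  by rewrite lerD2r ler_nat ltnW.
- by move=> n x; rewrite /u ge_max ge_min lexx orbT ler01.
- move=> x; exists (Num.truncn `|rho x|).+1; rewrite /u.
  have := truncnS_gt `|rho x|; have := ler_norm (rho x).
  rewrite -[_.+2%:R]natr1; set t := _.+1%:R => h1 h2.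
  by rewrite min_r ?max_l//; lra.
Qed.

End vanishing_functions.

Section vanishing_stone.
Context (R : realType).

(** Links the product topology with the product sigma-algebra: an open set is the union of the
    countably many squares with rational centre and half-side [n.+1%:R^-1] that it contains. *)
Lemma open_measurable_plane (A : set (R * R)) : open A ->
  measurable (A : set (measurableTypeR R * measurableTypeR R)).
Proof.
move=> oA.
pose I (q : rat) (n : nat) : set R := `](ratr q - n.+1%:R^-1), (ratr q + n.+1%:R^-1)[%classic.
pose P := [set i : rat * rat * nat | I i.1.1 i.2 `*` I i.1.2 i.2 `<=` A].
have -> : A = \bigcup_(i in P) (I i.1.1 i.2 `*` I i.1.2 i.2).
  apply/seteqP; split; last by move=> z [i Pi]; exact: Pi.
  move=> z Az; have /nbhs_ballP[e /= e0 He] : nbhs z A by exact: open_nbhs_nbhs.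
  have [n ne] : exists n : nat, n.+1%:R^-1 < e / 2.
    exists (Num.truncn (2 / e)); rewrite invf_plt ?posrE ?divr_gt0// invf_div.
    exact: truncnS_gt.
  have n0 : 0 < n.+1%:R^-1 :> R by rewrite invr_gt0.
  move: ne n0; set d := n.+1%:R^-1 => ne n0.
  have pick x : exists q : rat, `|x - ratr q| < d.
    have [|q] := @rat_in_itvoo R (x - d) (x + d); first by lra.
    by rewrite in_itv/= => /andP[h1 h2]; exists q; rewrite ltr_norml; lra.
  have [q1 h1] := pick z.1; have [q2 h2] := pick z.2.
  have IE q x : I q n x <-> `|x - ratr q| < d.
    by rewrite /I /= in_itv/= ltr_norml -/d; split=> /andP[? ?]; apply/andP; split; lra.
  exists (q1, q2, n); last by split; apply/IE.
  move=> y /= [/IE y1 /IE y2]; apply: He; split; rewrite /ball/=.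
    by move: h1 y1; rewrite !ltr_norml => /andP[? ?] /andP[? ?]; lra.
  by move: h2 y2; rewrite !ltr_norml => /andP[? ?] /andP[? ?]; lra.
rewrite bigcup_mkcond; apply: countable_bigcupT_measurable; first exact: countableP.
by move=> i; case: ifP => // _; apply: measurableX; exact: measurable_itv.
Qed.

Lemma continuous_measurable_plane (f : R * R -> R) : continuous f ->
  measurable_fun (setT : set (measurableTypeR R * measurableTypeR R)) f.
Proof.
move=> cf; apply: (measurability (@RGenOpens.G R)); first exact: RGenOpens.measurableE.
move=> _ [_ [a [b ->]] <-]; rewrite setTI; apply: open_measurable_plane.
by apply: open_comp => // x _; exact: cf.
Qed.

(** Exceeds 1 exactly on []a, b[] and vanishes outside [[a - 1, b + 1]]; this exhibits the interval
    as a superlevel set of a vanishing function. *)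
Definition tent (a b x : R) : R := Num.max (1 + Num.min (x - a) (b - x)) 0.

Lemma tent_continuous a b : continuous (tent a b).
Proof.
have cm : continuous (fun y : R => Num.min (y - a) (b - y)).
  by apply: (@min_fun_continuous _ R (fun y => y - a) (fun y => b - y)) => y; apply: cvgB; [exact: cvg_id|exact: cvg_cst|exact: cvg_cst|exact: cvg_id].
move=> x; apply: (@continuous_max R R _ (fun=> 0) x); last exact: cvg_cst.
by apply: cvgD; [exact: cvg_cst|exact: cm].
Qed.

Lemma tent_gt1 a b x : (1 < tent a b x) = (a < x < b).
Proof.
by rewrite /tent lt_max ltr10 orbF ltrDl lt_min !subr_gt0.
Qed.

Lemma tent_eq0 a b x : ~ `[a - 1, b + 1]%classic x -> tent a b x = 0.
Proof.
rewrite /= in_itv/= => /negP; rewrite negb_and -!ltNge => H.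
rewrite /tent max_r// -lerBrDl sub0r ge_min.
by case/orP: H => h; apply/orP; [left|right]; lra.
Qed.

Lemma stone_lattice_line :
  stone_lattice (@vanishing_continuous R R : set (measurableTypeR R -> R)).
Proof.
split.
- exact: vanishing_lin.
- exact: vanishing_min.
- exact: vanishing_min1.
- by move=> f [cf _]; exact: continuous_measurable_fun.
- exact: vanishing_bounded.
- exact: vanishing_dini.
- apply: (vanishing_exhaustion (@norm_continuous _ R)) => r.
  rewrite (_ : [set x | _] = `[- r, r]%classic); first exact: segment_compact.
  by apply/seteqP; split => x /=; rewrite in_itv/= ler_norml.
- move=> A /intervals_generate; apply: sub_smallest2r; first exact: smallest_sigma_algebra.
  move=> _ [a [b ->]]; exists (tent a b).
    apply: (vanishing_compact_support (@tent_continuous a b) (@segment_compact _ (a - 1) (b + 1))).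
    exact: tent_eq0.
  by apply/seteqP; split => x /=; rewrite tent_gt1 in_itv.
Qed.

Lemma stone_lattice_plane :
  stone_lattice (@vanishing_continuous R (R * R)%type : set (measurableTypeR R * measurableTypeR R -> R)).
Proof.
split.
- exact: vanishing_lin.
- exact: vanishing_min.
- exact: vanishing_min1.
- by move=> f [cf _]; exact: continuous_measurable_plane.
- exact: vanishing_bounded.
- exact: vanishing_dini.
- apply: (vanishing_exhaustion (rho := fun x : R * R => Num.max `|x.1| `|x.2|)) => [x|r].
    apply: (@continuous_max R _ (fun x : R * R => `|x.1|) (fun x => `|x.2|) x).
      by apply: (@continuous_comp _ _ _ fst); [exact: cvg_fst|exact: norm_continuous].
    by apply: (@continuous_comp _ _ _ snd); [exact: cvg_snd|exact: norm_continuous].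
  rewrite (_ : [set x | _] = `[- r, r]%classic `*` `[- r, r]%classic).
    by apply: compact_setX; exact: segment_compact.
  by apply/seteqP; split => x /=; rewrite !in_itv/= -!ler_norml ge_max => /andP.
- move=> A /rectangles_generate; apply: sub_smallest2r; first exact: smallest_sigma_algebra.
  move=> _ [_ [a [b ->]] [_ [a' [b' ->]] <-]].
  exists (fun x : R * R => Num.min (tent a b x.1) (tent a' b' x.2)).
    apply: (vanishing_compact_support _ (compact_setX (@segment_compact _ (a - 1) (b + 1)) (@segment_compact _ (a' - 1) (b' + 1)))).
      apply: min_fun_continuous => x.
        by apply: (@continuous_comp _ _ _ fst); [exact: cvg_fst|exact: tent_continuous].
      by apply: (@continuous_comp _ _ _ snd); [exact: cvg_snd|exact: tent_continuous].
    move=> x nx.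
    have t0 c d y : 0 <= tent c d y by rewrite /tent le_max lexx orbT.
    have [x1|/tent_eq0 ->] := pselect (`[a - 1, b + 1]%classic x.1); last by rewrite min_l.
    have [x2|/tent_eq0 ->] := pselect (`[a' - 1, b' + 1]%classic x.2); last by rewrite min_r.
    by case: nx.
  apply/seteqP; split => x /=; rewrite lt_min !tent_gt1 !in_itv/=.
    by move=> [-> ->].
  by move=> /andP.
Qed.

End vanishing_stone.

(** * The total variation as a dual norm *)

Section charge_functionals.
Context d (T : measurableType d) (R : realType).
Implicit Types (m : {charge set T -> \bar R}).

Lemma charge_int_lin m (a : R) (f g : T -> R) (s t : R) :
  measurable_fun setT f -> bounded_by s f -> measurable_fun setT g -> bounded_by t g ->
  charge_int m (fun x => a * f x + g x) = a * charge_int m f + charge_int m g.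
Proof.
move=> mf bf mg bg; rewrite /charge_int.
have H (mu : {finite_measure set T -> \bar R}) :
    \int[mu]_x (a * f x + g x) = a * \int[mu]_x f x + \int[mu]_x g x.
  have fi := finite_integrable mu mf bf; have gi := finite_integrable mu mg bg.
  have afi : mu.-integrable setT (EFin \o (fun x => a * f x)) by exact: (integrableZl measurableT a fi).
  by rewrite RintegralD// RintegralZl.
by rewrite (H (jpos m)) (H (jneg m)); ring.
Qed.

Lemma charge_int_0 m : charge_int m (fun=> 0) = 0.
Proof. by rewrite /charge_int !Rintegral_cst// !mul0r subrr. Qed.

(** Otherwise the functional of [m] would have norm at most [tv_norm m - e], and the Riesz theorem
    would represent it by a charge of that variation. By [stone_separates] this charge is [m]. *)
Lemma tv_approx (L : set (T -> R)) m (e : R) : stone_lattice L -> 0 < e ->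
  exists v, [/\ L v, bounded_by 1 v & tv_norm m - e <= charge_int m v].
Proof.
move=> SL e0; apply: contrapT => /forallNP H.
have lin (a : R) f g : L f -> L g -> charge_int m (fun x => a * f x + g x) = a * charge_int m f + charge_int m g.
  move=> Lf Lg; have [s bf] := stone_bounded SL Lf; have [t bg] := stone_bounded SL Lg.
  by apply: (charge_int_lin _ _ (stone_measurable SL Lf) bf (stone_measurable SL Lg) bg).
have L0 := stone_0 SL.
have Z a f : L f -> charge_int m (fun x => a * f x) = a * charge_int m f.
  move=> Lf; have := lin a f _ Lf L0.
  rewrite charge_int_0 addr0 => <-; congr charge_int; by apply/funext => x; rewrite addr0.
have one v : L v -> bounded_by 1 v -> charge_int m v <= tv_norm m - e.
  move=> Lv bv; rewrite leNgt; apply/negP => lt; apply: (H v); split=> //; exact: ltW.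
have bnd f (s : R) : L f -> bounded_by s f -> `|charge_int m f| <= (tv_norm m - e) * s.
  move=> Lf bf; have [s0|s0] := ltP 0 s.
    have b1 (a : R) : `|a| = 1 -> a * charge_int m f <= (tv_norm m - e) * s.
      move=> a1; have Lg : L (fun x => (a / s) * f x) by exact: stone_scale.
      have := one _ Lg; rewrite Z// => /(_ _).
      rewrite -ler_pdivrMr// mulrAC; apply=> x.
      by rewrite normrM normf_div a1 (gtr0_norm s0) mul1r mulrC ler_pdivrMr// mul1r.
    rewrite ler_norml; have := b1 1 (normr1 _); have := b1 (-1) (normrN1 _).
    by rewrite mul1r mulN1r; lra.
  have f0 : f = fun=> 0.
    by apply/funext => x; apply/eqP; rewrite -normr_le0; exact: le_trans (bf x) s0.
  have s00 : s <= 0 by [].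
  have sge : 0 <= s by exact: le_trans (normr_ge0 _) (bf point).
  have -> : s = 0 by lra.
  have := Z 0 f Lf; rewrite mul0r f0 => z; rewrite mulr0.
  by rewrite (_ : (fun x : T => 0 * 0) = fun=> 0) in z; [rewrite z normr0|apply/funext => x; rewrite mul0r].
have [m' [m'P tvm']] := riesz_representation SL lin bnd.
have [m0 m0P] := comb_charge_exists (-1) m m'.
have z : forall A, measurable A -> fine (m0 A) = 0.
  apply: (stone_separates SL) => h Lh; have [s bh] := stone_bounded SL Lh.
  by rewrite (comb_charge_int m0P (stone_measurable SL Lh) bh) m'P// mulN1r addNr.
have : tv_norm m = tv_norm m'.
  by apply: eq_charge_tv => A mA; have := m0P A mA; rewrite z//; lra.
lra.
Qed.

End charge_functionals.

(** * Linear functionals on the predual and the seminorm *)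

Section predual_algebra.
Context (R : realType).

Definition C0_comb (X : topologicalType) (a : R) (v w : C0 R X) : C0 R X :=
  exist _ _ (vanishing_lin a (svalP v) (svalP w)).

Lemma vanishing_0 (X : topologicalType) : vanishing_continuous (fun=> 0 : R) (X := X).
Proof.
split; first exact: cst_continuous.
by move=> e e0; exists set0; [exact: compact0|move=> x _; rewrite normr0].
Qed.

Definition C0_0 (X : topologicalType) : C0 R X := exist _ _ (vanishing_0 X).

Variables (n1 n2 : nat).
Local Notation predual := (predual R n1 n2).
Implicit Types (h : predual) (phi : predual -> R).

Definition pcomb (a : R) h h' : predual :=
  let: (v, v1, v2, e) := h in let: (w, w1, w2, e') := h' in
  (C0_comb a v w, fun n => C0_comb a (v1 n) (w1 n), fun n => C0_comb a (v2 n) (w2 n), a *: e + e').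

Definition pin0 (v : C0 R (R * R)%type) : predual := (v, fun=> C0_0 _, fun=> C0_0 _, 0).
Definition pin1 (v1 : 'I_n1 -> C0 R R) : predual := (C0_0 _, v1, fun=> C0_0 _, 0).
Definition pin2 (v2 : 'I_n2 -> C0 R R) : predual := (C0_0 _, fun=> C0_0 _, v2, 0).
Definition pin3 (e : 'M[R]_(n1, n2)) : predual := (C0_0 _, fun=> C0_0 _, fun=> C0_0 _, e).
Definition C0_at (n : nat) (i : 'I_n) (v : C0 R R) (j : 'I_n) : C0 R R := if j == i then v else C0_0 _.

Lemma C0_eq (X : topologicalType) (v w : C0 R X) : (forall x, sval v x = sval w x) -> v = w.
Proof.
case: v w => [v pv] [w pw] /= E; have vw : v = w by apply/funext.
by case: _ / vw pw => pw; congr exist; exact: Prop_irrelevance.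
Qed.

Lemma predual_eq (v w : C0 R (R * R)%type) v1 w1 v2 w2 (e e' : 'M[R]_(n1, n2)) :
  (forall x, sval v x = sval w x) -> (forall n x, sval (v1 n) x = sval (w1 n) x) ->
  (forall n x, sval (v2 n) x = sval (w2 n) x) -> e = e' ->
  (v, v1, v2, e) = (w, w1, w2, e') :> predual.
Proof.
move=> E E1 E2 ->; rewrite (C0_eq E).
have -> : v1 = w1 by apply/funext => n; apply: C0_eq; exact: E1.
by have -> : v2 = w2 by apply/funext => n; apply: C0_eq; exact: E2.
Qed.

Definition plinear phi := forall (a : R) h h', phi (pcomb a h h') = a * phi h + phi h'.

Lemma plinear_eq0 phi : plinear phi -> (forall v, phi (pin0 v) = 0) ->
  (forall n v, phi (pin1 (C0_at n v)) = 0) -> (forall n v, phi (pin2 (C0_at n v)) = 0) ->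
  (forall n n', phi (pin3 (delta_mx n n')) = 0) -> forall h, phi h = 0.
Proof.
move=> lphi p0 p1 p2 p3 [[[v v1] v2] e].
have z : phi (pin3 0) = 0.
  have := lphi (-1) (pin3 0) (pin3 0).
  rewrite mulN1r addNr => <-; congr phi; apply: predual_eq => //= *; rewrite ?mulr0 ?addr0//.
  by rewrite ?scaler0 ?addr0.
have h1 : phi (pin1 v1) = 0.
  (* The components are added one index at a time; an index already present changes nothing. *)
  have H (r : seq 'I_n1) : phi (pin1 (fun n => if n \in r then v1 n else C0_0 _)) = 0.
    elim: r => [|i r IH]; first exact: z.
    have [ir|ir] := boolP (i \in r).
      rewrite -[RHS]IH; congr phi; congr pin1; apply/funext => n; rewrite inE.
      by case: eqVneq => [->|//]; rewrite ir.
    have := lphi 1 (pin1 (C0_at i (v1 i))) (pin1 (fun n => if n \in r then v1 n else C0_0 _)).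
    rewrite p1 IH mulr0 addr0 => E; rewrite -[RHS]E; congr phi.
    apply: predual_eq => //= [x|n x|n x|]; rewrite ?mulr0 ?addr0//.
      rewrite inE /C0_at; case: eqVneq => [->|_] /=; last by rewrite mulr0 add0r.
      by rewrite (negbTE ir)/= addr0 mul1r.
    by rewrite ?scaler0 ?addr0.
  rewrite -[RHS](H (enum 'I_n1)); congr phi; congr pin1.
  by apply/funext => n; rewrite mem_enum.
have h2 : phi (pin2 v2) = 0.
  have H (r : seq 'I_n2) : phi (pin2 (fun n => if n \in r then v2 n else C0_0 _)) = 0.
    elim: r => [|i r IH]; first exact: z.
    have [ir|ir] := boolP (i \in r).
      rewrite -[RHS]IH; congr phi; congr pin2; apply/funext => n; rewrite inE.
      by case: eqVneq => [->|//]; rewrite ir.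
    have := lphi 1 (pin2 (C0_at i (v2 i))) (pin2 (fun n => if n \in r then v2 n else C0_0 _)).
    rewrite p2 IH mulr0 addr0 => E; rewrite -[RHS]E; congr phi.
    apply: predual_eq => //= [x|n x|n x|]; rewrite ?mulr0 ?addr0//.
      rewrite inE /C0_at; case: eqVneq => [->|_] /=; last by rewrite mulr0 add0r.
      by rewrite (negbTE ir)/= addr0 mul1r.
    by rewrite ?scaler0 ?addr0.
  rewrite -[RHS](H (enum 'I_n2)); congr phi; congr pin2.
  by apply/funext => n; rewrite mem_enum.
have h3 : phi (pin3 e) = 0.
  have l3 (a : R) (x y : 'M[R]_(n1, n2)) : phi (pin3 x) = 0 -> phi (pin3 y) = 0 -> phi (pin3 (a *: x + y)) = 0.
    move=> x0 y0; have := lphi a (pin3 x) (pin3 y); rewrite x0 y0 mulr0 addr0 => E.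
    by rewrite -[RHS]E; congr phi; apply: predual_eq => //= *; rewrite mulr0 addr0.
  have l3D (x y : 'M[R]_(n1, n2)) : phi (pin3 x) = 0 -> phi (pin3 y) = 0 -> phi (pin3 (x + y)) = 0.
    by move=> x0 y0; rewrite -[x]scale1r; exact: l3.
  rewrite [e]matrix_sum_delta; apply: (big_ind (fun x => phi (pin3 x) = 0)) => // i _.
  apply: (big_ind (fun x => phi (pin3 x) = 0)) => // j _.
  by rewrite -[_ *: _]addr0; exact: l3.
have E : phi (pcomb 1 (pcomb 1 (pcomb 1 (pin0 v) (pin1 v1)) (pin2 v2)) (pin3 e)) = 0.
  by rewrite !lphi p0 h1 h2 h3 !(mulr0, addr0).
rewrite -[RHS]E; congr phi.
by apply: predual_eq => //= *; rewrite ?scaler0 ?scale1r ?mul1r ?mulr0 !(addr0, add0r) ?scaler0 ?mulr0 ?add0r.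
Qed.

Lemma duality_plinear (c : coords R n1 n2) : plinear (duality c).
Proof.
move=> a [[[v v1] v2] e] [[[w w1] w2] e'] /=.
have L1 (m : meas1 R) (f g : C0 R R) : charge_int m (fun x => a * sval f x + sval g x) =
    a * charge_int m (sval f) + charge_int m (sval g).
  have [s bf] := vanishing_bounded (svalP f); have [t bg] := vanishing_bounded (svalP g).
  have mf := stone_measurable (stone_lattice_line R) (svalP f).
  have mg := stone_measurable (stone_lattice_line R) (svalP g).
  exact: (@charge_int_lin _ _ _ m a (sval f) (sval g) s t mf bf mg bg).
have L2 (m : meas2 R) (f g : C0 R (R * R)%type) : charge_int m (fun x => a * sval f x + sval g x) =
    a * charge_int m (sval f) + charge_int m (sval g).
  have [s bf] := vanishing_bounded (svalP f); have [t bg] := vanishing_bounded (svalP g).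
  have mf := stone_measurable (stone_lattice_plane R) (svalP f).
  have mg := stone_measurable (stone_lattice_plane R) (svalP g).
  exact: (@charge_int_lin _ _ _ m a (sval f) (sval g) s t mf bf mg bg).
rewrite L2; under eq_bigr => n _ do rewrite L1.
under [X in _ + X + _]eq_bigr => n _ do rewrite L1.
have -> : \sum_(n < n1) \sum_(n' < n2) co_d c n n' * (a *: e + e') n n' =
  a * (\sum_(n < n1) \sum_(n' < n2) co_d c n n' * e n n') + \sum_(n < n1) \sum_(n' < n2) co_d c n n' * e' n n'.
  rewrite mulr_sumr -big_split/=; apply: eq_bigr => n _.
  rewrite mulr_sumr -big_split/=; apply: eq_bigr => n' _; by rewrite !mxE; ring.
have S k (F G : 'I_k -> R) : \sum_n (a * F n + G n) = a * \sum_n F n + \sum_n G n.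
  by rewrite big_split/= mulr_sumr.
by rewrite !S; ring.
Qed.

Lemma duality_pin0 (c : coords R n1 n2) v : duality c (pin0 v) = charge_int (co_m c) (sval v).
Proof.
rewrite /= !big1 ?addr0// => n _; rewrite ?charge_int_0//.
by rewrite big1// => n' _; rewrite mxE mulr0.
Qed.

Lemma duality_pin1 (c : coords R n1 n2) n v :
  duality c (pin1 (C0_at n v)) = charge_int (co_m1 c n) (sval v).
Proof.
rewrite /= charge_int_0 add0r (bigD1 n)//= {1}/C0_at eqxx.
rewrite [X in _ + X + _ + _]big1 => [|n' nn']; last by rewrite /C0_at (negbTE nn') charge_int_0.
rewrite [X in _ + X + _]big1 => [|n' _]; last by rewrite charge_int_0.
rewrite [X in _ + X]big1 ?addr0 => [//|n' _].
by rewrite big1// => n'' _; rewrite mxE mulr0.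
Qed.

Lemma duality_pin2 (c : coords R n1 n2) n v :
  duality c (pin2 (C0_at n v)) = charge_int (co_m2 c n) (sval v).
Proof.
rewrite /= charge_int_0 add0r [X in X + _ + _]big1 => [|n' _]; last by rewrite charge_int_0.
rewrite add0r (bigD1 n)//= {1}/C0_at eqxx.
rewrite [X in _ + X + _]big1 => [|n' nn']; last by rewrite /C0_at (negbTE nn') charge_int_0.
rewrite [X in _ + X]big1 ?addr0 => [//|n' _].
by rewrite big1// => n'' _; rewrite mxE mulr0.
Qed.

Lemma duality_pin3 (c : coords R n1 n2) n n' : duality c (pin3 (delta_mx n n')) = co_d c n n'.
Proof.
rewrite /= charge_int_0 add0r [X in X + _ + _]big1 => [|i _]; last by rewrite charge_int_0.
rewrite add0r [X in X + _]big1 => [|i _]; last by rewrite charge_int_0.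
rewrite add0r (bigD1 n)//= [X in _ + X]big1 => [|i ni]; last first.
  by rewrite big1// => j _; rewrite mxE (negbTE ni) mulr0.
rewrite addr0 (bigD1 n')//= [X in _ + X]big1 => [|j nj]; last first.
  by rewrite mxE (negbTE nj) andbF mulr0.
by rewrite addr0 mxE !eqxx mulr1.
Qed.

Definition seminorm (c : coords R n1 n2) : R := tv_norm (co_m c) +
  \sum_(n < n1) tv_norm (co_m1 c n) + \sum_(n < n2) tv_norm (co_m2 c n).

Lemma tv_le_seminorm (c : coords R n1 n2) : [/\ tv_norm (co_m c) <= seminorm c,
  forall n, tv_norm (co_m1 c n) <= seminorm c, forall n, tv_norm (co_m2 c n) <= seminorm c &
  0 <= seminorm c].
Proof.
have a0 := tv_norm_ge0 (co_m c).
have b0 : 0 <= \sum_(n < n1) tv_norm (co_m1 c n) by apply: sumr_ge0 => n _; exact: tv_norm_ge0.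
have c0 : 0 <= \sum_(n < n2) tv_norm (co_m2 c n) by apply: sumr_ge0 => n _; exact: tv_norm_ge0.
split=> [|n|n|]; rewrite /seminorm; [lra| | |lra].
- suff : tv_norm (co_m1 c n) <= \sum_(n < n1) tv_norm (co_m1 c n) by lra.
  by rewrite (bigD1 n)//= lerDl; apply: sumr_ge0 => i _; exact: tv_norm_ge0.
- suff : tv_norm (co_m2 c n) <= \sum_(n < n2) tv_norm (co_m2 c n) by lra.
  by rewrite (bigD1 n)//= lerDl; apply: sumr_ge0 => i _; exact: tv_norm_ge0.
Qed.

(** The unit ball dual to the seminorm. The matrix component is 0 because the seminorm does not see
    [co_d]. *)
Definition punit h := let: (v, v1, v2, e) := h in
  [/\ forall x, `|sval v x| <= 1, forall n x, `|sval (v1 n) x| <= 1,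
      forall n x, `|sval (v2 n) x| <= 1 & e = 0].

Lemma punit_le (c : coords R n1 n2) h : punit h -> duality c h <= seminorm c.
Proof.
case: h => [[[v v1] v2] e] [b b1 b2 ->] /=.
rewrite [X in _ + X <= _]big1 => [|n _]; last by rewrite big1// => n' _; rewrite mxE mulr0.
have L1 (m : meas1 R) (f : C0 R R) : (forall x, `|sval f x| <= 1) -> charge_int m (sval f) <= tv_norm m.
  move=> bf; apply: (le_trans (ler_norm _)); rewrite -[leRHS]mul1r.
  by apply: charge_int_le => //; exact: (stone_measurable (stone_lattice_line R) (svalP f)).
rewrite addr0 /seminorm; apply: lerD; [apply: lerD|]; [|by apply: ler_sum => n _; exact: L1|by apply: ler_sum => n _; exact: L1].
apply: (le_trans (ler_norm _)); rewrite -[leRHS]mul1r.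
by apply: charge_int_le => //; exact: (stone_measurable (stone_lattice_plane R) (svalP v)).
Qed.

Lemma seminorm_le (c : coords R n1 n2) (r : R) :
  (forall h, punit h -> duality c h <= r) -> seminorm c <= r.
Proof.
move=> H; apply/ler_addgt0Pr => e e0.
(* There are [n1 + n2 + 1] charges to approximate, and the error [e] is shared equally among
   them. *)
pose k : R := n1%:R + n2%:R + 1; have k0 : 0 < k by rewrite ltr_pwDr.
pose d := e / k; have d0 : 0 < d by rewrite divr_gt0.
have [v [Lv bv tv]] := tv_approx (co_m c) (stone_lattice_plane R) d0.
have /choice[v1 v1P] n := tv_approx (co_m1 c n) (stone_lattice_line R) d0.
have /choice[v2 v2P] n := tv_approx (co_m2 c n) (stone_lattice_line R) d0.
have L1 n : vanishing_continuous (v1 n) by have [] := v1P n.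
have L2 n : vanishing_continuous (v2 n) by have [] := v2P n.
pose h : predual := (exist _ v Lv, fun n => exist _ (v1 n) (L1 n), fun n => exist _ (v2 n) (L2 n), 0).
have : duality c h <= r.
  by apply: H; split=> //= n; [have [] := v1P n|have [] := v2P n].
rewrite /= [X in _ + X <= _ -> _]big1 => [|n _]; last by rewrite big1// => n' _; rewrite mxE mulr0.
rewrite addr0 => le.
have S1 : \sum_(n < n1) tv_norm (co_m1 c n) - n1%:R * d <= \sum_(n < n1) charge_int (co_m1 c n) (v1 n).
  rewrite mulr_natl -[n1 in _ *+ n1]card_ord -sumr_const -sumrB.
  by apply: ler_sum => n _; have [] := v1P n.
have S2 : \sum_(n < n2) tv_norm (co_m2 c n) - n2%:R * d <= \sum_(n < n2) charge_int (co_m2 c n) (v2 n).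
  rewrite mulr_natl -[n2 in _ *+ n2]card_ord -sumr_const -sumrB.
  by apply: ler_sum => n _; have [] := v2P n.
have E : e = n1%:R * d + n2%:R * d + d.
  transitivity (d * k); first by rewrite /d divfK ?gt_eqF.
  by rewrite /k; ring.
by rewrite /seminorm E; lra.
Qed.

End predual_algebra.

(** * Charges concentrated on finitely many atoms *)

Section variation.
Context d (T : measurableType d) (R : realType).
Implicit Types (m : {charge set T -> \bar R}) (mu : {finite_measure set T -> \bar R}).
Implicit Types (A B C : set T).

Lemma fine_measureU mu A B : measurable A -> measurable B -> A `&` B = set0 ->
  fine (mu (A `|` B)) = fine (mu A) + fine (mu B).
Proof.
by move=> mA mB AB; rewrite measureU// fineD// fin_num_measure.
Qed.

Lemma fine_measureD mu A B : measurable A -> measurable B ->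
  fine (mu A) = fine (mu (A `&` B)) + fine (mu (A `\` B)).
Proof.
move=> mA mB; rewrite -fine_measureU; first by rewrite setUIDK.
- exact: measurableI.
- exact: measurableD.
- by apply/seteqP; split=> x //= -[[_ Bx] [_ /(_ Bx)]].
Qed.

Lemma fine_measure_ge0 mu A : 0 <= fine (mu A).
Proof. by rewrite fine_ge0. Qed.

Lemma fine_le_measure mu A B : measurable A -> measurable B -> A `<=` B ->
  fine (mu A) <= fine (mu B).
Proof.
move=> mA mB AB; rewrite (fine_measureD mu mB mA) (setIidr AB) lerDl; exact: fine_measure_ge0.
Qed.

Lemma fine_measureU_le mu A B : measurable A -> measurable B ->
  fine (mu (A `|` B)) <= fine (mu A) + fine (mu B).
Proof.
move=> mA mB; have mAB := measurableU _ _ mA mB; rewrite (fine_measureD mu mAB mA).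
apply: lerD; apply: fine_le_measure => //; [exact: measurableI|exact: measurableD|].
by move=> x [[Ax /(_ Ax)|Bx _]].
Qed.

Lemma null_integral mu A (h : T -> R) : measurable A -> fine (mu A) = 0 ->
  measurable_fun setT h -> (forall x, ~ A x -> h x = 0) -> \int[mu]_x h x = 0.
Proof.
move=> mA A0 mh h0; rewrite /Rintegral (@ae_eq_integral _ _ _ mu setT (cst 0%E))//.
- by rewrite integral0.
- exact/measurable_EFinP.
- exists A; split=> //; first by apply/eqP; rewrite -fine_eq0 ?fin_num_measure// A0.
  by move=> x /= H; apply: contrapT => /h0 E; apply: H => _; rewrite /= E.
Qed.

(** The total variation measure, with a finite measure structure. *)
Definition variation m : {finite_measure set T -> \bar R} :=
  sval (cid2 (ex_intro2 _ _ (s2val (finite_measure_comb (jpos m) (jneg m) ler01))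
   (s2valP (finite_measure_comb (jpos m) (jneg m) ler01))
   (s2valP' (finite_measure_comb (jpos m) (jneg m) ler01)))).

Lemma variationE m A : measurable A -> fine (variation m A) = fine (jpos m A) + fine (jneg m A).
Proof. by move=> mA; rewrite /variation; case: cid2 => /= mu H _; rewrite H// mul1r. Qed.

Lemma variation_eq0 m A : measurable A -> fine (variation m A) = 0 ->
  fine (jpos m A) = 0 /\ fine (jneg m A) = 0.
Proof.
move=> mA; rewrite variationE// => E.
by have := fine_measure_ge0 (jpos m) A; have := fine_measure_ge0 (jneg m) A; lra.
Qed.

Section weights.
Variables (K : nat) (A : 'I_K -> set T).
Hypothesis mA : forall k, measurable (A k).
Hypothesis dA : forall k l, k != l -> A k `&` A l = set0.

Let U (r : seq 'I_K) := \big[setU/set0]_(k <- r) A k.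

Let mU r : measurable (U r).
Proof. by apply: bigsetU_measurable. Qed.

Let partial_decomposition mu B r : measurable B -> uniq r ->
  fine (mu B) = fine (mu (B `\` U r)) + \sum_(k <- r) fine (mu (B `&` A k)).
Proof.
move=> mB; elim: r => [_|k r IH /= /andP[kr ur]].
  by rewrite /U !big_nil setD0 addr0.
rewrite IH// /U !big_cons -/(U r) addrA; congr (_ + _).
rewrite (fine_measureD mu (measurableD mB (mU r)) (mA k)) addrC; congr (_ + _); congr (fine (mu _)); last by rewrite setDDl setUC.
apply/seteqP; split=> x /=; first by move=> [[Bx _] Ax].
move=> [Bx Ax]; split=> //; split=> //; rewrite /U -bigcup_seq => -[l /= lr Alx].
have [kl|/dA kl] := eqVneq k l; first by rewrite kl lr in kr.
by have : (A k `&` A l) x by []; rewrite kl.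
Qed.

(** The measure with density [w k] on [A k] and 1 elsewhere, assembled from restrictions. *)
Lemma weighted_measure mu (w : 'I_K -> R) : (forall k, 0 <= w k) ->
  exists mu' : {finite_measure set T -> \bar R}, forall B, measurable B ->
    fine (mu' B) = fine (mu B) + \sum_k (w k - 1) * fine (mu (B `&` A k)).
Proof.
move=> w0.
have restr A0 (mA0 : measurable A0) : exists nu : {finite_measure set T -> \bar R},
    forall B, measurable B -> fine (nu B) = fine (mu (B `&` A0)).
  by have muA0 := finite_lty mu; exists (mfrestr mA0 (le_lt_trans (le_measure mu (mem_set mA0) (mem_set measurableT) (@subsetT _ A0)) muA0)).
have /choice[nu nuP] k := restr _ (mA k).
have [nu0 nu0P] := restr _ (measurableC (mU (enum 'I_K))).
have H (r : seq 'I_K) : exists mu' : {finite_measure set T -> \bar R}, forall B, measurable B ->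
    fine (mu' B) = fine (mu (B `\` U (enum 'I_K))) + \sum_(k <- r) w k * fine (mu (B `&` A k)).
  elim: r => [|k r [mu' mu'P]].
    by exists nu0 => B mB; rewrite big_nil addr0 nu0P.
  have [mu'' mu''P _] := finite_measure_comb (nu k) mu' (w0 k).
  by exists mu'' => B mB; rewrite mu''P// nuP// mu'P// big_cons addrCA.
have [mu' mu'P] := H (enum 'I_K); exists mu' => B mB.
rewrite mu'P// (partial_decomposition mu mB (enum_uniq 'I_K)) -addrA; congr (_ + _).
rewrite !big_enum/= -big_split/=; apply: eq_bigr => k _; ring.
Qed.

(** As long as [|e k| <= 1] the weights [1 + e k] are nonnegative, so the weighted Jordan parts
    still decompose [m']. The resulting bound is affine in [e], without absolute values, so opposite
    perturbations give opposite corrections. *)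
Lemma tv_perturbation m m' (e : 'I_K -> R) : (forall k, `|e k| <= 1) ->
  (forall B, measurable B -> fine (m' B) = fine (m B) + \sum_k e k * fine (m (B `&` A k))) ->
  tv_norm m' <= tv_norm m + \sum_k e k * fine (variation m (A k)).
Proof.
move=> e1 m'E.
have w0 k : 0 <= 1 + e k by have := e1 k; rewrite ler_norml => /andP[]; lra.
have [mu1 mu1P] := weighted_measure (jpos m) w0.
have [mu2 mu2P] := weighted_measure (jneg m) w0.
have : diff_of m' mu1 mu2.
  move=> B mB; rewrite m'E// mu1P// mu2P// (diff_of_jordan m mB).
  rewrite (eq_bigr (fun k => (1 + e k - 1) * fine (jpos m (B `&` A k)) - (1 + e k - 1) * fine (jneg m (B `&` A k)))).
    by rewrite sumrB; ring.
  by move=> k _; rewrite (diff_of_jordan m (measurableI _ _ mB (mA k))); ring.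
move=> /tv_norm_le_diff /le_trans; apply.
rewrite mu1P// mu2P// tv_normE.
rewrite [X in _ <= _ + X](eq_bigr (fun k => (1 + e k - 1) * fine (jpos m (setT `&` A k)) + (1 + e k - 1) * fine (jneg m (setT `&` A k)))).
  by rewrite big_split/=; lra.
by move=> k _; rewrite variationE// !setTI; ring.
Qed.

(** If [e k] were nonzero, [m] would vanish on all measurable subsets of [A k]; its intersection
    with the Hahn set shows that the variation of [A k] would vanish too. *)
Lemma perturbation_independent m (e : 'I_K -> R) : (forall k, 0 < fine (variation m (A k))) ->
  (forall B, measurable B -> \sum_k e k * fine (m (B `&` A k)) = 0) -> forall k, e k = 0.
Proof.
move=> Apos H k; apply/eqP/negPn/negP => ek.
have one B : measurable B -> fine (m (B `&` A k)) = 0.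
  move=> mB; have := H (B `&` A k) (measurableI _ _ mB (mA k)).
  rewrite (bigD1 k)//= big1 => [|l lk]; last first.
    by rewrite -setIA dA 1?eq_sym// setI0 charge0 mulr0.
  by rewrite addr0 -setIA setIid => /eqP; rewrite mulf_eq0 (negbTE ek)/= => /eqP.
have [[mP _] _ _ _] := hahnP m.
have p0 : fine (jpos m (A k)) = 0.
  by rewrite /jpos /= jordan_posE /= /crestr0 mem_set// /crestr setIC one.
have := one setT measurableT; rewrite setTI (diff_of_jordan m (mA k)) p0.
by have := Apos k; rewrite variationE// p0; lra.
Qed.

End weights.

Definition positive_family m K (A : 'I_K -> set T) :=
  [/\ forall k, measurable (A k), forall k l, k != l -> A k `&` A l = set0 &
      forall k, 0 < fine (variation m (A k))].

Lemma positive_family_cons m K (A : 'I_K -> set T) C : positive_family m A ->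
  measurable C -> (forall k, C `&` A k = set0) -> 0 < fine (variation m C) ->
  exists A' : 'I_K.+1 -> set T, positive_family m A'.
Proof.
move=> [mA dA pA] mC CA pC.
exists (fun i => if unlift ord0 i is Some j then A j else C); split=> [i|i j|i].
- by case: unliftP.
- case: unliftP => [i' ->|->]; case: unliftP => [j' ->|->] ij //.
  + by apply: dA; apply: contraNneq ij => ->.
  + by rewrite setIC.
- by case: unliftP.
Qed.

Lemma positive_family_subst m K (A : 'I_K -> set T) k B : positive_family m A ->
  measurable B -> B `<=` A k -> 0 < fine (variation m B) ->
  positive_family m (fun j => if j == k then B else A j).
Proof.
move=> [mA dA pA] mB BA pB; split=> [i|i j ij|i]; first by case: ifP.
- case: eqVneq => [ik|ik]; case: eqVneq => [jk|jk].
  + by rewrite ik jk eqxx in ij.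
  + by apply/seteqP; split=> x //= [/BA Akx Ajx]; have : (A k `&` A j) x by []; rewrite dA// eq_sym.
  + by apply/seteqP; split=> x //= [Aix /BA Akx]; have : (A i `&` A k) x by []; rewrite dA.
  + exact: dA.
- by case: ifP.
Qed.

(* In a maximal family of disjoint sets of positive variation, no set splits into
   two sets of positive variation. *)
Section atoms.
Variables (m : {charge set T -> \bar R}) (K : nat) (A : 'I_K -> set T).
Hypothesis famA : positive_family m A.
Hypothesis maxA : forall A' : 'I_K.+1 -> set T, ~ positive_family m A'.

Let mA k : measurable (A k). Proof. by have [] := famA. Qed.

Lemma atom_zero_one k B : measurable B ->
  fine (variation m (A k `&` B)) = 0 \/ fine (variation m (A k `\` B)) = 0.
Proof.
move=> mB; apply/or_asboolP/negPn/negP => /norP[/asboolPn/eqP n1 /asboolPn/eqP n2].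
have m1 := measurableI _ _ (mA k) mB; have m2 := measurableD (mA k) mB.
have p1 : 0 < fine (variation m (A k `&` B)) by rewrite lt_neqAle eq_sym n1 fine_measure_ge0.
have p2 : 0 < fine (variation m (A k `\` B)) by rewrite lt_neqAle eq_sym n2 fine_measure_ge0.
have fam1 := positive_family_subst famA m1 (@subIsetl _ _ _) p1.
have [|A' famA'] := positive_family_cons fam1 m2 _ p2; last exact: maxA famA'.
move=> l; case: eqVneq => [_|lk].
  by apply/seteqP; split=> x //= -[[_ nB] [_ /nB]].
have [_ dA _] := famA.
by apply/seteqP; split=> x //= [[Ax _] Alx]; have : (A k `&` A l) x by []; rewrite dA// eq_sym.
Qed.

Lemma complement_null : fine (variation m (~` \bigcup_k A k)) = 0.
Proof.
apply/eqP/negPn/negP => n0.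
have mC : measurable (~` \bigcup_k A k).
  by apply: measurableC; apply: countable_bigcupT_measurable => //; exact: countableP.
have [||A' famA'] := positive_family_cons famA mC; last exact: maxA famA'.
  by move=> k; apply/seteqP; split=> x //= -[nU Ak]; apply: nU; exists k.
by rewrite lt_neqAle eq_sym n0 fine_measure_ge0.
Qed.

Lemma null_increasing_union (mu : {finite_measure set T -> \bar R}) (F : nat -> set T) :
  (forall n, measurable (F n)) -> (forall n, fine (mu (F n)) = 0) ->
  fine (mu (\bigcup_n F n)) = 0.
Proof.
move=> mF F0; have : (mu (\bigcup_n F n) <= \sum_(n <oo) mu (F n))%E.
  by apply: generalized_Boole_inequality => //; exact: bigcup_measurable.
rewrite eseries0 => [|n _ _]; last first.
  have mFn : mu (F n) \is a fin_num by exact: fin_num_measure.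
  by rewrite -(fineK mFn) F0.
by rewrite measure_le0 => /eqP ->.
Qed.

(** On an atom the distribution function of [p] takes only the values 0 and full mass. The constant
    [c] is the supremum of the thresholds with value 0, and continuity of the measure handles the
    jump. *)
Lemma atom_level k (p : T -> R) : measurable_fun setT p ->
  exists c : R, fine (variation m (A k `&` [set x | p x != c])) = 0.
Proof.
move=> mp; set mu := variation m.
have mle (r : R) : measurable [set x | p x <= r].
  by rewrite -[X in measurable X]setTI; apply: measurable_fun_le => //; exact: measurable_cst.
pose S := [set r : R | fine (mu (A k `&` [set x | p x <= r])) = 0].
have pA : 0 < fine (mu (A k)) by have [] := famA.
have mono (r r' : R) : r <= r' -> fine (mu (A k `&` [set x | p x <= r])) <= fine (mu (A k `&` [set x | p x <= r'])).
  move=> rr; apply: fine_le_measure; [exact: measurableI|exact: measurableI|].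
  by move=> x /= [Ax pr]; split=> //; exact: le_trans rr.
have S0 : S !=set0.
  apply: contrapT => /forallNP H.
  have full n : fine (mu (A k `\` [set x | p x <= - n%:R])) = 0.
    have [h|h] := atom_zero_one k (mle (- n%:R)); [by case: (H _ h)|exact: h].
  have := null_increasing_union (fun n => measurableD (mA k) (mle (- n%:R))) full.
  rewrite (_ : \bigcup_n _ = A k) ?gt_eqF//; last first.
    apply/seteqP; split=> [x [n _ []]//|x Ax]; exists (Num.truncn `|p x|).+1 => //; split=> //=.
    apply/negP; rewrite -ltNge; have := truncnS_gt `|p x|; have := ler_norm (- p x); rewrite normrN.
    by set t := _.+1%:R; lra.
  by move=> /eqP; rewrite gt_eqF.
have ubS : exists b : R, ubound S b.
  apply: contrapT => /forallNP H.
  have zero n : fine (mu (A k `&` [set x | p x <= n%:R])) = 0.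
    have /existsNP[r /not_implyP[Sr /negP]] := H n%:R; rewrite -ltNge => nr.
    apply/eqP; rewrite eq_le fine_measure_ge0 andbT -Sr; exact: mono (ltW nr).
  have := null_increasing_union (fun n => measurableI _ _ (mA k) (mle n%:R)) zero.
  rewrite (_ : \bigcup_n _ = A k); last first.
    apply/seteqP; split=> [x [n _ []]//|x Ax]; exists (Num.truncn `|p x|).+1 => //; split=> //=.
    have := truncnS_gt `|p x|; have := ler_norm (p x).
    by set t := _.+1%:R; lra.
  by move=> /eqP; rewrite gt_eqF.
pose c := sup S; have hS : has_sup S by split.
have Sbelow (r : R) : r < c -> S r.
  move=> rc; have cr0 : 0 < c - r by rewrite subr_gt0.
  have [r' Sr' rr'] := sup_adherent cr0 hS.
  apply/eqP; rewrite eq_le fine_measure_ge0 andbT -(Sr' : fine _ = 0); apply: mono.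
  by rewrite -/c in rr'; lra.
have nSabove (r : R) : c < r -> fine (mu (A k `\` [set x | p x <= r])) = 0.
  move=> cr; have [Sr|//] := atom_zero_one k (mle r).
  by have := sup_upper_bound hS Sr; rewrite -/c; lra.
exists c.
pose F n : set T := (A k `&` [set x | p x <= c - n.+1%:R^-1]) `|` (A k `\` [set x | p x <= c + n.+1%:R^-1]).
have n0 n : 0 < n.+1%:R^-1 :> R by rewrite invr_gt0.
have mF n : measurable (F n) by apply: measurableU; [exact: measurableI|exact: measurableD].
have F0 n : fine (mu (F n)) = 0.
  rewrite fine_measureU; [|exact: measurableI|exact: measurableD|].
    by rewrite nSabove ?addr0; [apply: Sbelow; have := n0 n|have := n0 n]; set t := _^-1; lra.
  apply/seteqP; split=> x //= -[[_ h1] [_ h2]]; apply: h2; have := n0 n.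
  by move: h1; set t := _^-1; lra.
rewrite (_ : _ `&` _ = \bigcup_n F n); first exact: null_increasing_union.
apply/seteqP; split=> x /=.
  move=> [Ax pc]; have d0 : 0 < `|p x - c| by rewrite normr_gt0 subr_eq0.
  have := truncnS_gt (`|p x - c|^-1); set n := Num.truncn _ => hn.
  have hn' : n.+1%:R^-1 < `|p x - c| by rewrite invf_plt ?posrE.
  exists n => //; rewrite /F /=; move: hn'; set t := _^-1 => hn'.
  have [xc|xc] := ltP (p x) c.
    by left; split=> //; move: hn'; rewrite ltr0_norm; lra.
  right; split=> //; apply/negP; rewrite -ltNge; move: hn'; rewrite ger0_norm; lra.
move=> [n _ [[Ax h]|[Ax h]]]; split=> //; have := n0 n.
  by move=> t0; apply/eqP => E; move: t0 h; rewrite /= E; set t := _^-1; lra.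
by move=> t0; apply/eqP => E; apply: h; move: t0; rewrite /= E; set t := _^-1; lra.
Qed.

(** Intended for coordinate functions: the identity on the line and the two projections on the
    plane. *)
Variable ps : seq (T -> R).
Hypothesis mps : forall p, List.In p ps -> measurable_fun setT p.
Hypothesis sep : forall x y, (forall p, List.In p ps -> p x = p y) -> x = y.

(** Intersecting the atom with one full level set per function of [ps] keeps its whole variation.
    All functions of [ps] are constant on the result, which is therefore a single point. *)
Lemma atom_point k : exists x, A k x /\ measurable [set x] /\
  fine (variation m (A k `\` [set x])) = 0.
Proof.
have [E [mE EA E0 Ec]] : exists E, [/\ measurable E, E `<=` A k, fine (variation m (A k `\` E)) = 0 &
    forall p, List.In p ps -> forall x y, E x -> E y -> p x = p y].
  elim: ps mps => [_|p r IH mpr]; first by exists (A k); split=> //; rewrite setDv measure0.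
  have [|E [mE EA E0 Ec]] := IH; first by move=> q qr; apply: mpr; right.
  have mp : measurable_fun setT p by apply: mpr; left.
  have [c c0] := atom_level k mp.
  have mc : measurable [set x | p x = c].
    rewrite -[X in measurable X]setTI; exact: (mp measurableT _ (measurable_set1 c)).
  exists (E `&` [set x | p x = c]); split; [exact: measurableI|by move=> x [/EA]| |].
  - have mpc : measurable [set x | p x != c].
      rewrite (_ : [set x | _] = ~` [set x | p x = c]); first exact: measurableC.
      by apply/seteqP; split=> z /= /eqP.
    have mD : measurable (A k `\` (E `&` [set x | p x = c])).
      by apply: measurableD => //; exact: measurableI.
    have m1 := measurableD (mA k) mE; have m2 := measurableI _ _ (mA k) mpc.
    apply/eqP; rewrite eq_le fine_measure_ge0 andbT.
    have := fine_measureU_le (variation m) m1 m2; rewrite E0 c0 addr0; apply: le_trans.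
    apply: fine_le_measure => //; first exact: measurableU.
    move=> z [Az nEz]; have [Ez|nE] := pselect (E z); last by left.
    by right; split=> //=; apply/eqP => pz; apply: nEz.
  - move=> q [<- x y [_ ->] [_ ->]//|qr x y [Ex _] [Ey _]]; exact: Ec.
have [x Ex] : E !=set0.
  apply/set0P/eqP => E00; move: E0; rewrite E00 setD0 => A0.
  by have [_ _ /(_ k)] := famA; rewrite A0 ltxx.
exists x; have -> : [set x] = E.
  apply/seteqP; split=> [y ->//|y Ey]; apply: sep => p pin; exact: Ec.
by split=> //; exact: EA.
Qed.

(** Off a set of zero variation, [h] agrees with a combination of indicators of the points [x k]. *)
Lemma atomic_charge : exists (x : 'I_K -> T) (a : 'I_K -> R), forall (h : T -> R) (s : R),
  measurable_fun setT h -> bounded_by s h -> charge_int m h = \sum_k a k * h (x k).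
Proof.
have /choice[x xP] k := atom_point k.
exists x, (fun k => fine (m [set x k])) => h s mh bh.
have Ax k : A k (x k) by have [] := xP k.
have mx k : measurable [set x k] by have [_ []] := xP k.
pose Z := ~` \bigcup_k [set x k].
have mbig (B : 'I_K -> set T) : (forall k, measurable (B k)) -> measurable (\bigcup_k B k).
  by move=> mB; apply: countable_bigcupT_measurable => //; exact: countableP.
have mZ : measurable Z by apply: measurableC; exact: mbig.
have Z0 : fine (variation m Z) = 0.
  (* A sequence of null sets that covers [Z]: the atoms without their points, then, from index [K]
     on, the complement of all atoms. *)
  pose F n : set T := if insub n is Some k then A k `\` [set x k] else ~` \bigcup_k A k.
  have mF n : measurable (F n).
    by rewrite /F; case: insub => [k|]; [exact: measurableD|apply: measurableC; exact: mbig].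
  have F0 n : fine (variation m (F n)) = 0.
    by rewrite /F; case: insub => [k|]; [have [_ []] := xP k|exact: complement_null].
  apply/eqP; rewrite eq_le fine_measure_ge0 andbT -(null_increasing_union mF F0).
  apply: fine_le_measure => //; first exact: bigcup_measurable.
  move=> y nZ; have [[k _ Ay]|nA] := pselect ((\bigcup_k A k) y).
    exists (nat_of_ord k) => //; rewrite /F valK; split=> //= yx.
    by apply: nZ; exists k.
  by exists K => //; rewrite /F insubF// ltnn.
have [Zp Zn] := variation_eq0 mZ Z0.
pose S (r : seq 'I_K) y := \sum_(k <- r) h (x k) * \1_[set x k] y.
have mS r : measurable_fun setT (S r).
  by apply: measurable_sum => k; apply: measurable_funM => //; exact: measurable_indic.
have bS r : exists t : R, bounded_by t (S r).
  exists (\sum_(k <- r) `|h (x k)|) => y; apply: (le_trans (ler_norm_sum _ _ _)); apply: ler_sum => k _.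
  by rewrite normrM ler_piMr// indicE; case: (_ \in _); rewrite ?normr1 ?normr0.
have intS r : charge_int m (S r) = \sum_(k <- r) fine (m [set x k]) * h (x k).
  elim: r => [|k r IH].
    rewrite big_nil (_ : S [::] = fun=> 0) ?charge_int_0//.
    by apply/funext => y; rewrite /S big_nil.
  rewrite big_cons -IH (_ : S (k :: r) = fun y => h (x k) * \1_[set x k] y + S r y); last first.
    by apply/funext => y; rewrite /S big_cons.
  have [t bt] := bS r.
  have bi : bounded_by 1 (\1_[set x k] : T -> R).
    by move=> y; rewrite indicE; case: (_ \in _); rewrite ?normr1 ?normr0.
  rewrite (charge_int_lin m (h (x k)) (measurable_indic (mx k)) bi (mS r) bt) charge_int_indic//.
  by rewrite mulrC.
have [t bt] := bS (enum 'I_K).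
pose g y := h y - S (enum 'I_K) y.
have mg : measurable_fun setT g by exact: measurable_funB.
have bg : bounded_by (s + t) g by move=> y; rewrite (le_trans (ler_normB _ _))// lerD.
have g0 y : ~ Z y -> g y = 0.
  rewrite /Z /= => /contrapT[k _ ->]; rewrite /g /S big_enum/= (bigD1 k)//= indicE mem_set// mulr1.
  rewrite big1 ?addr0 ?subrr// => l lk; rewrite indicE memNset ?mulr0//= => E.
  have [_ dA _] := famA; have : (A l `&` A k) (x l) by split=> //; rewrite -E.
  by rewrite dA.
have ig : charge_int m g = 0.
  by rewrite /charge_int (null_integral mZ Zp mg g0) (null_integral mZ Zn mg g0) subrr.
have -> : charge_int m h = charge_int m (fun y => 1 * S (enum 'I_K) y + g y).
  by congr charge_int; apply/funext => y; rewrite /g mul1r addrC subrK.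
rewrite (charge_int_lin m 1 (mS _) bt mg bg) ig addr0 mul1r intS big_enum.
by apply: eq_bigl.
Qed.

End atoms.

End variation.

Lemma riesz_subtype d (T : measurableType d) (R : realType) (L : set (T -> R)) (SL : stone_lattice L)
    (phi : {v : T -> R | L v} -> R) (r : R) :
  (forall (a : R) v w u, (forall x, sval u x = a * sval v x + sval w x) -> phi u = a * phi v + phi w) ->
  (forall v, (forall x, `|sval v x| <= 1) -> phi v <= r) ->
  exists m : {charge set T -> \bar R}, forall v, charge_int m (sval v) = phi v.
Proof.
move=> lin bnd.
(* The functional lives on a subtype; the default 0 outside the lattice is never evaluated by
   [riesz_representation]. *)
pose Lam f := if pselect (L f) is left Lf then phi (exist _ f Lf) else 0.
have LamE f (Lf : L f) : Lam f = phi (exist _ f Lf).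
  by rewrite /Lam; case: pselect => // Lf'; congr phi; congr exist; exact: Prop_irrelevance.
have Lam_lin (a : R) f g : L f -> L g -> Lam (fun x => a * f x + g x) = a * Lam f + Lam g.
  by move=> Lf Lg; rewrite (LamE _ (stone_lin SL a Lf Lg)) (LamE _ Lf) (LamE _ Lg); exact: lin.
have Lam0 : Lam (fun=> 0) = 0.
  have := Lam_lin (-1) (fun=> 0) (fun=> 0) (stone_0 SL) (stone_0 SL).
  have E0 : (fun _ : T => -1 * 0 + 0 : R) = fun=> 0 by apply/funext => x; rewrite mulr0 addr0.
  by rewrite E0 mulN1r addNr.
have LamZ (a : R) f : L f -> Lam (fun x => a * f x) = a * Lam f.
  move=> Lf; have := Lam_lin a f _ Lf (stone_0 SL); rewrite Lam0 addr0 => <-.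
  by congr Lam; apply/funext => x; rewrite addr0.
have Lam_bound f (s : R) : L f -> bounded_by s f -> `|Lam f| <= r * s.
  move=> Lf bf; have [s0|s0] := ltP 0 s.
    have b1 (a : R) : `|a| = 1 -> a * Lam f <= r * s.
      move=> a1; have Lg : L (fun x => (a / s) * f x) by exact: stone_scale.
      have := bnd (exist _ _ Lg); rewrite -LamE LamZ//= => /(_ _).
      rewrite -ler_pdivrMr// mulrAC; apply=> x.
      by rewrite normrM normf_div a1 (gtr0_norm s0) mul1r mulrC ler_pdivrMr// mul1r.
    rewrite ler_norml; have := b1 1 (normr1 _); have := b1 (-1) (normrN1 _).
    by rewrite mul1r mulN1r; lra.
  have f0 : f = fun=> 0.
    by apply/funext => x; apply/eqP; rewrite -normr_le0; exact: le_trans (bf x) s0.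
  have sge : 0 <= s by exact: le_trans (normr_ge0 _) (bf point).
  have -> : s = 0 by lra.
  by rewrite f0 Lam0 normr0 mulr0.
have [m [mP _]] := riesz_representation SL Lam_lin Lam_bound.
by exists m => -[v Lv]; rewrite /= mP// LamE.
Qed.

(** * The native space and its topology *)

Section native_space.
Context (R : realType) (alpha1 alpha2 : R) (k1 k2 : nat).
Variables (S1 : admissible_system alpha1 k1.+1) (S2 : admissible_system alpha2 k2.+1).
Local Notation n1 := k1.+1.
Local Notation n2 := k2.+1.
Local Notation N := (native S1 S2).
Local Notation predual := (predual R n1 n2).
Implicit Types (f g h : N) (c : coords R n1 n2).

Definition nat_coords f : coords R n1 n2 := coords_of (f : set_type (native_set S1 S2)).
Local Notation crd := nat_coords.

Lemma native_funE f : native_fun f = synth S1 S2 (crd f).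
Proof. by rewrite /native_fun /nat_coords /coords_of; case: cid. Qed.

Lemma native_fun_inj f g : (forall t1 t2, native_fun f t1 t2 = native_fun g t1 t2) -> f = g.
Proof. by move=> E; apply: val_inj; apply/funext => t1; apply/funext => t2; exact: E. Qed.

Lemma native_of c : exists f, native_fun f = synth S1 S2 c.
Proof.
have H : synth S1 S2 c \in native_set S1 S2 by apply/mem_set; exists c.
by exists (exist (fun x => x \in native_set S1 S2) _ H).
Qed.

Lemma synth_eq c c' : eq_coords c c' -> synth S1 S2 c = synth S1 S2 c'.
Proof.
move=> [em em1 em2 ed]; apply/funext => t1; apply/funext => t2.
have cc : comb_coords c 0 c' c'.
  split=> [A mA|n A mA|n A mA|]; first by rewrite mul0r add0r em.
  - by rewrite mul0r add0r em1.
  - by rewrite mul0r add0r em2.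
  - by rewrite scale0r add0r.
by rewrite (synth_comb S1 S2 cc) mul0r add0r.
Qed.

Lemma coords_unique f c : (forall t1 t2, native_fun f t1 t2 = synth S1 S2 c t1 t2) ->
  eq_coords (crd f) c.
Proof. by move=> E; apply: (@synth_inj _ _ _ _ _ S1 S2) => t1 t2; rewrite -E native_funE. Qed.

(** The pointwise linear structure as a relation; [comb_exists] and [native_fun_inj] give existence
    and uniqueness of the combination. *)
Definition is_comb h (a : R) f g :=
  forall t1 t2, native_fun h t1 t2 = a * native_fun f t1 t2 + native_fun g t1 t2.

Lemma comb_exists (a : R) f g : exists h, is_comb h a f g.
Proof.
have [c cP] := comb_coords_exists a (crd f) (crd g); have [h hE] := native_of c.
by exists h => t1 t2; rewrite hE (synth_comb S1 S2 cP) !native_funE.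
Qed.

Lemma coords_comb h (a : R) f g : is_comb h a f g -> comb_coords (crd h) a (crd f) (crd g).
Proof.
move=> E; have [c cP] := comb_coords_exists a (crd f) (crd g).
have [em em1 em2 ed] : eq_coords (crd h) c.
  by apply: coords_unique => t1 t2; rewrite E (synth_comb S1 S2 cP) !native_funE.
have [cm cm1 cm2 cd] := cP.
split=> [A mA|n A mA|n A mA|]; first by rewrite em// cm.
- by rewrite em1// cm1.
- by rewrite em2// cm2.
- by rewrite ed.
Qed.

Lemma duality_comb c (a : R) c1 c2 (v : predual) : comb_coords c a c1 c2 ->
  duality c v = a * duality c1 v + duality c2 v.
Proof.
move=> [cm cm1 cm2 cd]; case: v => [[[v v1] v2] e] /=.
have E1 (m m' m'' : meas1 R) (w : C0 R R) : comb_charge m a m' m'' ->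
    charge_int m (sval w) = a * charge_int m' (sval w) + charge_int m'' (sval w).
  move=> cc; have [s bw] := vanishing_bounded (svalP w).
  exact: (comb_charge_int cc (stone_measurable (stone_lattice_line R) (svalP w)) bw).
have E2 : charge_int (co_m c) (sval v) = a * charge_int (co_m c1) (sval v) + charge_int (co_m c2) (sval v).
  have [s bw] := vanishing_bounded (svalP v).
  exact: (comb_charge_int cm (stone_measurable (stone_lattice_plane R) (svalP v)) bw).
have -> : \sum_(n < n1) charge_int (co_m1 c n) (sval (v1 n)) =
   a * \sum_(n < n1) charge_int (co_m1 c1 n) (sval (v1 n)) + \sum_(n < n1) charge_int (co_m1 c2 n) (sval (v1 n)).
  by rewrite mulr_sumr -big_split/=; apply: eq_bigr => n _; exact: E1.
have -> : \sum_(n < n2) charge_int (co_m2 c n) (sval (v2 n)) =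
   a * \sum_(n < n2) charge_int (co_m2 c1 n) (sval (v2 n)) + \sum_(n < n2) charge_int (co_m2 c2 n) (sval (v2 n)).
  by rewrite mulr_sumr -big_split/=; apply: eq_bigr => n _; exact: E1.
have -> : \sum_(n < n1) \sum_(n' < n2) co_d c n n' * e n n' =
  a * (\sum_(n < n1) \sum_(n' < n2) co_d c1 n n' * e n n') + \sum_(n < n1) \sum_(n' < n2) co_d c2 n n' * e n n'.
  rewrite mulr_sumr -big_split/=; apply: eq_bigr => n _.
  rewrite mulr_sumr -big_split/=; apply: eq_bigr => n' _; by rewrite cd !mxE; ring.
by rewrite E2; ring.
Qed.

Lemma duality_inj c c' : (forall v : predual, duality c v = duality c' v) -> eq_coords c c'.
Proof.
move=> E; have [c0 c0P] := comb_coords_exists (-1) c c'.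
have Z v : duality c0 v = 0 by rewrite (duality_comb v c0P) E mulN1r addNr.
have [cm cm1 cm2 cd] := c0P.
split=> [A mA|n A mA|n A mA|].
- have z : fine (co_m c0 A) = 0.
    apply: (stone_separates (stone_lattice_plane R)) mA => w vw.
    by have := Z (pin0 n1 n2 (exist _ w vw)); rewrite duality_pin0.
  by have := cm _ mA; rewrite z; lra.
- have z : fine (co_m1 c0 n A) = 0.
    apply: (stone_separates (stone_lattice_line R)) mA => w vw.
    by have := Z (pin1 n2 (C0_at n (exist _ w vw))); rewrite duality_pin1.
  by have := cm1 n _ mA; rewrite z; lra.
- have z : fine (co_m2 c0 n A) = 0.
    apply: (stone_separates (stone_lattice_line R)) mA => w vw.
    by have := Z (pin2 n1 (C0_at n (exist _ w vw))); rewrite duality_pin2.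
  by have := cm2 n _ mA; rewrite z; lra.
- apply/matrixP => n n'; have := Z (pin3 (delta_mx n n')); rewrite duality_pin3 cd !mxE.
  by lra.
Qed.

(** Riesz is applied to each component on its own. The matrix components need no bound, their values
    on [delta_mx] being the entries of [co_d]. *)
Lemma functional_repr (phi : predual -> R) (r : R) : plinear phi ->
  (forall v, punit v -> phi v <= r) -> exists c, duality c = phi.
Proof.
move=> lphi bphi.
have eqphi (x y : predual) : x = y -> phi x = phi y by move=> ->.
have [m mP] : exists m : meas2 R, forall v : C0 R (R * R)%type, charge_int m (sval v) = phi (pin0 n1 n2 v).
  apply: (riesz_subtype (stone_lattice_plane R) (r := r)) => [a v w u E|v bv].
    rewrite -lphi; apply: eqphi; apply: predual_eq => //= *; by rewrite ?mulr0 ?addr0 ?scaler0 ?addr0.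
  by apply: bphi; split=> //= *; rewrite normr0.
have /choice[m1 m1P] n : exists m : meas1 R, forall v : C0 R R, charge_int m (sval v) = phi (pin1 n2 (C0_at n v)).
  apply: (riesz_subtype (stone_lattice_line R) (r := r)) => [a v w u E|v bv].
    rewrite -lphi; apply: eqphi; apply: predual_eq => //= *; rewrite ?mulr0 ?addr0 ?scaler0 ?addr0//.
    by rewrite /C0_at; case: ifP => // _; rewrite /= mulr0 addr0.
  by apply: bphi; split=> //= *; rewrite ?normr0// /C0_at; case: ifP => // _; rewrite normr0.
have /choice[m2 m2P] n : exists m : meas1 R, forall v : C0 R R, charge_int m (sval v) = phi (pin2 n1 (C0_at n v)).
  apply: (riesz_subtype (stone_lattice_line R) (r := r)) => [a v w u E|v bv].
    rewrite -lphi; apply: eqphi; apply: predual_eq => //= *; rewrite ?mulr0 ?addr0 ?scaler0 ?addr0//.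
    by rewrite /C0_at; case: ifP => // _; rewrite /= mulr0 addr0.
  by apply: bphi; split=> //= *; rewrite ?normr0// /C0_at; case: ifP => // _; rewrite normr0.
pose c := Build_coords m m1 m2 (\matrix_(n, n') phi (pin3 (delta_mx n n'))).
exists c; apply/funext => v; apply/eqP; rewrite -subr_eq0; apply/eqP; move: v.
apply: (@plinear_eq0 R n1 n2 (fun v => duality c v - phi v)).
- by move=> a x y; rewrite duality_plinear lphi; ring.
- by move=> v; rewrite duality_pin0 mP subrr.
- by move=> n v; rewrite duality_pin1 m1P subrr.
- by move=> n v; rewrite duality_pin2 m2P subrr.
- by move=> n n'; rewrite duality_pin3 mxE subrr.
Qed.

(* [{classic _}] only equips the predual with the choice structure required of the
   index type of a product space. *)
Definition Phi f : prod_topology (fun _ : {classic predual} => R) := duality (crd f).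

Lemma Phi_continuous : continuous Phi.
Proof. exact: initial_continuous. Qed.

Lemma Phi_comb h (a : R) f g v : is_comb h a f g -> Phi h v = a * Phi f v + Phi g v.
Proof. by move=> /coords_comb; exact: duality_comb. Qed.

Lemma Phi_inj f g : (forall v, Phi f v = Phi g v) -> f = g.
Proof.
move=> E; apply: native_fun_inj => t1 t2; rewrite !native_funE.
by rewrite (@synth_eq (crd f) (crd g))//; exact: duality_inj.
Qed.

Definition nball (r s : R) : set N :=
  [set f | seminorm (crd f) <= r /\ forall n n', `|co_d (crd f) n n'| <= s].

(** Each condition on the right is closed and involves finitely many coordinates, so the image is
    closed in the product. That every such functional comes from the native space is where the Riesz
    theorem enters. *)
Lemma Phi_nball (r s : R) : Phi @` nball r s = [set phi | plinear phi /\
  (forall v, punit v -> phi v <= r) /\ forall n n', `|phi (pin3 (delta_mx n n'))| <= s].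
Proof.
apply/seteqP; split.
  move=> _ [f [fr fs] <-]; split; first exact: duality_plinear.
  split=> [v uv|n n']; first exact: le_trans (punit_le _ uv) fr.
  by rewrite /Phi duality_pin3.
move=> phi [lphi [pr ps]]; have [c cE] := functional_repr lphi pr.
have [f fE] := native_of c.
have [em em1 em2 ed] : eq_coords (crd f) c by apply: coords_unique => t1 t2; rewrite fE.
have fphi : Phi f = phi.
  rewrite -cE; apply/funext => v.
  have cc : comb_coords (crd f) 0 c c.
    split=> [A mA|n A mA|n A mA|]; first by rewrite mul0r add0r em.
    - by rewrite mul0r add0r em1.
    - by rewrite mul0r add0r em2.
    - by rewrite scale0r add0r.
  by rewrite /Phi (duality_comb v cc) mul0r add0r.
exists f => //; split.
  by apply: seminorm_le => v uv; have := pr v uv; rewrite -fphi.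
by move=> n n'; have := ps n n'; rewrite -fphi /Phi duality_pin3.
Qed.

End native_space.

Lemma linear_defect_continuous (X : topologicalType) (R : realType) (u v w : X -> R) (a : R) :
  continuous u -> continuous v -> continuous w -> continuous (fun x => u x - (a * v x + w x)).
Proof.
move=> cu cv cw x; apply: cvgB; first exact: cu.
by apply: cvgD; [apply: cvgM; [exact: cvg_cst|exact: cv]|exact: cw].
Qed.

(** * Compactness and closure in an initial topology *)

Section initial_topology_transfer.
Context {S : choiceType} {T : topologicalType} (w : S -> T).
Local Notation X := (initial_topology w).
Implicit Types (A : set X).

Lemma initial_nbhs (x : X) (U : set X) : nbhs x U ->
  exists B : set T, [/\ nbhs (w x) B & forall y : X, B (w y) -> U y].
Proof.
move=> Ux; have [Q [[B oB BQ] Qx] QU] : exists2 Q : set X, open_nbhs x Q & Q `<=` U.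
  by move: Ux; rewrite nbhsE.
exists B; split; first by apply: open_nbhs_nbhs; split=> //; rewrite -BQ in Qx.
by move=> y By; apply: QU; rewrite -BQ.
Qed.

Lemma initial_compact A : compact (w @` A) -> compact A.
Proof.
move=> cA F FF FA.
have FwA : F (fun x => (w @` A) (w x)) by apply: filterS FA => x Ax; exists x.
have [_ [[a Aa <-] cl]] := cA (w @ F) _ FwA.
exists a; split=> // B U FB /initial_nbhs[V [Vw VU]].
have FwB : F (fun x => (w @` B) (w x)) by apply: filterS FB => x Bx; exists x.
have [_ [[b Bb <-] Vb]] := cl _ _ FwB Vw.
by exists b; split=> //; exact: VU.
Qed.

Lemma initial_closure A : closure A = w @^-1` closure (w @` A).
Proof.
apply/seteqP; split=> x.
  move=> clx V Vx; have cw : continuous (w : X -> T) by exact: initial_continuous.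
  have [y [Ay Vy]] := clx _ (cw x V Vx).
  by exists (w y); split=> //; exists y.
move=> clx U /initial_nbhs[V [Vx VU]].
have [_ [[y Ay <-] Vy]] := clx V Vx.
by exists y; split=> //; exact: VU.
Qed.

End initial_topology_transfer.

Section native_compactness.
Context (R : realType) (alpha1 alpha2 : R) (k1 k2 : nat).
Variables (S1 : admissible_system alpha1 k1.+1) (S2 : admissible_system alpha2 k2.+1).
Local Notation n1 := k1.+1.
Local Notation n2 := k2.+1.
Local Notation N := (native S1 S2).
Local Notation predual := (predual R n1 n2).
Local Notation W := (prod_topology (fun _ : {classic predual} => R)).
Local Notation crd := (@nat_coords R alpha1 alpha2 k1 k2 S1 S2).
Local Notation Phi := (@Phi R alpha1 alpha2 k1 k2 S1 S2).
Implicit Types (f g h : N).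

Lemma eval_continuous (v : predual) : continuous (fun phi : W => phi v).
Proof. exact: (@prod_eval_continuous R {classic predual} v). Qed.

Lemma Phi_eval_continuous (v : predual) : continuous (fun f : N => Phi f v).
Proof.
move=> f; apply: (@continuous_comp _ _ _ Phi (fun phi : W => phi v)); first exact: Phi_continuous.
exact: eval_continuous.
Qed.

Lemma duality_bounded (r s : R) (v : predual) :
  exists b : R, forall f, nball r s f -> `|Phi f v| <= b.
Proof.
case: v => [[[v v1] v2] e].
have [t bv] := vanishing_bounded (svalP v).
have /choice[t1 bv1] n := vanishing_bounded (svalP (v1 n)).
have /choice[t2 bv2] n := vanishing_bounded (svalP (v2 n)).
exists (`|t| * `|r| + \sum_n `|t1 n| * `|r| + \sum_n `|t2 n| * `|r| + \sum_n \sum_n' `|s| * `|e n n'|).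
move=> f [fr fs]; rewrite /Phi/=; have [h0 h1 h2 _] := tv_le_seminorm (crd f).
have nt := tv_norm_ge0.
have L1 (m : meas1 R) (u : C0 R R) (q : R) : (forall x, `|sval u x| <= q) -> tv_norm m <= seminorm (crd f) ->
    `|charge_int m (sval u)| <= `|q| * `|r|.
  move=> bu mr; have := charge_int_le m (stone_measurable (stone_lattice_line R) (svalP u)) bu.
  move=> /le_trans; apply; have q0 : 0 <= q by exact: le_trans (normr_ge0 _) (bu 0).
  by rewrite (ger0_norm q0) ler_wpM2l// (le_trans mr)// (le_trans fr)// ler_norm.
apply: (le_trans (ler_normD _ _)); apply: lerD.
  apply: (le_trans (ler_normD _ _)); apply: lerD.
    apply: (le_trans (ler_normD _ _)); apply: lerD.
      have := charge_int_le (co_m (crd f)) (stone_measurable (stone_lattice_plane R) (svalP v)) bv.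
      move=> /le_trans; apply; have q0 : 0 <= t by exact: le_trans (normr_ge0 _) (bv 0).
      by rewrite (ger0_norm q0) ler_wpM2l// (le_trans h0)// (le_trans fr)// ler_norm.
    apply: (le_trans (ler_norm_sum _ _ _)); apply: ler_sum => n _; exact: L1.
  apply: (le_trans (ler_norm_sum _ _ _)); apply: ler_sum => n _; exact: L1.
apply: (le_trans (ler_norm_sum _ _ _)); apply: ler_sum => n _.
apply: (le_trans (ler_norm_sum _ _ _)); apply: ler_sum => n' _.
by rewrite normrM ler_wpM2r// (le_trans (fs _ _))// ler_norm.
Qed.

Lemma nball_compact (r s : R) : compact (nball r s : set N).
Proof.
apply: initial_compact.
have /choice[b bP] v := duality_bounded r s v.
have cbox : compact [set phi : W | forall v, `[- b v, b v]%classic (phi v)].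
  by apply: (@tychonoff {classic predual} (fun=> R) (fun v => `[- b v, b v]%classic)) => v; exact: segment_compact.
apply: (subclosed_compact _ cbox); last first.
  move=> _ [f Bf <-] v; rewrite /= in_itv/= -ler_norml; exact: bP.
rewrite -[X in closed X]/(Phi @` (nball r s : set N)) (Phi_nball S1 S2 r s).
rewrite (_ : [set _ | _] =
  (\bigcap_(i : R * predual * predual) [set phi : W | phi (pcomb i.1.1 i.1.2 i.2) - (i.1.1 * phi i.1.2 + phi i.2) = 0])
  `&` (\bigcap_(v in [set v | punit v]) [set phi : W | phi v <= r])
  `&` (\bigcap_(i : 'I_n1 * 'I_n2) [set phi : W | - s <= phi (pin3 (delta_mx i.1 i.2)) <= s])); last first.
  apply/seteqP; split=> phi.
    move=> [lphi [pr ps]]; split; [split|].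
    - by move=> [[a v] w] _ /=; rewrite lphi subrr.
    - by move=> v uv; exact: pr.
    - by move=> [n n'] _; rewrite /= -ler_norml; exact: ps.
  move=> [[lphi pr] ps]; split.
    by move=> a v w; apply/eqP; rewrite -subr_eq0; apply/eqP; exact: (lphi (a, v, w) I).
  split=> [v uv|n n']; first exact: pr.
  by have := ps (n, n') I; rewrite /= -ler_norml.
apply: closedI; [apply: closedI|].
- apply: closed_bigI => -[[a v] w] _ /=.
  apply: (@closed_level W R (fun phi => phi (pcomb a v w) - (a * phi v + phi w)) [set 0]).
    exact: (@linear_defect_continuous W R (fun phi => phi (pcomb a v w)) (fun phi => phi v) (fun phi => phi w) a
      (@eval_continuous (pcomb a v w)) (@eval_continuous v) (@eval_continuous w)).
  exact: closed_eq.
- apply: closed_bigI => v _.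
  apply: (@closed_level W R (fun phi => phi v) [set x | x <= r]); first exact: eval_continuous.
  exact: closed_le.
- apply: closed_bigI => -[n n'] _ /=.
  apply: (@closed_level W R (fun phi => phi (pin3 (delta_mx n n'))) [set x | - s <= x <= s]); first exact: eval_continuous.
  rewrite (_ : [set x | _] = `[- s, s]%classic); first exact: itv_closed.
  by apply/seteqP; split=> x; rewrite /= in_itv.
Qed.

(** By duality the seminorm is a supremum of weak* continuous functionals. *)
Lemma seminorm_level_closed (r : R) : closed [set f : N | seminorm (crd f) <= r].
Proof.
rewrite (_ : [set _ | _] = \bigcap_(v in [set v | punit v]) [set f : N | Phi f v <= r]).
  apply: closed_bigI => v _.
  apply: (@closed_level N R (fun f => Phi f v) [set x | x <= r]); first exact: Phi_eval_continuous.
  exact: closed_le.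
apply/seteqP; split=> f /=.
  by move=> fr v uv; exact: le_trans (punit_le _ uv) fr.
by move=> H; apply: seminorm_le => v uv; exact: H.
Qed.

Lemma seminorm_comb h (a : R) f g : is_comb h a f g ->
  seminorm (crd h) <= `|a| * seminorm (crd f) + seminorm (crd g).
Proof.
move=> /coords_comb[cm cm1 cm2 _]; rewrite /seminorm.
have S0 := comb_charge_tv cm.
have T1 : \sum_n tv_norm (co_m1 (crd h) n) <=
    `|a| * \sum_n tv_norm (co_m1 (crd f) n) + \sum_n tv_norm (co_m1 (crd g) n).
  rewrite mulr_sumr -big_split/=; apply: ler_sum => n _; exact: comb_charge_tv.
have T2 : \sum_n tv_norm (co_m2 (crd h) n) <=
    `|a| * \sum_n tv_norm (co_m2 (crd f) n) + \sum_n tv_norm (co_m2 (crd g) n).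
  rewrite mulr_sumr -big_split/=; apply: ler_sum => n _; exact: comb_charge_tv.
by rewrite !mulrDr; lra.
Qed.

End native_compactness.

(** * Convex combinations and extreme points in the native space *)

Section native_sums.
Context (R : realType) (alpha1 alpha2 : R) (k1 k2 M : nat).
Variables (S1 : admissible_system alpha1 k1.+1) (S2 : admissible_system alpha2 k2.+1).
Local Notation n1 := k1.+1.
Local Notation n2 := k2.+1.
Local Notation N := (native S1 S2).
Local Notation predual := (predual R n1 n2).
Local Notation W := (prod_topology (fun _ : {classic predual} => R)).
Local Notation crd := (@nat_coords R alpha1 alpha2 k1 k2 S1 S2).
Local Notation Phi := (@Phi R alpha1 alpha2 k1 k2 S1 S2).
Implicit Types (f g h : N).
Variable nu : N -> 'rV[R]_M.
Hypothesis nu_linear : native_linear nu.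

(** Obtained as [f - f] from an arbitrary element; it is the base case for finite sums. *)
Lemma native_0 : exists z : N, [/\ forall t1 t2, native_fun z t1 t2 = 0, nu z = 0,
  forall v, Phi z v = 0, seminorm (crd z) = 0 &
  [/\ zero_charge (co_m (crd z)), forall n, zero_charge (co_m1 (crd z) n),
    forall n, zero_charge (co_m2 (crd z) n) & co_d (crd z) = 0]].
Proof.
have [f _] : exists f : N, True.
  have [c _] : exists c : coords R n1 n2, True.
    by exists (Build_coords (@czero _ _ R) (fun=> @czero _ _ R) (fun=> @czero _ _ R) 0).
  by have [f _] := native_of S1 S2 c; exists f.
have [z zP] := comb_exists (-1) f f.
have z0 t1 t2 : native_fun z t1 t2 = 0 by rewrite zP mulN1r addNr.
have [cm cm1 cm2 cd] := coords_comb zP.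
exists z; split=> //.
- by rewrite (nu_linear zP) scaleN1r addNr.
- by move=> v; rewrite (Phi_comb v zP) mulN1r addNr.
- have zc : is_comb z 0 z z by move=> t1 t2; rewrite !z0 mul0r addr0.
  have zc2 : is_comb z (-1) z z by move=> t1 t2; rewrite !z0 mulr0 addr0.
  have m0 d (T : measurableType d) (m m' : {charge set T -> \bar R}) : comb_charge m (-1) m' m' -> tv_norm m = 0.
    move=> mP; apply/eqP; rewrite eq_le tv_norm_ge0 andbT.
    have : comb_charge m 0 m m by move=> A mA; rewrite mul0r add0r.
    have /comb_charge_tv : comb_charge m (-1) m m by move=> A mA; rewrite !mP//; ring.
    have mm : diff_of m (@mzero _ T R) (@mzero _ T R).
      by move=> A mA; rewrite mP// /mzero/= subrr; ring.
    by have := tv_norm_le_diff mm; rewrite /mzero/= addr0.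
  rewrite /seminorm (m0 _ _ _ _ cm) !big1 ?addr0// => n _; [exact: m0 (cm2 n)|exact: m0 (cm1 n)].
- split=> [A mA|n A mA|n A mA|]; first by rewrite cm// mulN1r addNr.
  + by rewrite cm1// mulN1r addNr.
  + by rewrite cm2// mulN1r addNr.
  + by rewrite cd scaleN1r addNr.
Qed.

(** One witness carries every aspect of a linear combination: the function, its image under [nu],
    the functional, the seminorm and the coordinates. *)
Lemma native_sum (I : Type) (r : seq I) (w : I -> R) (g : I -> N) : exists h : N,
  [/\ forall t1 t2, native_fun h t1 t2 = \sum_(i <- r) w i * native_fun (g i) t1 t2,
   nu h = \sum_(i <- r) w i *: nu (g i),
   forall v, Phi h v = \sum_(i <- r) w i * Phi (g i) v,
   seminorm (crd h) <= \sum_(i <- r) `|w i| * seminorm (crd (g i)) &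
  [/\ forall A, measurable A -> fine (co_m (crd h) A) = \sum_(i <- r) w i * fine (co_m (crd (g i)) A),
   forall n A, measurable A -> fine (co_m1 (crd h) n A) = \sum_(i <- r) w i * fine (co_m1 (crd (g i)) n A),
   forall n A, measurable A -> fine (co_m2 (crd h) n A) = \sum_(i <- r) w i * fine (co_m2 (crd (g i)) n A) &
   co_d (crd h) = \sum_(i <- r) w i *: co_d (crd (g i))]].
Proof.
elim: r => [|i r [h [h0 hnu hPhi hs [hm hm1 hm2 hd]]]].
  have [z [z0 znu zPhi zs [zm zm1 zm2 zd]]] := native_0.
  exists z; split=> [t1 t2||v||]; rewrite ?big_nil ?zs//.
  split=> [A mA|n A mA|n A mA|]; rewrite ?big_nil//; [exact: zm|exact: zm1|exact: zm2].
have [h' h'P] := comb_exists (w i) (g i) h.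
have [cm cm1 cm2 cd] := coords_comb h'P.
exists h'; split=> [t1 t2||v||].
- by rewrite big_cons -h0 h'P.
- by rewrite big_cons -hnu (nu_linear h'P).
- by rewrite big_cons -hPhi (Phi_comb v h'P).
- by rewrite big_cons (le_trans (seminorm_comb h'P))// lerD2l.
- split=> [A mA|n A mA|n A mA|]; rewrite big_cons.
  + by rewrite -hm// cm.
  + by rewrite -hm1// cm1.
  + by rewrite -hm2// cm2.
  + by rewrite -hd cd.
Qed.

Lemma native_conv (s : R) f g : exists h : N,
  [/\ forall t1 t2, native_fun h t1 t2 = s * native_fun f t1 t2 + (1 - s) * native_fun g t1 t2,
   nu h = s *: nu f + (1 - s) *: nu g,
   forall v, Phi h v = s * Phi f v + (1 - s) * Phi g v &
   0 <= s <= 1 -> seminorm (crd h) <= s * seminorm (crd f) + (1 - s) * seminorm (crd g)].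
Proof.
have [h [h0 hnu hPhi hs _]] := native_sum (index_enum 'I_2)
  (fun i => if i == 0 then s else 1 - s) (fun i => if i == 0 then f else g).
exists h; split=> [t1 t2||v|/andP[s0 s1]].
- by rewrite h0 !big_ord_recl big_ord0 /= addr0.
- by rewrite hnu !big_ord_recl big_ord0 /= addr0.
- by rewrite hPhi !big_ord_recl big_ord0 /= addr0.
- move: hs; rewrite !big_ord_recl big_ord0 /= addr0.
  by rewrite !ger0_norm// subr_ge0.
Qed.

Lemma convex_hull_sum (A : set N) f : convex_hull A f -> exists (k : nat) (w : 'I_k -> R) (g : 'I_k -> N),
  [/\ forall i, 0 <= w i, \sum_i w i = 1, forall i, A (g i) & forall v, Phi f v = \sum_i w i * Phi (g i) v].
Proof.
move=> [k [w [g [w0 w1 Ag fE]]]]; exists k, w, g; split=> // v.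
have [h [h0 _ hPhi _ _]] := native_sum (index_enum 'I_k) w g.
by rewrite -hPhi; congr (Phi _ v); apply: native_fun_inj => t1 t2; rewrite fE h0.
Qed.

Lemma Phi_convex_hull (A : set N) : Phi @` convex_hull A = hull (Phi @` A : set W).
Proof.
apply/seteqP; split.
  move=> _ [f /convex_hull_sum[k [w [g [w0 w1 Ag fE]]]] <-].
  exists k, w, (Phi \o g); split=> // [i|]; first by exists (g i).
  by apply/funext => v; rewrite fE.
move=> phi [k [w [psi [w0 w1 Apsi ->]]]].
have /choice[g gP] i : exists g : N, A g /\ Phi g = psi i by have [g ? ?] := Apsi i; exists g.
have [h [h0 _ hPhi _ _]] := native_sum (index_enum 'I_k) w g.
exists h; last by apply/funext => v; rewrite hPhi; apply: eq_bigr => i _; rewrite (gP i).2.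
by exists k, w, g; split=> // i; exact: (gP i).1.
Qed.

Lemma Phi_extreme (V : set N) : Phi @` extreme_points V = extreme_in (Phi @` V : set W).
Proof.
apply/seteqP; split.
  move=> _ [f [Vf ext] <-]; split; first by exists f.
  move=> _ _ s [g Vg <-] [h Vh <-] s01 E.
  have [f' [f'0 _ f'Phi _]] := native_conv s g h.
  have [|-> ->//] := ext g h s Vg Vh s01.
  suff -> : f = f' by [].
  by apply: Phi_inj => v; rewrite f'Phi E.
move=> _ [[f Vf <-] ext]; exists f => //; split=> // g h s Vg Vh s01 E.
have [f' [f'0 _ f'Phi _]] := native_conv s g h.
have ff' : f = f' by apply: native_fun_inj => t1 t2; rewrite f'0 E.
have PE : Phi f = (fun v => s * Phi g v + (1 - s) * Phi h v).
  by rewrite ff'; apply/funext => v; rewrite f'Phi.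
have [gf hf] := ext (Phi g) (Phi h) s (imageP Phi Vg) (imageP Phi Vh) s01 PE.
by split; apply: Phi_inj => v; [rewrite gf|rewrite hf].
Qed.

(** [Phi] is injective and compatible with convex combinations, and the topology is initial for it,
    so hulls, extreme points and closures all transfer. *)
Lemma native_krein_milman (V : set N) : compact V -> convex_hull V `<=` V ->
  V = closure (convex_hull (extreme_points V)).
Proof.
move=> cV hV.
have cPV : compact (Phi @` V : set W).
  by apply: continuous_compact => //; apply: continuous_subspaceT; exact: Phi_continuous.
have hPV : hull (Phi @` V : set W) `<=` Phi @` V.
  by rewrite -Phi_convex_hull => _ [f /hV Vf <-]; exists f.
have KM := krein_milman cPV hPV.
rewrite (@initial_closure _ W Phi) (Phi_convex_hull (extreme_points V)) Phi_extreme -KM.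
apply/seteqP; split=> f; first by exists f.
by move=> [g Vg E]; rewrite -(@Phi_inj _ _ _ _ _ S1 S2 g f)// => v; rewrite E.
Qed.

End native_sums.

(** * Dependent and independent families of row vectors *)

Section finite_families.
Context (R : realType) (I : finType) (M : nat) (g : I -> 'rV[R]_M).
Implicit Types (w : I -> R).

Let T : 'M[R]_(#|I|, M) := \matrix_k g (enum_val k).
Let vec w : 'rV[R]_#|I| := \row_k w (enum_val k).

Let vec_mul w : vec w *m T = \sum_i w i *: g i.
Proof.
rewrite mulmx_sum_row (eq_bigr (fun k => w (enum_val k) *: g (enum_val k))).
  by rewrite -(big_enum_val (fun i => w i *: g i)).
by move=> k _; rewrite rowK mxE.
Qed.

Let vecE w i : vec w 0 (enum_rank i) = w i.
Proof. by rewrite mxE enum_rankK. Qed.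

Let vec_onto (x : 'rV[R]_#|I|) : x = vec (fun i => x 0 (enum_rank i)).
Proof. by apply/rowP => k; rewrite mxE enum_valK. Qed.

Lemma dependent_family : (M < #|I|)%N ->
  exists w, \sum_i w i *: g i = 0 /\ exists i, w i != 0.
Proof.
move=> MI; have : kermx T != 0.
  by rewrite kermx_eq0; apply/negP => /eqP rT; have := rank_leq_col T; rewrite rT leqNgt MI.
move=> /matrix0Pn[i [j ij]]; pose x := row i (kermx T).
exists (fun i => x 0 (enum_rank i)); split.
  by rewrite -vec_mul -vec_onto -row_mul mulmx_ker row0.
by exists (enum_val j); rewrite enum_valK mxE.
Qed.

Lemma independent_family_bound :
  (forall w, \sum_i w i *: g i = 0 -> forall i, w i = 0) ->
  exists C : R, forall w i, `|w i| <= `|\sum_i w i *: g i| * C.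
Proof.
move=> indep.
have fT : row_free T.
  apply: inj_row_free => x; rewrite (vec_onto x) vec_mul => /indep x0.
  by apply/rowP => k; rewrite !mxE x0.
(* Independence makes the matrix of the family row free, so its pseudo-inverse recovers the weights
   from their combination. *)
exists (\sum_k \sum_j `|pinvmx T k j|) => w i.
rewrite -vec_mul -{1}(vecE w i) -{1}[vec w](mulmxKp fT) mxE.
apply: (le_trans (ler_norm_sum _ _ _)); rewrite mulr_sumr; apply: ler_sum => k _.
rewrite normrM; apply: ler_pM => //.
  rewrite [leRHS]mx_normrE; exact: (le_bigmax _ (fun ij => `|(vec w *m T) ij.1 ij.2|) (0, k)).
by rewrite (bigD1 (enum_rank i))//= lerDl sumr_ge0.
Qed.

End finite_families.

(** * Minimizers *)

Section minimizers.
Context (R : realType) (alpha1 alpha2 : R) (k1 k2 M : nat).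
Variables (S1 : admissible_system alpha1 k1.+1) (S2 : admissible_system alpha2 k2.+1).
Local Notation n1 := k1.+1.
Local Notation n2 := k2.+1.
Local Notation N := (native S1 S2).
Local Notation crd := (@nat_coords R alpha1 alpha2 k1 k2 S1 S2).
Implicit Types (f g h : N).
Variable nu : N -> 'rV[R]_M.
Hypothesis nu_linear : native_linear nu.
Hypothesis nu_continuous : continuous nu.
Hypothesis nu_injective : set_inj (null_tensor (S1 := S1) (S2 := S2)) nu.

Lemma null_tensor_exists (d : 'M[R]_(n1, n2)) : exists q : N,
  [/\ null_tensor q, zero_charge (co_m (crd q)), forall n, zero_charge (co_m1 (crd q) n),
    forall n, zero_charge (co_m2 (crd q) n) & co_d (crd q) = d].
Proof.
pose c := Build_coords (@czero _ _ R : meas2 R) (fun=> @czero _ _ R : meas1 R) (fun=> @czero _ _ R : meas1 R) d.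
have [q qE] := native_of S1 S2 c; exists q.
have cint0 e (T : measurableType e) (h : T -> R) (s : R) : measurable_fun setT h -> bounded_by s h ->
    charge_int (@czero _ T R) h = 0.
  by apply: zero_charge_int => A mA.
have [em em1 em2 ed] : eq_coords (crd q) c by apply: coords_unique => t1 t2; rewrite qE.
split=> [|A mA|n A mA|n A mA|//].
- exists d => t1 t2; rewrite qE /synth.
  have [mK [s Ks]] := kernel_product_section S1 S2 t1 t2.
  have [mK1 [s1 Ks1]] := kernel_section S1 t1; have [mK2 [s2 Ks2]] := kernel_section S2 t2.
  rewrite (cint0 _ _ _ _ mK Ks) add0r [X in X + _ + _]big1 => [|n _]; last first.
    have -> : charge_int (co_m1 c n) (kernel_phi S2 t2) = 0 by exact: (cint0 _ (measurableTypeR R) _ _ mK2 Ks2).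
    by rewrite mulr0.
  rewrite add0r [X in X + _]big1 ?add0r// => n _.
  have -> : charge_int (co_m2 c n) (kernel_phi S1 t1) = 0 by exact: (cint0 _ (measurableTypeR R) _ _ mK1 Ks1).
  by rewrite mul0r.
- by rewrite em.
- by rewrite em1.
- by rewrite em2.
Qed.

(** By injectivity the images under [nu] of the elementary null tensors are independent, which
    bounds the coefficients of a null tensor by its image. *)
Lemma null_tensor_bound : exists C : R, forall q, zero_charge (co_m (crd q)) ->
  (forall n, zero_charge (co_m1 (crd q) n)) -> (forall n, zero_charge (co_m2 (crd q) n)) ->
  forall n n', `|co_d (crd q) n n'| <= `|nu q| * C.
Proof.
have /choice[Q QP] (i : 'I_n1 * 'I_n2) := null_tensor_exists (delta_mx i.1 i.2).
have dsum (w : 'I_n1 * 'I_n2 -> R) n n' : (\sum_i w i *: co_d (crd (Q i))) n n' = w (n, n').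
  rewrite summxE (bigD1 (n, n'))//= big1 => [|i ni].
    by have [_ _ _ _ ->] := QP (n, n'); rewrite !mxE !eqxx mulr1 addr0.
  have [_ _ _ _ ->] := QP i; rewrite !mxE.
  case: eqVneq => [E1|]; case: eqVneq => [E2|]; rewrite ?mulr0//.
  by case/eqP: ni; rewrite E1 E2; case: i {E1 E2}.
have qsum (w : 'I_n1 * 'I_n2 -> R) q : zero_charge (co_m (crd q)) ->
    (forall n, zero_charge (co_m1 (crd q) n)) -> (forall n, zero_charge (co_m2 (crd q) n)) ->
    (forall n n', co_d (crd q) n n' = w (n, n')) -> nu q = \sum_i w i *: nu (Q i).
  move=> z z1 z2 qd; have [h [h0 hnu _ _ [hm hm1 hm2 hd]]] := native_sum nu_linear (index_enum _) w Q.
  rewrite -hnu; congr nu; apply: native_fun_inj => t1 t2; rewrite !native_funE.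
  rewrite (@synth_eq _ _ _ _ _ S1 S2 (crd q) (crd h))//; split=> [A mA|n A mA|n A mA|].
  - by rewrite z// hm// big1// => i _; have [_ zi _ _ _] := QP i; rewrite zi ?mulr0.
  - by rewrite z1// hm1// big1// => i _; have [_ _ zi _ _] := QP i; rewrite zi ?mulr0.
  - by rewrite z2// hm2// big1// => i _; have [_ _ _ zi _] := QP i; rewrite zi ?mulr0.
  - by apply/matrixP => n n'; rewrite qd hd dsum.
have [|C CP] := @independent_family_bound R ('I_n1 * 'I_n2)%type M (fun i => nu (Q i)).
  move=> w w0 [n n'].
  have [q [nq z z1 z2 qd]] := null_tensor_exists (\matrix_(n, n') w (n, n')).
  have [q0 [no zo zo1 zo2 od]] := null_tensor_exists 0.
  have qo : q = q0.
    apply: nu_injective; rewrite ?inE//.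
    rewrite (qsum w q)//; last by move=> *; rewrite qd mxE.
    rewrite w0 (qsum (fun=> 0) q0)//; last by move=> *; rewrite od mxE.
    by rewrite big1// => i _; rewrite scale0r.
  by have := congr1 (fun x : 'M[R]_(n1, n2) => x n n') qd; rewrite qo od !mxE => <-.
exists C => q z z1 z2 n n'.
have := CP (fun i => co_d (crd q) i.1 i.2) (n, n').
by rewrite -(qsum _ q).
Qed.

(** Write [f] as [f0 + q], where [f0] has the same measures and zero matrix. [f0] lies in a fixed
    compact ball, on which [nu] is bounded by continuity; thus [nu q] is bounded, and
    [null_tensor_bound] controls the matrix. *)
Lemma sublevel_in_ball (r B : R) : exists s : R, forall f, seminorm (crd f) <= r ->
  `|nu f| <= B -> nball r s f.
Proof.
have [C CP] := null_tensor_bound.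
have cb : compact (nu @` (nball r 0 : set N)).
  apply: continuous_compact; last exact: nball_compact.
  by apply: continuous_subspaceT; exact: nu_continuous.
have [B1 [_ BP]] := compact_bounded cb.
exists ((B + (`|B1| + 1)) * `|C|) => f fr fB; split=> // n n'.
pose c := Build_coords (co_m (crd f)) (co_m1 (crd f)) (co_m2 (crd f)) 0.
have [f0 f0E] := native_of S1 S2 c.
have e0 : eq_coords (crd f0) c by apply: coords_unique => t1 t2; rewrite f0E.
have [em em1 em2 ed] := e0.
have f0r : nball r 0 f0.
  split; last by move=> i j; rewrite ed mxE normr0.
  rewrite /seminorm (eq_charge_tv em) (eq_bigr (fun n => tv_norm (co_m1 (crd f) n))).
    rewrite [X in _ + X <= _](eq_bigr (fun n => tv_norm (co_m2 (crd f) n)))// => i _.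
    exact: eq_charge_tv (em2 i).
  by move=> i _; exact: eq_charge_tv (em1 i).
have [q qP] := comb_exists (-1) f0 f.
have [cm cm1 cm2 cd] := coords_comb qP.
have nuf0 : `|nu f0| <= `|B1| + 1.
  by apply: (BP (`|B1| + 1)); [rewrite (le_lt_trans (ler_norm B1))// ltrDl|exists f0].
have -> : co_d (crd f) n n' = co_d (crd q) n n' by rewrite cd ed scaler0 add0r.
apply: (le_trans (CP q _ _ _ n n')).
- by move=> A mA; rewrite cm// em// mulN1r addNr.
- by move=> i A mA; rewrite cm1// em1// mulN1r addNr.
- by move=> i A mA; rewrite cm2// em2// mulN1r addNr.
apply: (le_trans (ler_wpM2l _ (ler_norm C))) => //.
rewrite ler_wpM2r// (nu_linear qP) scaleN1r addrC (le_trans (ler_normB _ _))//.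
by rewrite lerD.
Qed.

Variables (F : 'rV[R]_M -> \bar R) (lambda : R).
Hypothesis nu_surjective : forall z : 'rV[R]_M, exists f, nu f = z.
Hypothesis F_ge0 : forall z, (0 <= F z)%E.
Hypothesis F_proper : proper_fun F.
Hypothesis F_coercive : coercive_fun F.
Hypothesis F_lsc : lower_semicontinuous F.
Hypothesis F_sconvex : strictly_convex_fun F.
Hypothesis lambda_gt0 : 0 < lambda.

Let J f : \bar R := (F (nu f) + (lambda * seminorm (crd f))%:E)%E.

(** If the objective exceeds [a] at [f], the excess is shared between its two terms. Each strict
    inequality persists near [f], by lower semicontinuity of [F] and of the seminorm. *)
Lemma objective_level_closed (a : R) : closed [set f : N | (J f <= a%:E)%E].
Proof.
move=> f clf; rewrite /= leNgt; apply/negP => aJ.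
have [b [c [bF cl abc]]] : exists b c : R, [/\ (b%:E < F (nu f))%E, c < lambda * seminorm (crd f) & a <= b + c].
  move: aJ; rewrite /J; case: (F (nu f)) (F_ge0 (nu f)) => [x _|_ _|//].
    rewrite -EFinD lte_fin => ax.
    exists (x - (x + lambda * seminorm (crd f) - a) / 2).
    exists (lambda * seminorm (crd f) - (x + lambda * seminorm (crd f) - a) / 2).
    by rewrite lte_fin; split; lra.
  (* Where [F] is infinite any real lower bound is available, so the seminorm term can give up 1. *)
  exists (a - (lambda * seminorm (crd f) - 1)), (lambda * seminorm (crd f) - 1).
  by split; [exact: ltry|lra|lra].
have [V Vf VF] := F_lsc bF.
have nV : nbhs f (nu @^-1` V) by exact: nu_continuous Vf.
have nS : nbhs f (~` [set g : N | seminorm (crd g) <= c / lambda]).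
  apply: open_nbhs_nbhs; split; first by apply: closed_openC; exact: seminorm_level_closed.
  by apply/negP; rewrite -ltNge ltr_pdivrMr// mulrC.
have [g [/= Jg [Vg /negP Sg]]] := clf _ (filterI nV nS).
rewrite -ltNge ltr_pdivrMr// mulrC in Sg.
have := VF _ Vg; move: Jg; rewrite /J; case: (F (nu g)) => [x||//]; last by rewrite addye// leye_eq.
by rewrite -EFinD lee_fin lte_fin; lra.
Qed.

Lemma objective_level_compact (a : R) : compact [set f : N | (J f <= a%:E)%E].
Proof.
(* Coercivity yields a large inequality only; the extra 1 makes it contradict the level [a]. *)
have [B BP] := F_coercive (a + 1).
have [s sP] := sublevel_in_ball (a / lambda) B.
apply: (subclosed_compact (@objective_level_closed a) (@nball_compact _ _ _ _ _ S1 S2 (a / lambda) s)).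
move=> f /= Jf.
have [_ _ _ sn0] := tv_le_seminorm (crd f).
have ls : 0 <= lambda * seminorm (crd f) by rewrite mulr_ge0// ltW.
move: Jf; rewrite /J => Jf; apply: sP.
  rewrite ler_pdivlMr// mulrC -lee_fin (le_trans _ Jf)//.
  by rewrite -[leLHS]add0e leeD2r.
rewrite leNgt; apply/negP => /BP aF; have := le_trans (leeD2r (lambda * seminorm (crd f))%:E aF) Jf.
by rewrite -EFinD lee_fin; lra.
Qed.

(** The nonempty sublevel sets below the value at some [f0] form a chain of closed sets inside a
    compact one; a common point lies below every attained value. *)
Lemma minimizer_exists : exists (p : N) (b : R), J p = b%:E /\ forall f, (J p <= J f)%E.
Proof.
have [_ [z0 Fz0]] := F_proper; have [f0 nf0] := nu_surjective z0.
have Jreal f : (J f < +oo)%E -> exists b : R, J f = b%:E.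
  rewrite /J; case: (F (nu f)) (F_ge0 (nu f)) => [x _ _|_|//].
    by exists (x + lambda * seminorm (crd f)).
  by rewrite addye.
have [j0 Jf0] : exists b : R, J f0 = b%:E.
  by apply: Jreal; rewrite /J nf0; apply: lte_add_pinfty => //; rewrite ltry.
pose lev (a : R) := [set f : N | (J f <= a%:E)%E].
have [|||p [Sp Cp]] := @compact_chain N (lev j0) [set A | exists a : R, [/\ a <= j0, (lev a) !=set0 & A = lev a]]
    (@objective_level_compact j0).
- by exists (lev j0), j0; split=> //; exists f0; rewrite /lev/= Jf0.
- move=> _ [a [aj ne ->]]; split=> //; first exact: objective_level_closed.
  by move=> f /= /le_trans; apply; rewrite lee_fin.
- move=> _ _ [a [_ _ ->]] [a' [_ _ ->]]; have [aa|/ltW aa] := leP a a'; [left|right];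
  by move=> f /= /le_trans; apply; rewrite lee_fin.
have [b Jp] : exists b : R, J p = b%:E.
  by apply: Jreal; rewrite (le_lt_trans Sp)// ltry.
exists p, b; split=> // f; have [fj|jf] := leP (J f) j0%:E; last exact: le_trans Sp (ltW jf).
have [a Ja] : exists a : R, J f = a%:E by apply: Jreal; rewrite (le_lt_trans fj)// ltry.
rewrite Ja; apply: (Cp (lev a)); exists a; split=> //; first by rewrite -lee_fin -Ja.
by exists f; rewrite /lev/= Ja.
Qed.

(** This description of the minimizers no longer mentions [F]: convexity and the analysis of extreme
    points use only the constraint [nu f = z0] and the minimality of [sigma] under it. *)
Lemma minimizers_spec : exists (z0 : 'rV[R]_M) (sigma : R),
  [/\ argmin J = [set f | nu f = z0 /\ seminorm (crd f) <= sigma],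
      (argmin J) !=set0, compact (argmin J) &
      forall f, nu f = z0 -> sigma <= seminorm (crd f)].
Proof.
have [p [b [Jp pmin]]] := minimizer_exists.
have Fp : exists a : R, F (nu p) = a%:E.
  move: Jp; rewrite /J; case: (F (nu p)) => [a _|//|//]; by exists a.
have [a Fa] := Fp; have ab : b = a + lambda * seminorm (crd p).
  by move: Jp; rewrite /J Fa -EFinD => -[].
(* If the images differed, the midpoint of [f] and [p] would have a value strictly below the
   minimum. *)
have same f : (J f <= b%:E)%E -> nu f = nu p.
  move=> Jf; apply/eqP/negPn/negP => ne.
  have [c Fc] : exists c : R, F (nu f) = c%:E.
    move: Jf (F_ge0 (nu f)); rewrite /J; case: (F (nu f)) => [c _ _|/= |//]; first by exists c.
    by rewrite leye_eq.
  have cb : c + lambda * seminorm (crd f) <= b by move: Jf; rewrite /J Fc -EFinD lee_fin.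
  have h01 : 0 < (2^-1 : R) < 1 by rewrite invr_gt0 ltr0n invf_lt1 ?ltr1n.
  have [h [_ hnu _ hs]] := native_conv nu_linear 2^-1 f p.
  have := F_sconvex ne (_ : F (nu f) < +oo)%E (_ : F (nu p) < +oo)%E h01.
  rewrite Fc Fa !ltry -hnu => /(_ isT isT) Fh.
  have := pmin h; rewrite Jp /J; move: Fh (F_ge0 (nu h)); rewrite -!EFinM -EFinD.
  case: (F (nu h)) => [x|//|//]; rewrite lte_fin => xl _; rewrite -EFinD lee_fin.
  have /hs : 0 <= (2^-1 : R) <= 1 by case/andP: h01 => /ltW -> /ltW ->.
  move=> sh; have : lambda * seminorm (crd h) <= lambda * (2^-1 * seminorm (crd f) + (1 - 2^-1) * seminorm (crd p)).
    by rewrite ler_wpM2l// ltW.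
  set sf := seminorm (crd f) in cb *; set sp := seminorm (crd p) in ab *; set sh' := lambda * seminorm (crd h).
  lra.
exists (nu p), (seminorm (crd p)).
have VE : argmin J = [set f | (J f <= b%:E)%E].
  apply/seteqP; split=> f /=; first by move=> /(_ p); rewrite Jp.
  by move=> Jf g; rewrite (le_trans Jf)// -Jp; exact: pmin.
split.
- rewrite VE; apply/seteqP; split=> f /=.
    move=> Jf; have nf := same _ Jf; split=> //.
    by move: Jf; rewrite /J nf Fa -EFinD lee_fin ab lerD2l ler_pM2l.
  by move=> [nf sf]; rewrite /J nf Fa -EFinD lee_fin ab lerD2l ler_pM2l.
- by exists p; exact: pmin.
- by rewrite VE; exact: objective_level_compact.
- move=> f nf; have := pmin f; rewrite Jp /J nf Fa -EFinD lee_fin ab lerD2l ler_pM2l//.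
Qed.

End minimizers.

Lemma sum_tagged_single (R : nmodType) (m : nat) (K : 'I_m -> nat) (F : {n & 'I_(K n)} -> R) n :
  (forall p, tag p != n -> F p = 0) ->
  \sum_p F p = \sum_(k < K n) F (Tagged (fun n => 'I_(K n)) k).
Proof.
move=> F0.
transitivity (\sum_(p : {n & 'I_(K n)} | xpredT (tag p) && xpredT (tagged p))
    (fun n0 (k0 : 'I_(K n0)) => F (Tagged (fun n => 'I_(K n)) k0)) (tag p) (tagged p)).
  by apply: eq_bigr => -[].
rewrite -(@sig_big_dep _ _ _ _ _ xpredT (fun=> xpredT) (fun n0 k0 => F (Tagged (fun n => 'I_(K n)) k0)))/=.
rewrite (bigD1 n)//= [X in _ + X]big1 ?addr0// => l ln.
by rewrite big1// => k _; exact: F0.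
Qed.

(** * Extreme points *)

Section extreme_point_form.
Context (R : realType) (alpha1 alpha2 : R) (k1 k2 M : nat).
Variables (S1 : admissible_system alpha1 k1.+1) (S2 : admissible_system alpha2 k2.+1).
Local Notation n1 := k1.+1.
Local Notation n2 := k2.+1.
Local Notation N := (native S1 S2).
Local Notation crd := (@nat_coords R alpha1 alpha2 k1 k2 S1 S2).
Implicit Types (f g h : N).
Variable nu : N -> 'rV[R]_M.
Hypothesis nu_linear : native_linear nu.
Variables (z0 : 'rV[R]_M) (sigma : R) (V : set N).
Hypothesis VE : V = [set f | nu f = z0 /\ seminorm (crd f) <= sigma].
Hypothesis sigma_min : forall f, nu f = z0 -> sigma <= seminorm (crd f).

Lemma restricted_charge d (T : measurableType d) (m : {charge set T -> \bar R}) (A : set T) :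
  measurable A -> exists m' : {charge set T -> \bar R},
    forall B, measurable B -> fine (m' B) = fine (m (B `&` A)).
Proof.
move=> mA; exists (crestr0 m mA) => B mB.
by rewrite /= /crestr0 mem_set// /crestr.
Qed.

Section families.
Variables (f : N) (extf : extreme_points V f).
Variables (K0 : nat) (K1 : 'I_n1 -> nat) (K2 : 'I_n2 -> nat).
Variables (A0 : 'I_K0 -> set (measurableTypeR R * measurableTypeR R))
  (A1 : forall n, 'I_(K1 n) -> set (measurableTypeR R))
  (A2 : forall n, 'I_(K2 n) -> set (measurableTypeR R)).
Hypothesis fam0 : positive_family (co_m (crd f)) A0.
Hypothesis fam1 : forall n, positive_family (co_m1 (crd f) n) (A1 (n := n)).
Hypothesis fam2 : forall n, positive_family (co_m2 (crd f) n) (A2 (n := n)).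

Local Notation I := ('I_K0 + {n : 'I_n1 & 'I_(K1 n)} + {n : 'I_n2 & 'I_(K2 n)} + 'I_n1 * 'I_n2)%type.
Let i0 (k : 'I_K0) : I := inl (inl (inl k)).
Let i1 n (k : 'I_(K1 n)) : I := inl (inl (inr (Tagged (fun n => 'I_(K1 n)) k))).
Let i2 n (k : 'I_(K2 n)) : I := inl (inr (Tagged (fun n => 'I_(K2 n)) k)).
Let i3 (p : 'I_n1 * 'I_n2) : I := inr p.

(** Each direction changes a single component: one charge of [f] restricted to one set, or one entry
    of the matrix. The statement gives the coordinates of weighted sums, the form delivered by
    [native_sum]. *)
Lemma directions_exist : exists G : I -> N, forall w : I -> R,
  [/\ forall B, measurable B -> \sum_i w i * fine (co_m (crd (G i)) B) =
        \sum_k w (i0 k) * fine (co_m (crd f) (B `&` A0 k)),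
      forall n B, measurable B -> \sum_i w i * fine (co_m1 (crd (G i)) n B) =
        \sum_k w (@i1 n k) * fine (co_m1 (crd f) n (B `&` @A1 n k)),
      forall n B, measurable B -> \sum_i w i * fine (co_m2 (crd (G i)) n B) =
        \sum_k w (@i2 n k) * fine (co_m2 (crd f) n (B `&` @A2 n k)) &
      forall n n', (\sum_i w i *: co_d (crd (G i))) n n' = w (i3 (n, n'))].
Proof.
have mA0 k : measurable (A0 k) by have [] := fam0.
have mA1 n k : measurable (@A1 n k) by have [] := fam1 n.
have mA2 n k : measurable (@A2 n k) by have [] := fam2 n.
have /choice[r0 r0P] k := restricted_charge (co_m (crd f)) (mA0 k).
have /choice[r1 r1P] (p : {n : 'I_n1 & 'I_(K1 n)}) := restricted_charge (co_m1 (crd f) (tag p)) (mA1 _ (tagged p)).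
have /choice[r2 r2P] (p : {n : 'I_n2 & 'I_(K2 n)}) := restricted_charge (co_m2 (crd f) (tag p)) (mA2 _ (tagged p)).
pose z1 : meas1 R := @czero _ _ R; pose z2 : meas2 R := @czero _ _ R.
pose c (i : I) : coords R n1 n2 := match i with
  | inl (inl (inl k)) => Build_coords (r0 k) (fun=> z1) (fun=> z1) 0
  | inl (inl (inr p)) => Build_coords z2 (fun n => if n == tag p then r1 p else z1) (fun=> z1) 0
  | inl (inr p) => Build_coords z2 (fun=> z1) (fun n => if n == tag p then r2 p else z1) 0
  | inr p => Build_coords z2 (fun=> z1) (fun=> z1) (delta_mx p.1 p.2)
  end.
have /choice[G GP] i : exists g : N, eq_coords (crd g) (c i).
  have [g gE] := native_of S1 S2 (c i); exists g.
  by apply: coords_unique => t1 t2; rewrite gE.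
exists G => w; split=> [B mB|n B mB|n B mB|n n'].
- transitivity (\sum_i w i * fine (co_m (c i) B)).
    by apply: eq_bigr => i _; have [-> //] := GP i.
  rewrite !big_sumType/= [X in _ + X + _ + _]big1 => [|i _]; last by rewrite mulr0.
  rewrite [X in _ + _ + X + _]big1 => [|i _]; last by rewrite mulr0.
  rewrite [X in _ + _ + _ + X]big1 => [|i _]; last by rewrite mulr0.
  by rewrite !addr0; apply: eq_bigr => k _; rewrite r0P.
- transitivity (\sum_i w i * fine (co_m1 (c i) n B)).
    by apply: eq_bigr => i _; have [_ -> //] := GP i.
  rewrite !big_sumType/= [X in X + _ + _ + _]big1 => [|i _]; last by rewrite mulr0.
  rewrite [X in _ + _ + X + _]big1 => [|i _]; last by rewrite mulr0.
  rewrite [X in _ + _ + _ + X]big1 => [|i _]; last by rewrite mulr0.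
  rewrite add0r !addr0 (sum_tagged_single (n := n)) => [|p pn]; last by rewrite eq_sym (negbTE pn) mulr0.
  by apply: eq_bigr => k _; rewrite eqxx r1P.
- transitivity (\sum_i w i * fine (co_m2 (c i) n B)).
    by apply: eq_bigr => i _; have [_ _ -> //] := GP i.
  rewrite !big_sumType/= [X in X + _ + _ + _]big1 => [|i _]; last by rewrite mulr0.
  rewrite [X in _ + X + _ + _]big1 => [|i _]; last by rewrite mulr0.
  rewrite [X in _ + _ + _ + X]big1 => [|i _]; last by rewrite mulr0.
  rewrite !add0r !addr0 (sum_tagged_single (n := n)) => [|p pn]; last by rewrite eq_sym (negbTE pn) mulr0.
  by apply: eq_bigr => k _; rewrite eqxx r2P.
- rewrite summxE (eq_bigr (fun i => w i * co_d (c i) n n')); last first.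
    by move=> i _; have [_ _ _ ->] := GP i; rewrite mxE.
  rewrite !big_sumType/= [X in X + _ + _ + _]big1 => [|i _]; last by rewrite mxE mulr0.
  rewrite [X in _ + X + _ + _]big1 => [|i _]; last by rewrite mxE mulr0.
  rewrite [X in _ + _ + X + _]big1 => [|i _]; last by rewrite mxE mulr0.
  rewrite !add0r (bigD1 (n, n'))//= mxE !eqxx mulr1 big1 ?addr0// => -[l l'] ll.
  rewrite mxE /=; case: eqVneq => [nl|]; case: eqVneq => [nl'|]; rewrite ?mulr0//.
  by rewrite nl nl' eqxx in ll.
Qed.

Lemma family_bound : (K0 + \sum_n K1 n + \sum_n K2 n + n1 * n2 <= M)%N.
Proof.
rewrite leqNgt; apply/negP => lt.
have cardI : #|{: I}| = (K0 + \sum_n K1 n + \sum_n K2 n + n1 * n2)%N.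
  have S k (K : 'I_k -> nat) : #|{: {n : 'I_k & 'I_(K n)}}| = (\sum_n K n)%N.
    rewrite card_tagged sumnE big_map big_enum /=.
    by apply: eq_bigr => n _; rewrite card_ord.
  by rewrite !card_sum card_prod !S !card_ord.
have [G GP] := directions_exist.
have [|w' [w'0 [j w'j]]] := @dependent_family R I M (fun i => nu (G i)); first by rewrite cardI.
(* Normalises the weights to absolute value at most 1, as [tv_perturbation] requires; the added 1
   keeps [t] positive. *)
pose t : R := 1 + \sum_i `|w' i|.
have t0 : 0 < t by rewrite ltr_pwDl// sumr_ge0.
pose w i := w' i / t.
have w1 i : `|w i| <= 1.
  rewrite /w normrM normfV (gtr0_norm t0) ler_pdivrMr// mul1r /t (bigD1 i)//=.
  have : 0 <= \sum_(l | l != i) `|w' l| by exact: sumr_ge0.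
  lra.
have wj : w j != 0 by rewrite mulf_neq0// invr_neq0 ?gt_eqF.
have w0 : \sum_i w i *: nu (G i) = 0.
  have -> : \sum_i w i *: nu (G i) = t^-1 *: \sum_i w' i *: nu (G i).
    by rewrite scaler_sumr; apply: eq_bigr => i _; rewrite scalerA mulrC.
  by rewrite w'0 scaler0.
have [h [_ hnu _ _ [hm hm1 hm2 hd]]] := native_sum nu_linear (index_enum _) w G.
have [Gm Gm1 Gm2 Gd] := GP w.
have nuh : nu h = 0 by rewrite hnu.
have [Vf ext] := extf.
have [nuf sf] : nu f = z0 /\ seminorm (crd f) <= sigma by rewrite VE in Vf.
have sfE : seminorm (crd f) = sigma by apply/eqP; rewrite eq_le sf sigma_min.
(* Moving along [e *: h] changes the seminorm by at most [e * ell]; both signs of [e]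
   and minimality force [ell = 0]. *)
pose ell : R := \sum_k w (i0 k) * fine (variation (co_m (crd f)) (A0 k)) +
  \sum_n \sum_k w (@i1 n k) * fine (variation (co_m1 (crd f) n) (@A1 n k)) +
  \sum_n \sum_k w (@i2 n k) * fine (variation (co_m2 (crd f) n) (@A2 n k)).
have shift (e : R) g : `|e| = 1 -> is_comb g e h f -> nu g = z0 /\ seminorm (crd g) <= sigma + e * ell.
  move=> e1 gP; have [cm cm1 cm2 cd] := coords_comb gP.
  split; first by rewrite (nu_linear gP) nuh scaler0 add0r.
  have ew i : `|e * w i| <= 1 by rewrite normrM e1 mul1r.
  have [mA0 dA0 _] := fam0.
  have T0 : tv_norm (co_m (crd g)) <= tv_norm (co_m (crd f)) +
      \sum_k (e * w (i0 k)) * fine (variation (co_m (crd f)) (A0 k)).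
    apply: tv_perturbation => // B mB; rewrite cm// hm// Gm// mulr_sumr addrC; congr (_ + _).
    by apply: eq_bigr => k _; rewrite mulrA.
  have T1 n : tv_norm (co_m1 (crd g) n) <= tv_norm (co_m1 (crd f) n) +
      \sum_k (e * w (@i1 n k)) * fine (variation (co_m1 (crd f) n) (@A1 n k)).
    have [mA1 dA1 _] := fam1 n.
    apply: tv_perturbation => // B mB; rewrite cm1// hm1// Gm1// mulr_sumr addrC; congr (_ + _).
    by apply: eq_bigr => k _; rewrite mulrA.
  have T2 n : tv_norm (co_m2 (crd g) n) <= tv_norm (co_m2 (crd f) n) +
      \sum_k (e * w (@i2 n k)) * fine (variation (co_m2 (crd f) n) (@A2 n k)).
    have [mA2 dA2 _] := fam2 n.
    apply: tv_perturbation => // B mB; rewrite cm2// hm2// Gm2// mulr_sumr addrC; congr (_ + _).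
    by apply: eq_bigr => k _; rewrite mulrA.
  have pull k (u v : 'I_k -> R) : \sum_l (e * u l) * v l = e * \sum_l u l * v l.
    by rewrite mulr_sumr; apply: eq_bigr => l _; rewrite mulrA.
  have T1s : \sum_n tv_norm (co_m1 (crd g) n) <= \sum_n tv_norm (co_m1 (crd f) n) +
      e * \sum_n \sum_k w (@i1 n k) * fine (variation (co_m1 (crd f) n) (@A1 n k)).
    by rewrite mulr_sumr -big_split/=; apply: ler_sum => n _; rewrite -pull; exact: T1.
  have T2s : \sum_n tv_norm (co_m2 (crd g) n) <= \sum_n tv_norm (co_m2 (crd f) n) +
      e * \sum_n \sum_k w (@i2 n k) * fine (variation (co_m2 (crd f) n) (@A2 n k)).
    by rewrite mulr_sumr -big_split/=; apply: ler_sum => n _; rewrite -pull; exact: T2.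
  rewrite pull in T0; rewrite -sfE /seminorm /ell !mulrDr; lra.
have [fp fpP] := comb_exists 1 h f; have [fm fmP] := comb_exists (-1) h f.
have [nup sp] := shift 1 fp (normr1 _) fpP; have [num sm] := shift (-1) fm (normrN1 _) fmP.
have ell0 : ell = 0 by have := sigma_min nup; have := sigma_min num; lra.
have Vp : V fp by rewrite VE; split=> //; move: sp; rewrite ell0 mulr0 addr0.
have Vm : V fm by rewrite VE; split=> //; move: sm; rewrite ell0 mulr0 addr0.
have h01 : 0 < (2^-1 : R) < 1 by rewrite invr_gt0 ltr0n invf_lt1 ?ltr1n.
(* [f] is the midpoint of [fp] and [fm], so extremality gives [fp = f]. Then all coordinates of [h]
   vanish, and independence of the directions forces [w j = 0]. *)
have [|fpf _] := ext fp fm 2^-1 Vp Vm h01.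
  by move=> t1 t2; rewrite fpP fmP; field.
rewrite fpf in fpP; have [cm cm1 cm2 cd] := coords_comb fpP.
have [mA0 dA0 pA0] := fam0.
case: j {w'j} wj => [[[k|[n k]]|[n k]]|[n n']] /eqP; apply.
- apply: (perturbation_independent mA0 dA0 (e := fun k => w (i0 k)) pA0) => B mB.
  by have := cm B mB; rewrite hm// Gm//; lra.
- have [mA1 dA1 pA1] := fam1 n.
  apply: (perturbation_independent mA1 dA1 (e := fun k => w (@i1 n k)) pA1) => B mB.
  by have := cm1 n B mB; rewrite hm1// Gm1//; lra.
- have [mA2 dA2 pA2] := fam2 n.
  apply: (perturbation_independent mA2 dA2 (e := fun k => w (@i2 n k)) pA2) => B mB.
  by have := cm2 n B mB; rewrite hm2// Gm2//; lra.
- have := congr1 (fun x : 'M[R]_(n1, n2) => x n n') cd; rewrite hd scale1r mxE Gd; lra.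
Qed.

End families.

Lemma maximal_index (P : nat -> Prop) (B : nat) : P 0%N -> (forall K, P K -> (K <= B)%N) ->
  exists K, P K /\ ~ P K.+1.
Proof.
move=> P0 PB; apply: contrapT => /forallNP H.
have PS K : P K -> P K.+1 by move=> PK; apply: contrapT => nP; exact: (H K).
have : P B.+1 by elim: B.+1 => // K; exact: PS.
by move=> /PB; rewrite ltnn.
Qed.

Lemma extreme_point_form f : extreme_points V f ->
  exists (K : nat) (K1 : 'I_n1 -> nat) (K2 : 'I_n2 -> nat) (a x1 x2 : 'I_K -> R)
    (b yk : forall n, 'I_(K1 n) -> R) (c zk : forall n', 'I_(K2 n') -> R) (d : 'I_n1 -> 'I_n2 -> R),
    (K + \sum_(n < n1) K1 n + \sum_(n' < n2) K2 n' + n1 * n2 <= M)%N /\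
    forall t1 t2, native_fun f t1 t2 =
      \sum_(k < K) a k * kernel_phi S1 t1 (x1 k) * kernel_phi S2 t2 (x2 k)
      + \sum_(n < n1) \sum_(m < K1 n) b n m * sys_p S1 n t1 * kernel_phi S2 t2 (yk n m)
      + \sum_(n' < n2) \sum_(m' < K2 n') c n' m' * kernel_phi S1 t1 (zk n' m') * sys_p S2 n' t2
      + \sum_(n < n1) \sum_(n' < n2) d n n' * sys_p S1 n t1 * sys_p S2 n' t2.
Proof.
move=> extf.
have empty e (T : measurableType e) (m : {charge set T -> \bar R}) (A : 'I_0 -> set T) : positive_family m A.
  by split=> [[]|[]|[]].
pose e0 : 'I_0 -> set (measurableTypeR R * measurableTypeR R) := fun=> set0.
pose e1 (n : 'I_n1) : 'I_0 -> set (measurableTypeR R) := fun=> set0.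
pose e2 (n : 'I_n2) : 'I_0 -> set (measurableTypeR R) := fun=> set0.
(* Each charge gets its own maximal family, bounded by applying [family_bound] with all other
   families empty. The joint bound is then applied to all the maximal families at once. *)
have [K [[A famA] maxA]] : exists K, (exists A : 'I_K -> set (measurableTypeR R * measurableTypeR R),
    positive_family (co_m (crd f)) A) /\ ~ exists A : 'I_K.+1 -> set (measurableTypeR R * measurableTypeR R),
    positive_family (co_m (crd f)) A.
  apply: (@maximal_index (fun K => exists A : 'I_K -> set (measurableTypeR R * measurableTypeR R), positive_family _ A) M).
    by exists e0.
  move=> K [A famA]; have := family_bound extf famA (fun n => empty _ _ _ (e1 n)) (fun n => empty _ _ _ (e2 n)).
  by apply: leq_trans; rewrite -!addnA leq_addr.
have /choice[K1 K1P] (n : 'I_n1) : exists K, (exists A : 'I_K -> set (measurableTypeR R),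
    positive_family (co_m1 (crd f) n) A) /\ ~ exists A : 'I_K.+1 -> set (measurableTypeR R),
    positive_family (co_m1 (crd f) n) A.
  apply: (@maximal_index (fun K => exists A : 'I_K -> set (measurableTypeR R), positive_family _ A) M).
    by exists (e1 n).
  move=> K' [A' famA'].
  (* The candidate family at index [n] and the empty family at every other index. *)
  pose B (i : 'I_n1) : {K : nat & 'I_K -> set (measurableTypeR R)} :=
    if i == n then existT _ K' A' else existT _ 0%N (e1 i).
  have famB i : positive_family (co_m1 (crd f) i) (projT2 (B i)).
    by rewrite /B; case: eqVneq => [->|_]; [exact: famA'|exact: empty].
  have := family_bound extf (empty _ _ _ e0) famB (fun n => empty _ _ _ (e2 n)).
  apply: leq_trans; rewrite add0n (bigD1 n)//= {1}/B eqxx -!addnA leq_addr //.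
have /choice[K2 K2P] (n : 'I_n2) : exists K, (exists A : 'I_K -> set (measurableTypeR R),
    positive_family (co_m2 (crd f) n) A) /\ ~ exists A : 'I_K.+1 -> set (measurableTypeR R),
    positive_family (co_m2 (crd f) n) A.
  apply: (@maximal_index (fun K => exists A : 'I_K -> set (measurableTypeR R), positive_family _ A) M).
    by exists (e2 n).
  move=> K' [A' famA'].
  pose B (i : 'I_n2) : {K : nat & 'I_K -> set (measurableTypeR R)} :=
    if i == n then existT _ K' A' else existT _ 0%N (e2 i).
  have famB i : positive_family (co_m2 (crd f) i) (projT2 (B i)).
    by rewrite /B; case: eqVneq => [->|_]; [exact: famA'|exact: empty].
  have := family_bound extf (empty _ _ _ e0) (fun n => empty _ _ _ (e1 n)) famB.
  apply: leq_trans; have le : (K' <= \sum_i projT1 (B i))%N.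
    by rewrite (bigD1 n)//= {1}/B eqxx leq_addr.
  exact: leq_trans le (leq_trans (leq_addl _ _) (leq_addr _ _)).
have /all_sig[A1 A1P] n : {A : 'I_(K1 n) -> set (measurableTypeR R) | positive_family (co_m1 (crd f) n) A}.
  by apply: cid; exact: (K1P n).1.
have /all_sig[A2 A2P] n : {A : 'I_(K2 n) -> set (measurableTypeR R) | positive_family (co_m2 (crd f) n) A}.
  by apply: cid; exact: (K2P n).1.
have pid1 (p : R -> R) : List.In p [:: id] -> measurable_fun (setT : set (measurableTypeR R)) p.
  by move=> [<-|[]].
have sep1 (x y : R) : (forall p : R -> R, List.In p [:: id] -> p x = p y) -> x = y.
  by move=> /(_ id); apply; left.
have pid2 (p : R * R -> R) : List.In p [:: fst; snd] ->
    measurable_fun (setT : set (measurableTypeR R * measurableTypeR R)) p.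
  by move=> [<-|[<-|[]]].
have sep2 (x y : R * R) : (forall p : R * R -> R, List.In p [:: fst; snd] -> p x = p y) -> x = y.
  move=> H; rewrite (surjective_pairing x) (surjective_pairing y).
  by rewrite (H fst) ?(H snd)//; [right; left|left].
have [x [a xa]] := atomic_charge famA (fun A' famA' => maxA (ex_intro _ A' famA')) pid2 sep2.
have /all_sig[y1 y1P] n : {x : 'I_(K1 n) -> R | exists b : 'I_(K1 n) -> R, forall (h : R -> R) (s : R),
    measurable_fun (setT : set (measurableTypeR R)) h -> bounded_by s h ->
    charge_int (co_m1 (crd f) n) h = \sum_k b k * h (x k)}.
  by apply: cid; exact: (atomic_charge (A1P n) (fun A' famA' => (K1P n).2 (ex_intro _ A' famA')) pid1 sep1).
have /all_sig[b bP] n := cid (y1P n).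
have /all_sig[y2 y2P] n : {x : 'I_(K2 n) -> R | exists b : 'I_(K2 n) -> R, forall (h : R -> R) (s : R),
    measurable_fun (setT : set (measurableTypeR R)) h -> bounded_by s h ->
    charge_int (co_m2 (crd f) n) h = \sum_k b k * h (x k)}.
  by apply: cid; exact: (atomic_charge (A2P n) (fun A' famA' => (K2P n).2 (ex_intro _ A' famA')) pid1 sep1).
have /all_sig[c cP] n := cid (y2P n).
exists K, K1, K2, a, (fun k => (x k).1), (fun k => (x k).2), b, y1, c, y2, (fun n n' => co_d (crd f) n n').
split; first exact: (family_bound extf famA A1P A2P).
move=> t1 t2; rewrite native_funE /synth.
have [mK [s Ks]] := kernel_product_section S1 S2 t1 t2.
have [mK1 [s1 Ks1]] := kernel_section S1 t1; have [mK2 [s2 Ks2]] := kernel_section S2 t2.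
congr (_ + _ + _ + _).
- by rewrite (xa _ _ mK Ks); apply: eq_bigr => k _; rewrite mulrA.
- apply: eq_bigr => n _; rewrite (bP n _ _ mK2 Ks2) mulr_sumr; apply: eq_bigr => k _; by ring.
- apply: eq_bigr => n _; rewrite (cP n _ _ mK1 Ks1) mulr_suml; apply: eq_bigr => k _; by ring.
Qed.

End extreme_point_form.

Theorem theorem9 (R : realType) (alpha1 alpha2 : R) (N1 N2 M : nat)
  (hN1 : (1 <= N1)%N) (hN2 : (1 <= N2)%N)
  (S1 : admissible_system alpha1 N1) (S2 : admissible_system alpha2 N2)
  (nu : native S1 S2 -> 'rV[R]_M)
  (nu_linear : native_linear nu)
  (nu_continuous : continuous nu)
  (nu_surjective : forall z : 'rV[R]_M, exists f, nu f = z)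
  (nu_injective : set_inj (null_tensor (S1 := S1) (S2 := S2)) nu)
  (E : 'rV[R]_M -> 'rV[R]_M -> \bar R)
  (E_ge0 : forall y z, (0 <= E y z)%E)
  (E_proper : forall y, proper_fun (E y))
  (E_coercive : forall y, coercive_fun (E y))
  (E_lsc : forall y, lower_semicontinuous (E y))
  (E_sconvex : forall y, strictly_convex_fun (E y))
  (y : 'rV[R]_M) (lambda : R) (hlambda : 0 < lambda) :
  let V := argmin (fun f : native S1 S2 =>
             (E y (nu f) + (lambda * native_seminorm f)%:E)%E) in
  [/\ V !=set0,
      compact V,
      V = closure (convex_hull (extreme_points V))
    & forall f, extreme_points V f ->
        exists (K : nat) (K1 : 'I_N1 -> nat) (K2 : 'I_N2 -> nat)
          (a x1 x2 : 'I_K -> R)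
          (b yk : forall n : 'I_N1, 'I_(K1 n) -> R)
          (c zk : forall n' : 'I_N2, 'I_(K2 n') -> R)
          (d : 'I_N1 -> 'I_N2 -> R),
          (K + \sum_(n < N1) K1 n + \sum_(n' < N2) K2 n' + N1 * N2 <= M)%N /\
          forall t1 t2, native_fun f t1 t2 =
            \sum_(k < K) a k * kernel_phi S1 t1 (x1 k) * kernel_phi S2 t2 (x2 k)
            + \sum_(n < N1) \sum_(m < K1 n)
                b n m * sys_p S1 n t1 * kernel_phi S2 t2 (yk n m)
            + \sum_(n' < N2) \sum_(m' < K2 n')
                c n' m' * kernel_phi S1 t1 (zk n' m') * sys_p S2 n' t2
            + \sum_(n < N1) \sum_(n' < N2)
                d n n' * sys_p S1 n t1 * sys_p S2 n' t2].
Proof.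
(* Positive orders are written as successors, the form in which the Green's function has exponent
   [k]. *)
case: N1 N2 hN1 hN2 S1 S2 nu nu_linear nu_continuous nu_surjective nu_injective =>
  [//|k1] [//|k2] _ _ S1 S2 nu nu_linear nu_continuous nu_surjective nu_injective V.
have [z0 [sigma [VE V0 cV sigma_min]]] := minimizers_spec nu_linear nu_continuous nu_injective
  nu_surjective (E_ge0 y) (E_proper y) (E_coercive y) (@E_lsc y) (E_sconvex y) hlambda.
split=> //.
(* The solution set is convex by its description: [nu] is linear and the seminorm is convex. *)
- apply: (native_krein_milman nu_linear cV); rewrite VE => f [k [w [g [w0 w1 Vg fE]]]].
  have [h [hE hnu _ hs _]] := native_sum nu_linear (index_enum 'I_k) w g.
  have <- : h = f by apply: native_fun_inj => t1 t2; rewrite hE fE.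
  split.
    rewrite hnu (eq_bigr (fun i => w i *: z0)) => [|i _]; last by have [-> _] := Vg i.
    by rewrite -scaler_suml w1 scale1r.
  apply: (le_trans hs); rewrite -[sigma]mul1r -w1 mulr_suml; apply: ler_sum => i _.
  by rewrite ger0_norm// ler_wpM2l//; have [] := Vg i.
- move=> f; exact: (extreme_point_form nu_linear VE sigma_min).
Qed.
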